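(* Let $1+\frac1n<p<1+\frac{3}{2n}$ and $f(\xi)=|\xi|^{p-1}\xi$. Let $u_0\in L^1_1(\mathbb R^n)\cap L^\infty(\mathbb R^n)$ and let $u$ be the global solution with initial datum $u_0$. Then for every $q\in[1,\infty]$, $$\lim_{t\to\infty}t^{\frac n2(1-\frac1q)+2\sigma}\|u(t)-\mathcal A_{0,1}(t)\|_q=\|\mathcal R^*_{0,2}\|_q,$$ where $\mathcal R^*_{0,2}=\int_0^1a\cdot\nabla e^{(1-\theta)\Delta}\big((\mathcal A_{0,1}(\theta)-\mathcal A_0(\theta))f'(\mathcal A_0(\theta))\big)d\theta=f(\mathcal M_0(u_0))f'(\mathcal M_0(u_0))\int_0^1a\cdot\nabla e^{(1-\theta)\Delta}\Big(G_\theta^{p-1}\int_0^\theta a\cdot\nabla e^{(\theta-\tau)\Delta}G_\tau^p\,d\tau\Big)d\theta.$ In particular, if $f(\mathcal M_0(u_0))f'(\mathcal M_0(u_0))\ne0$, then $\mathcal R^*_{0,2}\not\equiv0$ and $t^{\frac n2(1-\frac1q)}\|u(t)-\mathcal A_{0,1}(t)\|_q=t^{-2\sigma}\|\mathcal R^*_{0,2}\|_q(1+o(1))$ as $t\to\infty$ for all $q\in[1,\infty]$.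
   Context: Let $n\ge1$, $a=(a_1,\dots,a_n)\in\mathbb R^n\setminus\{0\}$. $\|\cdot\|_q$ is the $L^q(\mathbb R^n)$ norm; $L^1_1=\{\varphi\in L^1: x_j\varphi\in L^1\ \forall j\}$. $G_t(x)=(4\pi t)^{-n/2}e^{-|x|^2/(4t)}$, $e^{t\Delta}\varphi=G_t*\varphi$. The global solution for $u_0\in L^1\cap L^\infty$ is the unique $u\in (C\cap L^\infty)([0,\infty);L^1)\cap(C\cap L^\infty)((0,\infty);L^\infty)$ with $u(t)=e^{t\Delta}u_0+\int_0^ta\cdot\nabla e^{(t-s)\Delta}f(u(s))ds$ for all $t>0$ (solution of $\partial_tu-\Delta u=a\cdot\nabla f(u)$, $u(0)=u_0$). $\mathcal M_0(\varphi)=\int\varphi$; $\mathcal A_0(t)=\mathcal M_0(u_0)G_t$; $\sigma=\frac n2(p-1)-\frac12$; $\mathcal A_{0,1}(t)=\mathcal A_0(t)+\int_0^ta\cdot\nabla e^{(t-s)\Delta}f(\mathcal A_0(s))ds$ for $t>0$. *)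

(* Defs.v *)
From HB Require Import structures.
From mathcomp Require Import all_boot all_order all_algebra.
From mathcomp Require Import all_classical all_reals all_analysis.
Set Implicit Arguments. Unset Strict Implicit. Unset Printing Implicit Defensive.
Import Order.TTheory GRing.Theory Num.Theory.
Import numFieldNormedType.Exports.
Local Open Scope classical_set_scope.
Local Open Scope ring_scope.

Definition sqnorm (R : realType) (n : nat) (x : 'rV[R]_n) : R :=
  \sum_(i < n) x 0 i ^+ 2.

(* Lebesgue integral over R^n, computed as the iterated one-dimensional
   Lebesgue integral  int dx_1 int dx_2 ... int dx_n g(x)  (Fubini/Tonelli). *)
Fixpoint iint (R : realType) (n : nat) : ('rV[R]_n -> \bar R) -> \bar R :=
  match n return ('rV[R]_n -> \bar R) -> \bar R with
  | 0 => fun g => g 0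
  | n'.+1 => fun g =>
      (\int[@lebesgue_measure R]_(s in [set: R])
          iint (fun y : 'rV[R]_n' => g (row_mx (const_mx (s : R) : 'rV[R]_1) y)))%E
  end.

Definition iintR (R : realType) (n : nat) (g : 'rV[R]_n -> R) : R :=
  fine (iint (fun y => (g y)%:E)).

Definition rn_null (R : realType) (n : nat) (A : set 'rV[R]_n) : Prop :=
  forall e : R, 0 < e -> exists lo hi : nat -> 'rV[R]_n,
    A `<=` \bigcup_k [set x | forall i, lo k 0 i <= x 0 i <= hi k 0 i] /\
    (\sum_(0 <= k <oo) (\prod_(i < n) Num.max 0 (hi k 0 i - lo k 0 i))%:E
       < e%:E)%E.

Definition esssup (R : realType) (n : nat) (g : 'rV[R]_n -> R) : \bar R :=
  ereal_inf [set M : \bar R | rn_null [set x | (M < (`|g x|)%:E)%E]].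

Definition Lq (R : realType) (n : nat) (q : \bar R) (g : 'rV[R]_n -> R)
  : \bar R :=
  match q with
  | r%:E => ((iint (fun x => (`|g x| `^ r)%:E)) `^ r^-1)%E
  | +oo%E => esssup g
  | -oo%E => 0%E
  end.

Definition inv_exp (R : realType) (q : \bar R) : R :=
  match q with r%:E => r^-1 | _ => 0 end.

Definition rn_measurable (R : realType) (n : nat) (g : 'rV[R]_n -> R) : Prop :=
  forall B : set R, measurable B ->
    (<<s [set U : set 'rV[R]_n | open U] >>) (g @^-1` B).

Definition gauss (R : realType) (n : nat) (t : R) (x : 'rV[R]_n) : R :=
  (4 * pi * t) `^ (- (n%:R / 2)) * expR (- sqnorm x / (4 * t)).

Definition heat (R : realType) (n : nat) (t : R) (phi : 'rV[R]_n -> R)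
  (x : 'rV[R]_n) : R :=
  iintR (fun y => gauss t (x - y) * phi y).

Definition adgrad (R : realType) (n : nat) (a : 'rV[R]_n)
  (F : 'rV[R]_n -> R) (x : 'rV[R]_n) : R := 'D_a F x.

Definition duhamel (R : realType) (n : nat) (a : 'rV[R]_n)
  (g : R -> 'rV[R]_n -> R) (t : R) (x : 'rV[R]_n) : R :=
  Rintegral (@lebesgue_measure R) `[0, t]
    (fun s => adgrad a (heat (t - s) (g s)) x).

Definition fnl (R : realType) (p : R) (xi : R) : R := `|xi| `^ (p - 1) * xi.

Definition M0 (R : realType) (n : nat) (phi : 'rV[R]_n -> R) : R := iintR phi.

Definition A0 (R : realType) (n : nat) (u0 : 'rV[R]_n -> R) (t : R)
  (x : 'rV[R]_n) : R := M0 u0 * gauss t x.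

Definition A01 (R : realType) (n : nat) (p : R) (a : 'rV[R]_n)
  (u0 : 'rV[R]_n -> R) (t : R) (x : 'rV[R]_n) : R :=
  A0 u0 t x + duhamel a (fun s y => fnl p (A0 u0 s y)) t x.

Definition sigma (R : realType) (n : nat) (p : R) : R :=
  n%:R / 2 * (p - 1) - 2^-1.

Definition Rstar (R : realType) (n : nat) (p : R) (a : 'rV[R]_n)
  (u0 : 'rV[R]_n -> R) (x : 'rV[R]_n) : R :=
  duhamel a (fun th y => (A01 p a u0 th y - A0 u0 th y)
                          * derive1 (fnl p) (A0 u0 th y)) 1 x.

(* the global solution of  u_t - Delta u = a.grad f(u), u(0) = u0 *)
Definition global_solution (R : realType) (n : nat) (p : R) (a : 'rV[R]_n)
  (u0 : 'rV[R]_n -> R) (u : R -> 'rV[R]_n -> R) : Prop :=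
  [/\ (* each u(t) is (a Borel representative of) a measurable function *)
      (forall t, 0 <= t -> rn_measurable (u t)),
      [/\ (forall t, 0 <= t -> (Lq 1%E (u t) < +oo)%E),
      (forall t, 0 <= t -> forall e : R, 0 < e -> exists2 d : R, 0 < d &
         forall s, 0 <= s -> `|s - t| < d ->
           (Lq 1%E (fun x => (u s x - u t x)%R) < e%:E)%E) &
      (exists C : R, forall t, 0 <= t -> (Lq 1%E (u t) <= C%:E)%E)],
      [/\ (forall t, 0 < t -> (Lq +oo%E (u t) < +oo)%E),
          (forall t, 0 < t -> forall e : R, 0 < e -> exists2 d : R, 0 < d &
            forall s, 0 < s -> `|s - t| < d ->
              (Lq +oo%E (fun x => (u s x - u t x)%R) < e%:E)%E) &
          (exists C : R, forall t, 0 < t -> (Lq +oo%E (u t) <= C%:E)%E)] &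
      (* the integral equation, for all t > 0 (as elements of L^1: a.e. in x) *)
      forall t, 0 < t ->
        rn_null [set x | u t x <> heat t u0 x
                          + duhamel a (fun s y => fnl p (u s y)) t x]].

(* Main.v *)
From Pilot Require Import Defs.
From HB Require Import structures.
From mathcomp Require Import all_boot all_order all_algebra.
From mathcomp Require Import all_classical all_reals all_analysis measurable_realfun.
From mathcomp Require Import ring lra.
Import Order.TTheory GRing.Theory Num.Theory.
Import numFieldNormedType.Exports.
Import Pilot.Defs.
Set Implicit Arguments. Unset Strict Implicit. Unset Printing Implicit Defensive.
Local Open Scope classical_set_scope.
Local Open Scope ring_scope.

(** Testing the equation with u itself kills the nonlinear term in the L^2 balance, because
    [a . grad w * f(w)] is a divergence; hence |u(t)|_2 -> 0.  As p > 1 + 1/n, diffusion dominates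
    for small solutions, and bootstrapping the integral equation from this smallness gives
    |u(t,x)| <= C t^{-n/2}.  Say that w has size r at time t if |w|_1 <= r and
    |w| <= r t^{-n/2}: a Duhamel integral with source of size s^{-c}, 0 <= c < 1, has size
    t^{1/2-c}.  So f(u) has size s^{-(sigma+1/2)}, u - A_0 has size t^{-sigma}, u - A_{0,1} has size
    t^{-2 sigma}, and by Taylor's formula u - A_{0,1} equals R(t), the Duhamel integral
    of (A_{0,1} - A_0) f'(A_0), up to size t^{-2 sigma - delta}.  Parabolic scaling turns R(t)
    into R*_{0,2}.  Finally e^{Delta} R*_{0,2} at the origin is an integral of terms of constant
    sign, so that R*_{0,2} does not vanish. *)

(** * Iterated Lebesgue measure *)

(** Two obstacles shape the proof. The solution is a family of functions, each measurable in x
    alone, while every Duhamel estimate needs Fubini in (t, x); a jointly measurable version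
    satisfying the integral equation at every point is therefore built. And u is only a mild
    solution, so its energy is never differentiated in time: the decrease over a step h comes from
    midpoint convexity along the heat flow, and the nonlinear term costs only h^{5/4}, because a .
    grad e^{r Delta} u loses r^{-1/8} while u moves by r^{3/8} in L^1. The bounds on p enter through
    sigma: p > 1 + 1/n means sigma > 0, and p < 1 + 3/(2n) means sigma < 1/4. The latter makes the
    source of R(t), of size s^{-(2 sigma + 1/2)}, integrable at s = 0, and makes the error between
    e^{t Delta} u_0 and A_0, of size t^{-1/2} thanks to the first moment, negligible against t^{-2
    sigma}. As f' need not be Lipschitz at 0, the Taylor gain is taken with the exponent (p - 1)/2.
    No interpolation in q is carried out: L^1 and pointwise bounds on one rescaled difference give
    convergence for all q. *)

Fact rV_display : measure_display. Proof. exact. Qed.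

(** The Borel sets of [rn_measurable] become the measurable structure of row vectors, so that this
    predicate turns into [measurable_fun] and the general theory of integration applies. *)
HB.instance Definition _ (R : realType) (n : nat) :=
  @isMeasurable.Build rV_display 'rV[R]_n <<s [set U : set 'rV[R]_n | open U] >>
    (@sigma_algebra0 _ setT _) (@sigma_algebraC _ _) (@sigma_algebra_bigcup _ setT _).

Section rV_measurable.
Context {R : realType} {n : nat}.

Lemma rn_measurableE (g : 'rV[R]_n -> R) : rn_measurable g <-> measurable_fun setT g.
Proof.
split=> [mg _ B mB|mg B mB]; first by rewrite setTI; exact: mg.
by rewrite -[_ @^-1` _]setTI; exact: mg.
Qed.

Lemma measurable_coord (i : 'I_n) : measurable_fun setT (fun x : 'rV[R]_n => x 0 i).
Proof.
have h : @measurable_fun _ _ 'rV[R]_n (measurableTypeR R) setT (fun x => x 0 i).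
  apply: (measurability _ (RGenOInfty.measurableE R)) => _ [_ [a ->] <-].
  rewrite setTI; apply: sub_sigma_algebra => /=.
  apply: open_comp; last exact: interval_open.
  by move=> x _; apply: coord_continuous.
exact: h.
Qed.

(** An open set is the countable union of the boxes with rational centre and radius 1/(k+1) that it
    contains, so the coordinates generate the Borel sets. *)
Lemma measurable_rV d (T : measurableType d) (f : T -> 'rV[R]_n) :
  (forall i, measurable_fun setT (fun x => f x 0 i)) -> measurable_fun setT f.
Proof.
move=> mf.
apply: (@measurability _ _ _ _ _ _ [set U : set 'rV[R]_n | open U]) => //.
move=> _ [U oU <-]; rewrite setTI.
pose box (q : 'rV[rat]_n) (k : nat) : set 'rV[R]_n :=
  [set x | forall i, ball (ratr (q 0 i) : R) k.+1%:R^-1 (x 0 i)].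
have -> : U = \bigcup_(p in [set p : 'rV[rat]_n * nat | box p.1 p.2 `<=` U]) box p.1 p.2.
  apply/seteqP; split=> [x Ux|x [p /= pU]]; last exact: pU.
  have /nbhs_ballP[e /= e0 xe] := open_nbhs_nbhs (conj oU Ux).
  (* Radius below e / 2: a point of the box is within two radii of x, through the rational
     centre. *)
  pose k := Num.truncn (2 / e).
  have ke : k.+1%:R^-1 < e / 2 :> R.
    rewrite invf_plt ?posrE ?divr_gt0// invf_div.
    by rewrite truncnS_gt.
  have /choice[q qE] : forall i : 'I_n, exists q : rat, ball (x 0 i) k.+1%:R^-1 (ratr q : R).
    move=> i.
    have [q] := @rat_in_itvoo R (x 0 i - k.+1%:R^-1) (x 0 i + k.+1%:R^-1) ltac:(by rewrite ltrD2l gtrN).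
    rewrite in_itv/= => /andP[q1 q2]; exists q.
    by rewrite /ball/= ltr_distlC q1.
  exists (\row_i q i, k) => /=.
    move=> y yb; apply: xe; split=> // i j; rewrite ord1.
    have := yb j; have := qE j; rewrite /= mxE /ball/= => h1 h2.
    have := ler_normD (x 0 j - ratr (q j)) (ratr (q j) - y 0 j).
    rewrite addrA subrK => /le_lt_trans; apply.
    by rewrite (splitr e) ltrD// (lt_trans _ ke).
  by move=> i; rewrite /= mxE; exact/ball_sym.
rewrite preimage_bigcup.
rewrite (_ : \bigcup_(i in _) _ = \bigcup_i (if pselect (box i.1 i.2 `<=` U) then f @^-1` box i.1 i.2 else set0)); last first.
  apply/seteqP; split=> x [p].
    by move=> /= h ?; exists p => //; case: pselect.
  by move=> _; case: pselect => // h ?; exists p.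
apply: countable_bigcupT_measurable; first exact: countableP.
move=> p; case: (pselect (box p.1 p.2 `<=` U)) => [pU|pU] //=.
rewrite (_ : _ @^-1` _ = \bigcap_(i in [set` finset.setT]) (fun x => f x 0 i) @^-1` ball (ratr (p.1 0 i) : R) p.2.+1%:R^-1).
  apply: fin_bigcap_measurable => // i _; rewrite -[X in measurable X]setTI; apply: mf => //.
  by rewrite ball_itv; exact: measurable_itv.
by apply/seteqP; split=> x /= h i; [move=> _|]; apply: h => //=; rewrite inE.
Qed.

End rV_measurable.

(** * One-dimensional Lebesgue measure *)

Section leb.
Context {R : realType}.

(* [lebesgue_measure] lives on [measurableTypeR R]; this copy lives on the canonical
   measurable structure of [R] itself *)
Definition leb : set R -> \bar R := @lebesgue_measure R.

Let leb0 : leb set0 = 0%E. Proof. exact: (@measure0 _ _ _ (@lebesgue_measure R)). Qed.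
Let leb_ge0 A : (0 <= leb A)%E. Proof. exact: (@measure_ge0 _ _ _ (@lebesgue_measure R)). Qed.
Let leb_additive : semi_sigma_additive leb.
Proof. exact: (@measure_semi_sigma_additive _ _ _ (@lebesgue_measure R)). Qed.
HB.instance Definition _ := isMeasure.Build _ R R leb leb0 leb_ge0 leb_additive.

Let leb_sigma_finite : sigma_finite setT leb.
Proof. exact: (@sigma_finiteT _ _ _ (@lebesgue_measure R)). Qed.
HB.instance Definition _ := Measure_isSigmaFinite.Build _ _ _ leb leb_sigma_finite.

Lemma measurable_idR : @measurable_fun _ _ (measurableTypeR R) R setT (fun x => x).
Proof. by move=> _ A mA; rewrite setTI. Qed.

Let ge0_integral_leb D (f : R -> \bar R) : measurable D -> measurable_fun D f ->
  (forall x, 0 <= f x)%E ->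
  (\int[@lebesgue_measure R]_(x in D) f x = \int[leb]_(x in D) f x)%E.
Proof.
move=> mD mf f0.
have := @ge0_integral_pushforward _ _ (measurableTypeR R) R R (fun x => x) measurable_idR
  (@lebesgue_measure R) D f mD mf (fun x _ => f0 x).
move=> /= <-; apply: eq_measure_integral => A mA AD; reflexivity.
Qed.

(** The two copies are related by a pushforward along the identity, applied to positive and negative
    parts. *)
Lemma integral_leb D (f : R -> \bar R) : measurable D -> measurable_fun D f ->
  (\int[@lebesgue_measure R]_(x in D) f x = \int[leb]_(x in D) f x)%E.
Proof.
move=> mD mf; rewrite integralE [RHS]integralE.
by rewrite !ge0_integral_leb//; [exact: measurable_funeneg|exact: measurable_funepos].
Qed.

Lemma Rintegral_leb D (f : R -> R) : measurable D -> measurable_fun D f ->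
  \int[@lebesgue_measure R]_(x in D) f x = \int[leb]_(x in D) f x.
Proof.
move=> mD mf; rewrite /Rintegral integral_leb//; exact/measurable_EFinP.
Qed.
End leb.

(** * Lebesgue measure on row vectors *)

Section muR.
Context {R : realType}.

(** The gluing of a first coordinate in [iint], uncurried so that a product measure can be pushed
    forward along it. *)
Definition rcons_mx n (p : R * 'rV[R]_n) : 'rV[R]_n.+1 :=
  row_mx (const_mx p.1 : 'rV[R]_1) p.2.

Lemma rcons_mx0 n (p : R * 'rV[R]_n) : rcons_mx p 0 ord0 = p.1.
Proof.
rewrite /rcons_mx mxE; case: splitP => [j _|j]; first by rewrite mxE.
by move=> /= /eqP.
Qed.

Lemma rcons_mxS n (p : R * 'rV[R]_n) i : rcons_mx p 0 (lift ord0 i) = p.2 0 i.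
Proof.
rewrite /rcons_mx mxE; case: splitP => [j|j]; first by rewrite ord1.
by rewrite /= /bump/= => -[/val_inj ->].
Qed.

Lemma measurable_rcons_mx n : measurable_fun setT (@rcons_mx n).
Proof.
apply: measurable_rV => i; case: (unliftP ord0 i) => [j|] ->.
  under eq_fun do rewrite rcons_mxS.
  by apply: (@measurableT_comp _ _ _ _ _ _ (fun y : 'rV[R]_n => y 0 j) setT snd) => //; exact: measurable_coord.
under eq_fun do rewrite rcons_mx0.
exact: (@measurable_fst _ _ R 'rV[R]_n).
Qed.

Definition behead_mx n (x : 'rV[R]_n.+1) : 'rV[R]_n := \row_i x 0 (lift ord0 i).

Lemma behead_rcons n (p : R * 'rV[R]_n) : behead_mx (rcons_mx p) = p.2.
Proof. by apply/rowP => i; rewrite mxE rcons_mxS. Qed.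

Lemma measurable_behead n : measurable_fun setT (@behead_mx n).
Proof.
apply: measurable_rV => i; under eq_fun do rewrite mxE.
exact: measurable_coord.
Qed.

Section step.
Context {n : nat} (m : {sigma_finite_measure set 'rV[R]_n -> \bar R}).

Definition mstep : set 'rV[R]_n.+1 -> \bar R :=
  pushforward (@leb R \x m)%E (@rcons_mx n).

HB.instance Definition _ := Measure.copy mstep
  (measure_function_pushforward__canonical__measure_function_Measure
    (@leb R \x m)%E (@measurable_rcons_mx n)).

Let sigma_finite_mstep : sigma_finite setT mstep.
Proof.
have /sigma_finiteP[F [TF ndF Foo]] := sigma_finiteT (@leb R).
have /sigma_finiteP[G [TG ndG Goo]] := sigma_finiteT m.
exists (fun k => (fun x : 'rV[R]_n.+1 => (x 0 ord0, behead_mx x)) @^-1` (F k `*` G k)).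
  rewrite -preimage_bigcup (_ : \bigcup_k _ = setT) ?preimage_setT//.
  apply/seteqP; split=> // -[x y] _.
  have [i _ Fi] : (\bigcup_i F i) x by rewrite -TF.
  have [j _ Gj] : (\bigcup_i G i) y by rewrite -TG.
  exists (maxn i j) => //; split.
    by move: x Fi; exact/subsetPset/ndF/leq_maxl.
  by move: y Gj; exact/subsetPset/ndG/leq_maxr.
move=> k; have [mF Fk] := Foo k; have [mG Gk] := Goo k.
split.
  rewrite -[X in measurable X]setTI; apply: measurable_fun_pair => //.
  - exact: measurable_coord.
  - exact: measurable_behead.
  - exact: measurableX.
have : ((@leb R \x m) (F k `*` G k) < +oo)%E.
  by rewrite product_measure1E// lte_mul_pinfty// ge0_fin_numE.
rewrite /mstep /pushforward; congr ((_ \x _) _ < _)%E.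
by apply/seteqP; split=> -[a b] /=; rewrite rcons_mx0 behead_rcons.
Qed.

HB.instance Definition _ := Measure_isSigmaFinite.Build _ _ _ mstep sigma_finite_mstep.
End step.

Section base.
(** In dimension 0 [iint] evaluates at the only point, which is integration against a Dirac mass. *)
Definition mbase : set 'rV[R]_0 -> \bar R := \d_ (0 : 'rV[R]_0).
HB.instance Definition _ := Measure.on mbase.
Let sigma_finite_mbase : sigma_finite setT mbase.
Proof. by apply: fin_num_fun_sigma_finite; [rewrite /mbase measure0|exact: fin_num_measure]. Qed.
HB.instance Definition _ := Measure_isSigmaFinite.Build _ _ _ mbase sigma_finite_mbase.
End base.

(** Lebesgue measure on R^n, built by the recursion that [iint] follows, so that Tonelli and Fubini
    identify the two by induction on n. *)
Fixpoint rvm n : {sigma_finite_measure set 'rV[R]_n -> \bar R} :=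
  match n with
  | 0 => mbase
  | n'.+1 => mstep (rvm n')
  end.

Lemma ge0_integral_rvmS n (g : 'rV[R]_n.+1 -> \bar R) : measurable_fun setT g ->
  (forall x, 0 <= g x)%E ->
  (\int[rvm n.+1]_x g x = \int[(@leb R \x rvm n)%E]_z g (rcons_mx z))%E.
Proof.
move=> mg g0.
have := @ge0_integral_pushforward _ _ (R * 'rV[R]_n)%type 'rV[R]_n.+1 R _ (@measurable_rcons_mx n) (leb \x rvm n)%E setT g.
by rewrite preimage_setT => /(_ measurableT mg); apply.
Qed.

Lemma measurable_comp_rcons n d (U : measurableType d) (g : 'rV[R]_n.+1 -> U) :
  measurable_fun setT g -> measurable_fun setT (g \o @rcons_mx n).
Proof. by move=> mg; apply: measurableT_comp => //; exact: measurable_rcons_mx. Qed.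

Lemma measurable_comp_rcons2 n d (U : measurableType d) (g : 'rV[R]_n.+1 -> U) s :
  measurable_fun setT g -> measurable_fun setT (fun y => g (rcons_mx (s, y))).
Proof.
by move=> mg; exact: (measurable_fun_pair2 s (measurable_comp_rcons mg)).
Qed.

(** Slices may fail to be integrable, so positive and negative parts are treated separately by
    Tonelli; a difference of extended real functions is still measurable. *)
Lemma measurable_integral_snd d1 d2 (T1 : measurableType d1) (T2 : measurableType d2)
  (m2 : {sigma_finite_measure set T2 -> \bar R}) (f : T1 * T2 -> \bar R) :
  measurable_fun setT f -> measurable_fun setT (fun x => \int[m2]_y f (x, y))%E.
Proof.
move=> mf.
rewrite (_ : (fun x => _) = (fun x => \int[m2]_y f^\+ (x, y) - \int[m2]_y f^\- (x, y))%E); last first.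
  apply/funext => x; rewrite integralE; congr (_ - _)%E.
  - by apply: eq_integral => y _; rewrite funepos_comp.
  - by apply: eq_integral => y _; rewrite funeneg_comp.
apply: emeasurable_funB.
- by apply: (measurable_fun_fubini_tonelli_F f^\+%E) => //; exact: measurable_funepos.
- by apply: (measurable_fun_fubini_tonelli_F f^\-%E) => //; exact: measurable_funeneg.
Qed.

(** The parameter space X makes the induction possible: at each step the outermost integration
    variable joins the parameters. *)
Lemma measurable_iint n d (X : measurableType d) (G : X * 'rV[R]_n -> \bar R) :
  measurable_fun setT G -> measurable_fun setT (fun x => iint (fun y => G (x, y))).
Proof.
elim: n d X G => [|n IH] d X G mG /=.
  exact: (measurable_fun_pair1 (0 : 'rV[R]_0) mG).
pose H (z : X * R) := iint (fun y => G (z.1, rcons_mx (z.2, y))).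
have mH : measurable_fun setT H.
  apply: (IH _ _ (fun w : (X * R) * 'rV[R]_n => G (w.1.1, rcons_mx (w.1.2, w.2)))).
  apply: (measurableT_comp mG); apply: measurable_fun_pair.
    exact: (measurableT_comp measurable_fst measurable_fst).
  apply: (measurableT_comp (@measurable_rcons_mx n)); apply: measurable_fun_pair => //.
  exact: (measurableT_comp measurable_snd measurable_fst).
rewrite (_ : (fun x => _) = (fun x => \int[leb]_s H (x, s))%E).
  exact: measurable_integral_snd.
apply/funext => x; rewrite -integral_leb//.
exact: (measurable_fun_pair2 x mH).
Qed.

Lemma ge0_iintE n (g : 'rV[R]_n -> \bar R) : measurable_fun setT g ->
  (forall x, 0 <= g x)%E -> iint g = (\int[rvm n]_x g x)%E.
Proof.
elim: n g => [|n IH] g mg g0.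
  have := @integral_dirac _ 'rV[R]_0 0 R setT measurableT g mg.
  by rewrite diracT mul1e => ->.
have mgr := measurable_comp_rcons mg.
rewrite ge0_integral_rvmS// fubini_tonelli1//= integral_leb//; last first.
  exact: (measurable_iint mgr).
apply: eq_integral => s _; apply: IH => //.
exact: (measurable_comp_rcons2 s mg).
Qed.

(** Fubini. The induction hypothesis holds only for almost every slice, so the outer integrands are
    compared almost everywhere, with measurability from [measurable_iint]. *)
Lemma iintE n (g : 'rV[R]_n -> \bar R) : (rvm n).-integrable setT g ->
  iint g = (\int[rvm n]_x g x)%E.
Proof.
elim: n g => [|n IH] g ig.
  have := @integral_dirac _ 'rV[R]_0 0 R setT measurableT g (measurable_int _ ig).
  by rewrite diracT mul1e => ->.
have mg : measurable_fun setT g by exact: measurable_int ig.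
have igr : (@leb R \x rvm n)%E.-integrable setT (g \o @rcons_mx n).
  apply/integrableP; split; first exact: measurable_comp_rcons.
  move/integrableP : ig => [_].
  by rewrite ge0_integral_rvmS//; exact: measurableT_comp.
have -> : (\int[rvm n.+1]_x g x = \int[(@leb R \x rvm n)%E]_z g (rcons_mx z))%E.
  have := @integral_pushforward _ _ (R * 'rV[R]_n)%type 'rV[R]_n.+1 R _ (@measurable_rcons_mx n) (leb \x rvm n)%E setT g.
  by rewrite preimage_setT => /(_ mg igr measurableT).
rewrite -(integral12_prod_meas1 igr) /=.
rewrite integral_leb//; last exact: (measurable_iint (measurable_comp_rcons mg)).
apply: ae_eq_integral => //=.
- exact: (measurable_iint (measurable_comp_rcons mg)).
- exact: (measurable_fubini_F igr).
- have := ae_integrable1 igr; apply: filterS => s hs _.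
  exact: (IH (fun y => g (rcons_mx (s, y))) hs).
Qed.

End muR.

Arguments rvm : simpl never.

(** * Affine changes of variables *)

Section affine.
Context {R : realType}.

Let maff (c b : R) : measurable_fun setT (fun x : R => c * x + b).
Proof. by apply: measurable_funD => //; exact: measurable_funM. Qed.

(** Uniqueness of Lebesgue measure: both sides agree on the intervals []p, q]]. For c < 0 the
    preimage is closed on the left and open on the right, which does not affect its length. *)
Lemma leb_affine (c b : R) A : c != 0 -> measurable A ->
  leb A = (`|c|%:E * leb ((fun x => (c * x + b)%R) @^-1` A))%E.
Proof.
move=> c0 mA.
have maff' : @measurable_fun _ _ R (measurableTypeR R) setT (fun x => c * x + b).
  exact: maff.
have nn : 0 <= `|c| by [].
pose nu := mscale (NngNum nn) (measure_function_pushforward__canonical__measure_function_Measure (@leb R) maff').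
have := @lebesgue_measure_unique R nu _ A mA; apply.
move=> _ [[p q]] _ <- /=.
rewrite /mscale /= /pushforward /leb.
have [cp|cn] := ltP 0 c.
  rewrite (_ : _ @^-1` _ = `](p - b) / c, (q - b) / c]%classic); last first.
    apply/seteqP; split=> x /=; rewrite !in_itv/= ltr_pdivrMr// ler_pdivlMr//;
      by rewrite ltrBlDr lerBrDr mulrC.
  rewrite !lebesgue_measure_itv/= !lte_fin ltr_pM2r ?invr_gt0// ltrD2r.
  case: ifPn => _; last by rewrite mule0.
  by rewrite -!EFinD -EFinM gtr0_norm//; congr EFin; field.
have {}cn : c < 0 by rewrite lt_neqAle c0.
rewrite (_ : _ @^-1` _ = `[(q - b) / c, (p - b) / c[%classic); last first.
  apply/seteqP; split=> x /=; rewrite !in_itv/= ltr_ndivlMr// ler_ndivrMr//;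
    by rewrite ltrBlDr lerBrDr mulrC andbC.
rewrite !lebesgue_measure_itv/= !lte_fin ltr_nM2r ?invr_lt0// ltrD2r.
case: ifPn => _; last by rewrite mule0.
by rewrite -!EFinD -EFinM ltr0_norm//; congr EFin; field.
Qed.

Lemma ge0_integral_leb_affine (c b : R) (g : R -> \bar R) : c != 0 ->
  measurable_fun setT g -> (forall x, 0 <= g x)%E ->
  (\int[leb]_x g (c * x + b)%R = (`|c|^-1)%:E * \int[leb]_x g x)%E.
Proof.
move=> c0 mg g0.
have nn : 0 <= `|c| by [].
pose nu := measure_function_pushforward__canonical__measure_function_Measure (@leb R) (maff c b).
have -> : (\int[leb]_x g x = \int[mscale (NngNum nn) nu]_x g x)%E.
  by apply: eq_measure_integral => A mA _; exact: (leb_affine b c0 mA).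
rewrite ge0_integral_mscale//= muleA -EFinM mulVf ?normr_eq0// mul1e.
have := @ge0_integral_pushforward _ _ R R R _ (maff c b) leb setT g.
by rewrite preimage_setT => /(_ measurableT mg (fun x _ => g0 x)).
Qed.

Lemma affine_rcons n (c : R) (b : 'rV[R]_n.+1) (z : R * 'rV[R]_n) :
  c *: rcons_mx z + b = rcons_mx (c * z.1 + b 0 ord0, c *: z.2 + behead_mx b).
Proof.
apply/rowP => i; case: (unliftP ord0 i) => [j|] ->.
  by rewrite rcons_mxS mxE [X in X + _]mxE rcons_mxS !mxE.
by rewrite rcons_mx0 mxE [X in X + _]mxE rcons_mx0.
Qed.

Lemma measurable_affine n (c : R) (b : 'rV[R]_n) : measurable_fun setT (fun x : 'rV[R]_n => c *: x + b).
Proof.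
apply: measurable_rV => i; under eq_fun do rewrite !mxE.
by apply: measurable_funD => //; apply: measurable_funM => //; exact: measurable_coord.
Qed.

(** Tonelli peels off one factor |c|^{-1} per coordinate. *)
Lemma ge0_integral_affine n (c : R) (b : 'rV[R]_n) (g : 'rV[R]_n -> \bar R) : c != 0 ->
  measurable_fun setT g -> (forall x, 0 <= g x)%E ->
  (\int[rvm n]_x g (c *: x + b)%R = (`|c| ^- n)%:E * \int[rvm n]_x g x)%E.
Proof.
move=> c0; elim: n b g => [|n IH] b g mg g0.
  rewrite expr0 invr1 mul1e; apply: eq_integral => x _.
  by rewrite (thinmx0 (_ + _)) (thinmx0 x).
have mga := measurableT_comp mg (measurable_affine c b).
rewrite ge0_integral_rvmS// ge0_integral_rvmS//.
rewrite fubini_tonelli1//=; last exact: measurable_comp_rcons mga.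
rewrite fubini_tonelli1//; last exact: measurable_comp_rcons.
rewrite /fubini_F /=.
have mF : measurable_fun setT (fun s => \int[rvm n]_y g (rcons_mx (s, y)))%E.
  apply: (measurable_fun_fubini_tonelli_F (g \o @rcons_mx R n)) => //=.
  exact: measurable_comp_rcons.
transitivity (\int[leb]_s ((`|c| ^- n)%:E *
    (\int[rvm n]_y g (rcons_mx ((c * s + b 0 ord0)%R, y)))))%E.
  apply: eq_integral => s _.
  rewrite -(IH (behead_mx b) (fun y => g (rcons_mx ((c * s + b 0 ord0)%R, y))))//; last first.
    exact: measurable_comp_rcons2.
  by apply: eq_integral => y _; rewrite affine_rcons.
have F0 : forall s : R, [set: R] s -> (0 <= \int[rvm n]_y g (rcons_mx (s, y)))%E.
  by move=> s _; exact: integral_ge0.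
rewrite (ge0_integral_leb_affine (b 0 ord0) c0 (g := fun s => ((`|c| ^- n)%:E * \int[rvm n]_y g (rcons_mx (s, y)))%E)).
- rewrite (@ge0_integralZl_EFin _ _ R leb setT measurableT _ F0 mF).
    by rewrite muleA -EFinM -invfM exprS.
  by rewrite invr_ge0 exprn_ge0.
- exact: measurable_funeM.
- move=> s; apply: mule_ge0; first by rewrite lee_fin invr_ge0 exprn_ge0.
  exact: integral_ge0.
Qed.

End affine.

(** * Coverings by boxes *)

Section null.
Context {R : realType}.

Definition cbox n (lo hi : 'rV[R]_n) : set 'rV[R]_n :=
  [set x | forall i, lo 0 i <= x 0 i <= hi 0 i].

Lemma measurable_cbox n (lo hi : 'rV[R]_n) : measurable (cbox lo hi).
Proof.
rewrite (_ : cbox lo hi = \bigcap_(i in [set` finset.setT]) (fun x : 'rV[R]_n => x 0 i) @^-1` `[lo 0 i, hi 0 i]%classic).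
  apply: fin_bigcap_measurable => // i _.
  by rewrite -[X in measurable X]setTI; exact: measurable_coord.
apply/seteqP; split=> x /= h i.
  by move=> _; rewrite /= in_itv/=; exact: h.
by have := h i; rewrite /= in_itv/=; apply; rewrite inE.
Qed.

Lemma rvm_cbox n (lo hi : 'rV[R]_n) :
  rvm n (cbox lo hi) = (\prod_(i < n) Num.max 0 (hi 0 i - lo 0 i))%:E.
Proof.
elim: n lo hi => [|n IH] lo hi.
  rewrite big_ord0 /= /mbase diracE mem_set// => -[] //.
rewrite big_ord_recl.
transitivity ((@leb R \x rvm n) (`[lo (0%R : 'I_1) ord0, hi (0%R : 'I_1) ord0]%classic `*` cbox (behead_mx lo) (behead_mx hi)))%E.
  rewrite /= /mstep /pushforward; congr ((_ \x _) _)%E.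
  apply/seteqP; split=> -[s y] /=.
    move=> h; split; first by have := h ord0; rewrite rcons_mx0 in_itv.
    by move=> i; have := h (lift ord0 i); rewrite rcons_mxS !mxE.
  rewrite in_itv/= => -[h1 h2] i; case: (unliftP ord0 i) => [j|] ->.
    by have := h2 j; rewrite rcons_mxS !mxE.
  by rewrite rcons_mx0.
rewrite product_measure1E//; last exact: measurable_cbox.
rewrite EFinM IH; congr (_ * (\prod_(i < n) _)%:E)%E; last first.
  by apply/funext => i; rewrite !mxE.
transitivity (@lebesgue_measure R `[lo 0 ord0, hi 0 ord0]%classic); first by [].
rewrite lebesgue_measure_itv/= lte_fin.
case: ltP => h; first by rewrite -EFinD; congr EFin; apply/esym/max_idPr; rewrite subr_ge0 ltW.
by congr EFin; apply/esym/max_idPl; rewrite subr_le0.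
Qed.

(** Intersecting, over m, coverings of total volume below 1/(m+1) gives a measurable set of measure
    0 that contains A. *)
Lemma rn_null_negligible n (A : set 'rV[R]_n) : rn_null A -> (rvm n).-negligible A.
Proof.
move=> nA.
have /choice[lo /choice[hi h]] : forall m : nat, exists lo : nat -> 'rV[R]_n, exists hi : nat -> 'rV[R]_n,
    A `<=` \bigcup_k cbox (lo k) (hi k) /\
    (\sum_(0 <= k <oo) (\prod_(i < n) Num.max 0 (hi k 0 i - lo k 0 i))%:E < (m.+1%:R^-1)%:E)%E.
  by move=> m; apply: nA; rewrite invr_gt0.
pose B := \bigcap_m \bigcup_k cbox (lo m k) (hi m k).
have mB : measurable B.
  by apply: bigcapT_measurable => m; apply: bigcupT_measurable => k; exact: measurable_cbox.
exists B; split => //; last by move=> x Ax m _; exact: (h m).1.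
apply/eqP; rewrite eq_le measure_ge0 andbT; apply/lee_addgt0Pr => e e0; rewrite add0e.
pose m := Num.truncn e^-1.
have me : m.+1%:R^-1 < e by rewrite invf_plt ?posrE// truncnS_gt.
apply: (@le_trans _ _ (m.+1%:R^-1)%:E); last by rewrite lee_fin ltW.
apply: le_trans (ltW (h m).2).
under eq_eseriesr do rewrite -rvm_cbox.
apply: (@le_trans _ _ (rvm n (\bigcup_k cbox (lo m k) (hi m k)))).
  apply: le_measure; rewrite ?inE//.
    by apply: bigcupT_measurable => k; exact: measurable_cbox.
  by move=> x; exact.
apply: measure_sigma_subadditive => //.
- by move=> k; exact: measurable_cbox.
- by apply: bigcupT_measurable => k; exact: measurable_cbox.
Qed.

End null.

(** * The heat kernel and convolutions *)

Section gauss.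
Context {R : realType}.

Definition dotv n (a z : 'rV[R]_n) : R := \sum_(i < n) a 0 i * z 0 i.

Lemma sqnorm_ge0 n (x : 'rV[R]_n) : 0 <= sqnorm x.
Proof. by apply: sumr_ge0 => i _; exact: sqr_ge0. Qed.

Lemma measurable_sqnorm n : measurable_fun setT (@sqnorm R n).
Proof.
apply: measurable_sum => i; apply: (@measurable_funX _ _ _ _ (fun x : 'rV[R]_n => x 0 i)).
exact: measurable_coord.
Qed.

Lemma measurable_dotv n (a : 'rV[R]_n) : measurable_fun setT (dotv a).
Proof.
apply: measurable_sum => i; apply: measurable_funM => //; exact: measurable_coord.
Qed.

Lemma gauss_ge0 n t (x : 'rV[R]_n) : 0 <= gauss t x.
Proof. by rewrite /gauss mulr_ge0 ?powR_ge0 ?expR_ge0. Qed.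

Lemma gauss_gt0 n t (x : 'rV[R]_n) : 0 < t -> 0 < gauss t x.
Proof. by move=> t0; rewrite /gauss mulr_gt0 ?powR_gt0 ?expR_gt0// !mulr_gt0// pi_gt0. Qed.

Lemma gauss_le n t (x : 'rV[R]_n) : 0 <= t -> gauss t x <= (4 * pi * t) `^ (- (n%:R / 2)).
Proof.
move=> t0; rewrite /gauss ler_piMr ?powR_ge0// -expR0 ler_expR mulNr oppr_le0.
by rewrite divr_ge0 ?sqnorm_ge0// mulr_ge0.
Qed.

Lemma sqnormN n (x : 'rV[R]_n) : sqnorm (- x) = sqnorm x.
Proof. by apply: eq_bigr => i _; rewrite mxE sqrrN. Qed.

Lemma gaussN n t (x : 'rV[R]_n) : gauss t (- x) = gauss t x.
Proof. by rewrite /gauss sqnormN. Qed.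

(** Inversion is discontinuous at 0; on each half-line it is expressed by [powR], which is
    measurable. *)
Lemma measurable_invR : measurable_fun setT (fun x : R => x^-1).
Proof.
rewrite (_ : (fun x => _) = (fun x => if 0 <= x then x `^ (- 1) else - ((- x) `^ (- 1)))); last first.
  apply/funext => x; case: ifPn => x0; first by rewrite powR_inv1.
  by rewrite powR_inv1 ?invrN ?opprK// oppr_ge0 ltW// ltNge.
apply: measurable_fun_ifT.
- exact: measurable_fun_ler.
- exact: measurable_powR.
- by apply: measurableT_comp => //; apply: (measurableT_comp (measurable_powR _)).
Qed.

Lemma measurable_gauss2 n : measurable_fun setT (fun z : R * 'rV[R]_n => gauss z.1 z.2).
Proof.
apply: measurable_funM.
  apply: (measurableT_comp (measurable_powR _)); exact: measurable_funM.
apply: (measurableT_comp (@measurable_expR R)).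
apply: measurable_funM.
  by apply: measurableT_comp => //; exact: (measurableT_comp (@measurable_sqnorm n) measurable_snd).
apply: (@measurableT_comp _ _ _ _ _ _ (fun x : R => (4 * x)^-1) setT fst) => //.
apply: (@measurableT_comp _ _ _ _ _ _ (fun x : R => x^-1)); first exact: measurable_invR.
exact: measurable_funM.
Qed.

Lemma measurable_gauss n t : measurable_fun setT (@gauss R n t).
Proof. exact: (measurable_fun_pair2 t (@measurable_gauss2 n)). Qed.

Lemma sqnormZ n (c : R) (x : 'rV[R]_n) : sqnorm (c *: x) = c ^+ 2 * sqnorm x.
Proof. by rewrite /sqnorm mulr_sumr; apply: eq_bigr => i _; rewrite mxE exprMn. Qed.

Lemma gauss_scale n (c t : R) (x : 'rV[R]_n) : 0 < c -> 0 < t ->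
  gauss (c * t) (Num.sqrt c *: x) = c `^ (- (n%:R / 2)) * gauss t x.
Proof.
move=> c0 t0; rewrite /gauss sqnormZ sqr_sqrtr ?ltW// mulrA.
rewrite (_ : 4 * pi * c * t = c * (4 * pi * t)); last by ring.
rewrite powRM ?ltW// ?mulr_gt0 ?pi_gt0// [RHS]mulrA; congr (_ * _ * expR _).
by field; rewrite !gt_eqF.
Qed.

Let g1 (t s : R) := (4 * pi * t) `^ (- 2^-1) * expR (- s ^+ 2 / (4 * t)).

Let mg1 t : measurable_fun setT (g1 t).
Proof.
apply: measurable_funM => //; apply: (measurableT_comp (@measurable_expR R)).
by apply: measurable_funM => //; apply: measurableT_comp => //; exact: measurable_funX.
Qed.

Let int_g1 (t : R) : 0 < t -> (\int[leb]_s (g1 t s)%:E = 1)%E.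
Proof.
move=> t0; set c := (Num.sqrt (4 * t))^-1.
have t40 : 0 < 4 * t by rewrite mulr_gt0.
have c0 : 0 < c by rewrite invr_gt0 sqrtr_gt0.
have mG : measurable_fun setT (EFin \o (@gauss_fun R)).
  (apply/measurable_EFinP; exact: measurable_gauss_fun).
under eq_integral do rewrite /g1 EFinM.
rewrite ge0_integralZl_EFin//=; last first.
- exact: powR_ge0.
- apply/measurable_EFinP; apply: (measurableT_comp (@measurable_expR R)).
  by apply: measurable_funM => //; apply: measurableT_comp => //; exact: measurable_funX.
have -> : (\int[leb]_x (expR (- x ^+ 2 / (4 * t)))%:E = \int[leb]_x (EFin \o (@gauss_fun R)) (c * x + 0)%R)%E.
  apply: eq_integral => x _; rewrite /= /gauss_fun addr0 exprMn /c exprVn sqr_sqrtr ?ltW//.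
  by rewrite mulNr mulrC.
rewrite ge0_integral_leb_affine ?gt_eqF//; last by move=> x; rewrite lee_fin gauss_fun_ge0.
rewrite -integral_leb//= integralT_gauss -!EFinM; congr EFin.
rewrite gtr0_norm// /c invrK powRN powR12_sqrt; last by rewrite mulrAC mulr_ge0 ?pi_ge0// ltW.
rewrite -sqrtrM; last exact: ltW.
rewrite (_ : 4 * t * pi = 4 * pi * t); last by ring.
by rewrite mulVf// gt_eqF// sqrtr_gt0 !mulr_gt0// pi_gt0.
Qed.

Lemma gauss_rcons n (t : R) (z : R * 'rV[R]_n) : 0 < t ->
  gauss t (rcons_mx z) = g1 t z.1 * gauss t z.2.
Proof.
move=> t0; rewrite /gauss /g1 mulrACA -expRD; congr (_ * expR _); last first.
  rewrite /sqnorm big_ord_recl rcons_mx0 opprD mulrDl.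
  by under eq_bigr do rewrite rcons_mxS.
rewrite -powRD; last by rewrite (@gt_eqF _ _ (4 * pi * t) 0) ?implybT// !mulr_gt0// pi_gt0.
by congr (_ `^ _); rewrite -natr1; field.
Qed.

Lemma integral_gauss n (t : R) : 0 < t -> (\int[rvm n]_x (gauss t x)%:E = 1 :> \bar R)%E.
Proof.
move=> t0; elim: n => [|n IH].
  have := @integral_dirac _ 'rV[R]_0 0 R setT measurableT (EFin \o gauss t).
  rewrite diracT mul1e => ->; last (apply/measurable_EFinP; exact: measurable_gauss).
  by rewrite /= /gauss mul0r oppr0 powRr0 /sqnorm big_ord0 oppr0 mul0r expR0 mulr1.
rewrite ge0_integral_rvmS//; last 2 first.
  - (apply/measurable_EFinP; exact: measurable_gauss).
  - by move=> x; rewrite lee_fin gauss_ge0.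
rewrite fubini_tonelli1//=; last 2 first.
  - apply/measurable_EFinP; apply: measurable_comp_rcons; exact: measurable_gauss.
  - by move=> x; rewrite lee_fin gauss_ge0.
rewrite -[RHS](int_g1 t0); apply: eq_integral => s _.
rewrite /fubini_F; under eq_integral do rewrite gauss_rcons//= EFinM.
rewrite ge0_integralZl_EFin//= ?IH ?mule1//.
- by move=> x _; rewrite lee_fin gauss_ge0.
- (apply/measurable_EFinP; exact: measurable_gauss).
- by rewrite mulr_ge0 ?powR_ge0 ?expR_ge0.
Qed.

(** Completing the square in y: the product of two kernels is again a kernel, with time st/(s+t) and
    centre s x/(s+t). Integrating it in y yields the semigroup law. *)
Lemma gauss_mul n (s t : R) (x y : 'rV[R]_n) : 0 < s -> 0 < t ->
  gauss t (x - y) * gauss s y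
  = gauss (s + t) x * gauss (s * t / (s + t)) (y - (s / (s + t)) *: x).
Proof.
move=> s0 t0; have st0 : 0 < s + t by rewrite addr_gt0.
rewrite /gauss mulrACA [RHS]mulrACA -!expRD -!powRM ?mulr_ge0 ?pi_ge0 ?ltW ?divr_gt0 ?mulr_gt0 ?invr_gt0//.
congr (_ `^ _ * expR _).
  by field; rewrite gt_eqF.
rewrite /sqnorm -!sumrN !mulr_suml -!big_split; apply: eq_bigr => i _ /=.
rewrite !mxE; field; by rewrite !gt_eqF ?invr_gt0.
Qed.

Lemma integral_gauss_mul n (s t : R) (x : 'rV[R]_n) : 0 < s -> 0 < t ->
  (\int[rvm n]_y (gauss t (x - y)%R * gauss s y)%:E = (gauss (s + t) x)%:E)%E.
Proof.
move=> s0 t0; have st0 : 0 < s + t by rewrite addr_gt0.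
under eq_integral do rewrite gauss_mul// EFinM.
set r := s * t / (s + t); have r0 : 0 < r by rewrite divr_gt0// mulr_gt0.
have mr : measurable_fun setT (EFin \o @gauss R n r) by (apply/measurable_EFinP; exact: measurable_gauss).
rewrite ge0_integralZl_EFin//=.
- have := @ge0_integral_affine R n 1 (- (s / (s + t) *: x)) (EFin \o gauss r) (oner_neq0 _) mr.
  rewrite normr1 expr1n invr1 mul1e /= integral_gauss// => h.
  rewrite -[RHS]mule1; congr (_ * _)%E; rewrite -{}[RHS]h; last by move=> z; rewrite lee_fin gauss_ge0.
  by apply: eq_integral => z _; rewrite scale1r.
- by move=> y _; rewrite lee_fin gauss_ge0.
- have := measurableT_comp mr (measurable_affine 1 (- (s / (s + t) *: x))).
  by apply: eq_measurable_fun => y _ /=; rewrite scale1r.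
- exact: gauss_ge0.
Qed.

End gauss.

(** * Integrability with explicit bounds *)

Section L1.
Context d (T : measurableType d) {R : realType} (mu : {sigma_finite_measure set T -> \bar R}).
Implicit Types (f g : T -> R) (A B C : R).

(** B is any bound on the norm, not the norm itself: measurability, integrability and the estimate
    travel together as one hypothesis. *)
Definition L1 f B := measurable_fun setT f /\ (\int[mu]_x (`|f x|)%:E <= B%:E)%E.

Definition RI f : R := Rintegral mu setT f.

Lemma L1_meas f B : L1 f B -> measurable_fun setT f. Proof. by case. Qed.

Lemma L1_Itg f B : L1 f B -> mu.-integrable setT (EFin \o f).
Proof.
move=> [mf fB]; apply/integrableP; split; first exact/measurable_EFinP.
by apply: le_lt_trans fB _; exact: ltry.
Qed.

Lemma L1_ge0 f B : L1 f B -> 0 <= B.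
Proof. by move=> [_ fB]; rewrite -lee_fin; apply: le_trans fB; exact: integral_ge0. Qed.

Lemma abs_I_le f (b : \bar R) : measurable_fun setT f ->
  (\int[mu]_x (`|f x|)%:E <= b)%E -> (`|RI f|%:E <= b)%E.
Proof.
move=> mf fb; apply: (le_trans _ fb).
have h : (`|\int[mu]_x (f x)%:E| <= \int[mu]_x `|(f x)%:E|)%E.
  by apply: le_abse_integral => //; exact/measurable_EFinP.
apply: le_trans h; rewrite /RI /Rintegral.
(* An infinite integral has [fine] equal to 0, so the bound is trivial there. *)
by case: (\int[mu]_x (f x)%:E)%E => [r| |] //=; rewrite normr0 leey.
Qed.

Lemma L1_I f B : L1 f B -> `|RI f| <= B.
Proof. by move=> [mf fB]; rewrite -lee_fin; exact: abs_I_le. Qed.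

Lemma L1_le f g B : measurable_fun setT f -> (forall x, `|f x| <= g x) -> L1 g B -> L1 f B.
Proof.
move=> mf fg [mg gB]; split => //; apply: le_trans gB.
apply: ge0_le_integral => //.
- by apply/measurable_EFinP; exact: measurableT_comp.
- by apply/measurable_EFinP; exact: measurableT_comp.
- by move=> x _; rewrite lee_fin (le_trans (fg x))// ler_norm.
Qed.

Lemma L1_weak f A B : A <= B -> L1 f A -> L1 f B.
Proof. by move=> AB [mf fA]; split=> //; apply: le_trans fA _; rewrite lee_fin. Qed.

Lemma L1_abs f B : L1 f B -> L1 (fun x => `|f x|) B.
Proof.
move=> [mf fB]; split; first exact: measurableT_comp.
by under eq_integral do rewrite normr_id.
Qed.

Lemma L1_add f g A B : L1 f A -> L1 g B -> L1 (fun x => f x + g x) (A + B).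
Proof.
move=> [mf fA] [mg gB]; split; first exact: measurable_funD.
apply: (@le_trans _ _ (\int[mu]_x ((`|f x|)%:E + (`|g x|)%:E))%E).
  apply: ge0_le_integral => //.
  - by apply/measurable_EFinP; apply: measurableT_comp => //; exact: measurable_funD.
  - by apply/measurable_EFinP; apply: (@measurable_funD _ _ _ _ (fun x => `|f x|)); exact: measurableT_comp.
  - by move=> x _; rewrite -EFinD lee_fin ler_normD.
rewrite ge0_integralD//; last 2 first.
- by apply/measurable_EFinP; exact: measurableT_comp.
- by apply/measurable_EFinP; exact: measurableT_comp.
by rewrite EFinD; exact: leeD.
Qed.

Lemma L1_scale c f A : L1 f A -> L1 (fun x => c * f x) (`|c| * A).
Proof.
move=> [mf fA]; split; first exact: measurable_funM.
under eq_integral do rewrite normrM EFinM.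
rewrite ge0_integralZl_EFin//; last by apply/measurable_EFinP; exact: measurableT_comp.
by rewrite EFinM; exact: lee_wpmul2l.
Qed.

Lemma L1_opp f A : L1 f A -> L1 (fun x => - f x) A.
Proof.
move=> [mf fA]; split; first exact: measurableT_comp.
by under eq_integral do rewrite normrN.
Qed.

Lemma L1_sub f g A B : L1 f A -> L1 g B -> L1 (fun x => f x - g x) (A + B).
Proof. by move=> hf hg; exact: (L1_add hf (L1_opp hg)). Qed.

Lemma L1_mulb f g A C : L1 f A -> measurable_fun setT g -> (forall x, `|g x| <= C) ->
  L1 (fun x => f x * g x) (A * C).
Proof.
move=> hf mg gC; apply: (@L1_le _ (fun x => C * `|f x|)).
- by apply: measurable_funM => //; exact: L1_meas hf.
- by move=> x; rewrite normrM mulrC ler_wpM2r.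
- have C0 : 0 <= C by exact: le_trans (gC point).
  by rewrite mulrC -{2}(ger0_norm C0); exact/L1_scale/L1_abs.
Qed.

Lemma L1_intI f : mu.-integrable setT (EFin \o f) -> L1 f (RI (fun x => `|f x|)).
Proof.
move=> If; split; first by apply/measurable_EFinP; exact: measurable_int If.
rewrite /RI /Rintegral fineK//.
by apply: integrable_fin_num => //; exact: (integrable_abse If).
Qed.

Lemma eq_L1 f g B : f =1 g -> L1 f B -> L1 g B.
Proof. by move=> /funext ->. Qed.

Lemma eq_I f g : f =1 g -> RI f = RI g.
Proof. by move=> /funext ->. Qed.

Lemma I_add f g A B : L1 f A -> L1 g B -> RI (fun x => f x + g x) = RI f + RI g.
Proof. by move=> hf hg; apply: RintegralD => //; [exact: L1_Itg hf|exact: L1_Itg hg]. Qed.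

Lemma I_sub f g A B : L1 f A -> L1 g B -> RI (fun x => f x - g x) = RI f - RI g.
Proof. by move=> hf hg; apply: RintegralB => //; [exact: L1_Itg hf|exact: L1_Itg hg]. Qed.

Lemma I_scale c f A : L1 f A -> RI (fun x => c * f x) = c * RI f.
Proof. by move=> hf; apply: RintegralZl => //; exact: L1_Itg hf. Qed.

Lemma I_le f g A B : L1 f A -> L1 g B -> (forall x, f x <= g x) -> RI f <= RI g.
Proof. by move=> hf hg fg; apply: le_Rintegral => //; [exact: L1_Itg hf|exact: L1_Itg hg]. Qed.

Lemma I_ge0 f : (forall x, 0 <= f x) -> 0 <= RI f.
Proof. by move=> f0; apply: Rintegral_ge0. Qed.

Lemma ae_eq_I f g : measurable_fun setT f -> measurable_fun setT g ->
  ae_eq mu setT f g -> RI f = RI g.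
Proof.
move=> mf mg fg; congr fine; apply: ae_eq_integral => //; try exact/measurable_EFinP.
by apply: filterS fg => x /= fx ?; rewrite fx.
Qed.

Lemma I_eq0 f A : L1 f A -> (forall x, 0 <= f x) -> RI f = 0 -> ae_eq mu setT f (cst 0).
Proof.
move=> hf f0 If0.
have mf : measurable_fun setT (EFin \o f) by apply/measurable_EFinP; exact: L1_meas hf.
have := (ae_eq_integral_abs mu measurableT mf).1.
have -> : (\int[mu]_x `|(EFin \o f) x| = 0)%E.
  have -> : (\int[mu]_x `|(EFin \o f) x| = \int[mu]_x (EFin \o f) x)%E.
    by apply: eq_integral => x _; rewrite gee0_abs// lee_fin.
  rewrite -(@fineK _ (\int[mu]_x (EFin \o f) x)%E); first by rewrite (_ : fine _ = 0).
  by apply: integrable_fin_num => //; exact: L1_Itg hf.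
move=> /(_ erefl); apply: filterS => x h ?; exact: EFin_inj (h Logic.I).
Qed.

End L1.
Arguments L1_le {d T R mu f} g B.

Lemma measurable_comp2 d d1 d2 d3 (T : measurableType d) (T1 : measurableType d1)
  (T2 : measurableType d2) (T3 : measurableType d3) (F : T1 * T2 -> T3) (p : T -> T1) (q : T -> T2) :
  measurable_fun setT F -> measurable_fun setT p -> measurable_fun setT q ->
  measurable_fun setT (fun x => F (p x, q x)).
Proof. by move=> mF mp mq; apply: (measurableT_comp mF); exact: measurable_fun_pair. Qed.

Lemma measurable_fst_comp d d1 d2 (T : measurableType d) (T1 : measurableType d1)
  (T2 : measurableType d2) (p : T -> T1 * T2) :
  measurable_fun setT p -> measurable_fun setT (fun x => (p x).1).
Proof. by move=> mp; exact: (measurableT_comp measurable_fst mp). Qed.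

Lemma measurable_snd_comp d d1 d2 (T : measurableType d) (T1 : measurableType d1)
  (T2 : measurableType d2) (p : T -> T1 * T2) :
  measurable_fun setT p -> measurable_fun setT (fun x => (p x).2).
Proof. by move=> mp; exact: (measurableT_comp measurable_snd mp). Qed.

(** * Fubini with bounds on slices *)

Section Fub.
Context d1 d2 (T1 : measurableType d1) (T2 : measurableType d2) {R : realType}
  (m1 : {sigma_finite_measure set T1 -> \bar R}) (m2 : {sigma_finite_measure set T2 -> \bar R}).
Variable H : T1 * T2 -> R.
Hypothesis mH : measurable_fun setT H.

Let mHE : measurable_fun setT (EFin \o H). Proof. exact/measurable_EFinP. Qed.

Lemma measurable_I2 : measurable_fun setT (fun s => RI m2 (fun x => H (s, x))).
Proof.
apply: (measurableT_comp (fine_measurable (@measurableT _ (\bar R)))).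
exact: (measurable_integral_snd m2 mHE).
Qed.

Lemma measurable_I1 : measurable_fun setT (fun x => RI m1 (fun s => H (s, x))).
Proof.
apply: (measurableT_comp (fine_measurable (@measurableT _ (\bar R)))).
apply: (@measurable_integral_snd _ _ _ _ _ m1 (fun z : T2 * T1 => (H (z.2, z.1))%:E)).
apply: (measurableT_comp mHE); exact: measurable_fun_pair.
Qed.

Variables (b : T1 -> R) (B : R).
Hypothesis bB : L1 m1 b B.
Hypothesis Hb : forall s, (\int[m2]_x (`|H (s, x)|)%:E <= (b s)%:E)%E.

Let mHa : measurable_fun setT (fun z => (`|H z|)%:E).
Proof. by apply/measurable_EFinP; exact: measurableT_comp. Qed.

Let mHb : measurable_fun setT (fun s => \int[m2]_x (`|H (s, x)|)%:E)%E.
Proof. exact: (measurable_fun_fubini_tonelli_F (fun z => (`|H z|)%:E)). Qed.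

Let HB : (\int[m1]_s \int[m2]_x (`|H (s, x)|)%:E <= B%:E)%E.
Proof.
apply: le_trans (bB.2); apply: ge0_le_integral => //.
- by move=> s _; exact: integral_ge0.
- by apply/measurable_EFinP; apply: measurableT_comp => //; exact: bB.1.
- by move=> s _; apply: le_trans (Hb s) _; rewrite lee_fin ler_norm.
Qed.

Let iH : (m1 \x m2)%E.-integrable setT (EFin \o H).
Proof. by apply/(integrable12ltyP m1 m2 mHE); apply: le_lt_trans HB _; exact: ltry. Qed.

(** Minkowski's integral inequality in L^1, by Tonelli. *)
Lemma fub_L1 : L1 m2 (fun x => RI m1 (fun s => H (s, x))) B.
Proof.
split; first exact: measurable_I1.
apply: le_trans HB; rewrite (fubini_tonelli (fun z => (`|H z|)%:E))//.
apply: ge0_le_integral => //.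
- by apply/measurable_EFinP; apply: measurableT_comp => //; exact: measurable_I1.
- exact: (measurable_fun_fubini_tonelli_G (fun z => (`|H z|)%:E)).
- move=> x _; apply: abs_I_le => //.
  exact: (measurable_fun_pair1 x mH).
Qed.

Lemma fub_ae : {ae m2, forall x, m1.-integrable setT (fun s => (H (s, x))%:E)}.
Proof. exact: (ae_integrable2 iH). Qed.

Lemma fub_swap : RI m1 (fun s => RI m2 (fun x => H (s, x))) = RI m2 (fun x => RI m1 (fun s => H (s, x))).
Proof.
rewrite /RI /Rintegral; transitivity (fine (\int[m1]_s \int[m2]_x (H (s, x))%:E)%E).
  congr fine; apply: eq_integral => s _; rewrite fineK//.
  apply: integrable_fin_num => //; apply/integrableP; split.
    exact: (measurable_fun_pair2 s mHE).
  by apply: le_lt_trans (Hb s) _; exact: ltry.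
rewrite (Fubini iH); congr fine; apply: ae_eq_integral => //.
- exact: (measurable_fubini_G iH).
- by apply/measurable_EFinP; exact: measurable_I1.
- have := ae_integrable2 iH; apply: filterS => x hx _.
  by rewrite fineK//; exact: integrable_fin_num.
Qed.

End Fub.

(** * Convolutions *)

Section cnv.
Context {R : realType} {n : nat}.
Notation V := 'rV[R]_n.
Notation mu := (rvm n).
Implicit Types (k g w : V -> R) (A B C D : R).

Definition cnv k g (x : V) : R := RI mu (fun y => k (x - y) * g y).

Lemma measurable_subV : measurable_fun setT (fun z : V * V => z.1 - z.2).
Proof.
apply: measurable_rV => i; under eq_fun do rewrite !mxE.
apply: measurable_funB; exact: (measurableT_comp (measurable_coord i)).
Qed.

Lemma measurable_reflV (x : V) : measurable_fun setT (fun y : V => x - y).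
Proof. exact: (measurable_fun_pair2 x measurable_subV). Qed.

Lemma ge0_integral_refl (x : V) (f : V -> \bar R) : measurable_fun setT f ->
  (forall y, 0 <= f y)%E -> (\int[mu]_y f (x - y)%R = \int[mu]_y f y)%E.
Proof.
move=> mf f0; have N1 : -1 != 0 :> R by rewrite oppr_eq0 oner_neq0.
have := @ge0_integral_affine R n (-1) x f N1 mf f0.
rewrite normrN1 expr1n invr1 mul1e => <-.
by apply: eq_integral => y _; rewrite scaleN1r addrC.
Qed.

Lemma ge0_integral_trans (x : V) (f : V -> \bar R) : measurable_fun setT f ->
  (forall y, 0 <= f y)%E -> (\int[mu]_y f (y + x)%R = \int[mu]_y f y)%E.
Proof.
move=> mf f0; have := @ge0_integral_affine R n 1 x f (oner_neq0 _) mf f0.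
rewrite normr1 expr1n invr1 mul1e => <-.
by apply: eq_integral => y _; rewrite scale1r.
Qed.

(** Lets changes of variables, proved for nonnegative functions, act on signed functions whose
    integrability is unknown. *)
Lemma RI_posneg (f : V -> R) :
  RI mu f = fine (\int[mu]_x (Num.max (f x) 0)%R%:E - \int[mu]_x (Num.max (- f x) 0)%R%:E)%E.
Proof.
rewrite /RI /Rintegral integralE; congr (fine (_ - _)%E).
  by apply: eq_integral => x _; rewrite funeposE -EFin_max.
by apply: eq_integral => x _; rewrite funenegE -EFinN -EFin_max.
Qed.

Lemma RI_refl (x : V) (f : V -> R) : measurable_fun setT f -> RI mu (fun y => f (x - y)) = RI mu f.
Proof.
move=> mf; rewrite !RI_posneg.
have m1 : measurable_fun setT (fun y : V => (Num.max (f y) 0)%:E).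
  by apply/measurable_EFinP; exact: measurable_maxr.
have m2 : measurable_fun setT (fun y : V => (Num.max (- f y) 0)%:E).
  by apply/measurable_EFinP; apply: measurable_maxr => //; exact: measurableT_comp.
rewrite (ge0_integral_refl x m1); last by move=> y; rewrite lee_fin le_max lexx orbT.
by rewrite (ge0_integral_refl x m2)// => y; rewrite lee_fin le_max lexx orbT.
Qed.

Lemma RI_trans (x : V) (f : V -> R) : measurable_fun setT f -> RI mu (fun y => f (y + x)) = RI mu f.
Proof.
move=> mf; rewrite !RI_posneg.
have m1 : measurable_fun setT (fun y : V => (Num.max (f y) 0)%:E).
  by apply/measurable_EFinP; exact: measurable_maxr.
have m2 : measurable_fun setT (fun y : V => (Num.max (- f y) 0)%:E).
  by apply/measurable_EFinP; apply: measurable_maxr => //; exact: measurableT_comp.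
rewrite (ge0_integral_trans x m1); last by move=> y; rewrite lee_fin le_max lexx orbT.
by rewrite (ge0_integral_trans x m2)// => y; rewrite lee_fin le_max lexx orbT.
Qed.

Lemma L1_refl (x : V) f B : L1 mu f B -> L1 mu (fun y => f (x - y)) B.
Proof.
move=> [mf fB]; split; first exact: (measurableT_comp mf (measurable_reflV x)).
rewrite (@ge0_integral_refl x (fun y => (`|f y|)%:E))//.
by apply/measurable_EFinP; exact: measurableT_comp.
Qed.

Lemma L1_trans (x : V) f B : L1 mu f B -> L1 mu (fun y => f (y + x)) B.
Proof.
move=> [mf fB]; split.
  apply: (measurableT_comp mf); have := measurable_affine 1 x.
  by apply: eq_measurable_fun => y _; rewrite scale1r.
rewrite (@ge0_integral_trans x (fun y => (`|f y|)%:E))//.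
by apply/measurable_EFinP; exact: measurableT_comp.
Qed.

Let mcnv k g : measurable_fun setT k -> measurable_fun setT g ->
  measurable_fun setT (fun z : V * V => k (z.2 - z.1) * g z.1).
Proof.
move=> mk mg; apply: measurable_funM; last exact: (measurableT_comp mg).
apply: (measurableT_comp mk).
exact: (measurableT_comp measurable_subV (measurable_fun_pair measurable_snd measurable_fst)).
Qed.

Lemma cnv_L1 k g A B : L1 mu k A -> L1 mu g B -> L1 mu (cnv k g) (A * B).
Proof.
move=> hk hg; have A0 := L1_ge0 hk.
have hb := L1_scale A (L1_abs hg); rewrite ger0_norm// in hb.
apply: (@fub_L1 _ _ _ _ _ mu mu _ (mcnv hk.1 hg.1) _ _ hb) => y /=.
rewrite mulrC EFinM -/(RI _ _).
under eq_integral do rewrite mulrC normrM EFinM.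
have h := L1_trans (- y) hk.
rewrite ge0_integralZl_EFin//; first by apply: lee_wpmul2l => //; exact: h.2.
by apply/measurable_EFinP; apply: measurableT_comp => //; exact: h.1.
Qed.

Lemma cnv_intg k g A C x : L1 mu k A -> measurable_fun setT g -> (forall y, `|g y| <= C) ->
  L1 mu (fun y => k (x - y) * g y) (A * C).
Proof. by move=> hk mg gC; apply: L1_mulb => //; exact: L1_refl. Qed.

Lemma cnv_sup k g A C x : L1 mu k A -> measurable_fun setT g -> (forall y, `|g y| <= C) ->
  `|cnv k g x| <= A * C.
Proof. by move=> hk mg gC; exact: L1_I (cnv_intg x hk mg gC). Qed.

Lemma cnv_intg2 k g B C x : measurable_fun setT k -> (forall y, `|k y| <= C) -> L1 mu g B ->
  L1 mu (fun y => k (x - y) * g y) (C * B).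
Proof.
move=> mk kC hg; rewrite mulrC; apply: eq_L1 (_ : L1 mu (fun y => g y * k (x - y)) _).
  by move=> y; rewrite mulrC.
by apply: L1_mulb => //; exact: (measurableT_comp mk (measurable_reflV x)).
Qed.

Lemma cnv_sup2 k g B C x : measurable_fun setT k -> (forall y, `|k y| <= C) -> L1 mu g B ->
  `|cnv k g x| <= C * B.
Proof. by move=> mk kC hg; exact: L1_I (cnv_intg2 x mk kC hg). Qed.

Lemma cnvC k g x : measurable_fun setT k -> measurable_fun setT g -> cnv k g x = cnv g k x.
Proof.
move=> mk mg; rewrite /cnv -(RI_refl x).
  by apply: eq_I => y; rewrite mulrC; congr (_ * k _); rewrite opprB addrC subrK.
by apply: measurable_funM => //; exact: (measurableT_comp mk (measurable_reflV x)).
Qed.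

Lemma cnv_fubini w k g A B C D : measurable_fun setT w -> (forall x, `|w x| <= C) ->
  L1 mu k A -> (forall x, `|k x| <= D) -> L1 mu g B ->
  RI mu (fun x => w x * cnv k g x) = RI mu (fun y => RI mu (fun x => w x * k (x - y)) * g y).
Proof.
move=> mw wC hk kD hg.
have C0 : 0 <= C by exact: le_trans (wC 0).
have A0 := L1_ge0 hk.
pose H (z : V * V) := w z.2 * (k (z.2 - z.1) * g z.1).
have mH : measurable_fun setT H.
  apply: measurable_funM; last exact: mcnv hk.1 hg.1.
  exact: (measurableT_comp mw).
have hb := L1_scale (A * C) (L1_abs hg).
have hkt y : L1 mu (fun x => k (x - y)) A by exact: L1_trans.
have hH y : L1 mu (fun x => k (x - y) * w x) (A * C) by apply: L1_mulb.
have Hb y : (\int[mu]_x (`|H (y, x)|)%:E <= (A * C * `|g y|)%:E)%E.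
  have := (L1_scale (g y) (hH y)).2; rewrite mulrC; apply: le_trans.
  by rewrite le_eqVlt; apply/orP; left; apply/eqP; apply: eq_integral => x _;
     rewrite /H /=; congr (`|_|%:E); ring.
transitivity (RI mu (fun x => RI mu (fun y => H (y, x)))).
  apply: eq_I => x; rewrite /H /= /cnv.
  by rewrite (I_scale _ (cnv_intg2 x hk.1 kD hg)).
rewrite -(fub_swap mH hb Hb); apply: eq_I => y.
transitivity (RI mu (fun x => g y * (k (x - y) * w x))).
  by apply: eq_I => x; rewrite /H /=; ring.
by rewrite (I_scale _ (hH y)) mulrC; congr (_ * _); apply: eq_I => x; rewrite mulrC.
Qed.

(** Fubini moves k2 onto k1, and a translation of the inner variable produces their convolution. *)
Lemma cnvA k1 k2 g A C B D x : measurable_fun setT k1 -> (forall y, `|k1 y| <= C) ->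
  L1 mu k2 A -> (forall y, `|k2 y| <= D) -> L1 mu g B ->
  cnv k1 (cnv k2 g) x = cnv (cnv k1 k2) g x.
Proof.
move=> mk1 k1C hk2 k2D hg.
rewrite [LHS](cnv_fubini (measurableT_comp mk1 (measurable_reflV x)) (fun y => k1C (x - y)) hk2 k2D hg).
apply: eq_I => z; congr (_ * _).
rewrite -(RI_trans z); first by apply: eq_I => y; rewrite /= addrK opprD [- y - z]addrC addrA.
apply: measurable_funM; first exact: (measurableT_comp mk1 (measurable_reflV x)).
exact: (L1_trans (- z) hk2).1.
Qed.

(** The adjoint of convolution with k is convolution with its reflection. For the even kernel G_t
    this is self-adjointness; for the odd kernel a . grad G_t it brings a change of sign. *)
Lemma cnv_pair w k g A B C D : measurable_fun setT w -> (forall x, `|w x| <= C) ->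
  L1 mu k A -> (forall x, `|k x| <= D) -> L1 mu g B ->
  RI mu (fun x => w x * cnv k g x) = RI mu (fun y => cnv (fun z => k (- z)) w y * g y).
Proof.
move=> mw wC hk kD hg; rewrite (cnv_fubini mw wC hk kD hg); apply: eq_I => y; congr (_ * _).
by apply: eq_I => x; rewrite opprB mulrC.
Qed.

End cnv.

(** * Gradient and Taylor bounds of the heat kernel *)

Section kernel.
Context {R : realType} {n : nat}.
Notation V := 'rV[R]_n.
Notation mu := (rvm n).
Implicit Types (a x z : V) (t s h : R) (g : V -> R).

(* [a . grad G_t] *)
Definition K1 a t z : R := - dotv a z / (2 * t) * gauss t z.

Lemma measurable_K1_2 a : measurable_fun setT (fun z : R * V => K1 a z.1 z.2).
Proof.
apply: measurable_funM; last exact: measurable_gauss2.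
apply: measurable_funM.
  by apply: measurableT_comp => //; exact: (measurableT_comp (measurable_dotv a) measurable_snd).
apply: (@measurableT_comp _ _ _ _ _ _ (fun x : R => x^-1)); first exact: measurable_invR.
exact: measurable_funM.
Qed.

Lemma measurable_K1 a t : measurable_fun setT (K1 a t).
Proof. exact: (measurable_fun_pair2 t (measurable_K1_2 a)). Qed.

Lemma dotvN a z : dotv a (- z) = - dotv a z.
Proof. by rewrite /dotv -sumrN; apply: eq_bigr => i _; rewrite mxE mulrN. Qed.

Lemma dotvD a z w : dotv a (z + w) = dotv a z + dotv a w.
Proof. by rewrite /dotv -big_split; apply: eq_bigr => i _; rewrite mxE mulrDr. Qed.

Lemma dotvZ a c z : dotv a (c *: z) = c * dotv a z.
Proof. by rewrite /dotv mulr_sumr; apply: eq_bigr => i _; rewrite mxE mulrCA. Qed.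

Lemma dotvv a : dotv a a = sqnorm a.
Proof. by apply: eq_bigr => i _; rewrite expr2. Qed.

Lemma K1N a t z : K1 a t (- z) = - K1 a t z.
Proof. by rewrite /K1 gaussN dotvN opprK mulNr mulNr opprK. Qed.

Definition l1norm a : R := \sum_(i < n) `|a 0 i|.

Lemma l1norm_ge0 a : 0 <= l1norm a. Proof. by apply: sumr_ge0. Qed.

Lemma dotv_le a z : `|dotv a z| <= l1norm a * Num.sqrt (sqnorm z).
Proof.
rewrite /dotv /l1norm mulr_suml; apply: le_trans (ler_norm_sum _ _ _) _.
apply: ler_sum => i _; rewrite normrM ler_wpM2l// -sqrtr_sqr ler_wsqrtr//.
rewrite /sqnorm (bigD1 i)//= lerDl; apply: sumr_ge0 => j _; exact: sqr_ge0.
Qed.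

(** Half of the Gaussian decay is set aside: the exponential factor absorbs powers of |z|, and
    G_{2t} remains as an integrable majorant. *)
Lemma gauss_double t z : 0 < t ->
  gauss t z = 2 `^ (n%:R / 2) * expR (- (sqnorm z / (8 * t))) * gauss (2 * t) z.
Proof.
move=> t0; rewrite /gauss.
rewrite (_ : 4 * pi * (2 * t) = 2 * (4 * pi * t)); last by ring.
rewrite [(2 * (4 * pi * t)) `^ _]powRM ?mulr_ge0 ?pi_ge0 ?(ltW t0)//.
rewrite [RHS](_ : _ = (2 `^ (n%:R / 2) * 2 `^ (- (n%:R / 2))) * (4 * pi * t) `^ (- (n%:R / 2)) *
  (expR (- (sqnorm z / (8 * t))) * expR (- sqnorm z / (4 * (2 * t))))); last by ring.
rewrite [2 `^ (- _)]powRN mulfV ?gt_eqF ?powR_gt0// mul1r -expRD; congr (_ * expR _).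
by field; rewrite gt_eqF.
Qed.

Let mul_expN (y : R) : 0 <= y -> y * expR (- y ^+ 2) <= 1.
Proof.
move=> y0; rewrite expRN ler_pdivrMr ?expR_gt0// mul1r.
have := expR_ge1Dx (y ^+ 2); have := sqr_ge0 (y - 1); nra.
Qed.

Definition cK a : R := 2 * l1norm a * 2 `^ (n%:R / 2).

Lemma cK_ge0 a : 0 <= cK a. Proof. by rewrite !mulr_ge0 ?l1norm_ge0 ?powR_ge0. Qed.

(** With y = |z| / sqrt(8t), the factor |z| / t is t^{-1/2} y up to a constant, and y e^{-y^2} <= 1
    by [mul_expN]. *)
Lemma K1_le a t z : 0 < t -> `|K1 a t z| <= cK a * t `^ (- 2^-1) * gauss (2 * t) z.
Proof.
move=> t0; rewrite /K1 normrM (ger0_norm (gauss_ge0 t z)) normrM normrN (gauss_double z t0).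
move: (gauss_ge0 (2 * t) z); move: (gauss (2 * t) z) => G G0.
rewrite !mulrA ler_wpM2r//.
rewrite normfV (gtr0_norm (mulr_gt0 (@ltr0Sn R 1) t0)).
set q := sqnorm z; have q0 : 0 <= q by exact: sqnorm_ge0.
have t2 : t `^ (- 2^-1) = (Num.sqrt t)^-1 by rewrite powRN powR12_sqrt// ltW.
have st0 : 0 < Num.sqrt t by rewrite sqrtr_gt0.
have tE : t = Num.sqrt t ^+ 2 by rewrite sqr_sqrtr// ltW.
pose y := Num.sqrt q / (Num.sqrt 8 * Num.sqrt t).
have s8 : 0 < Num.sqrt 8 :> R by rewrite sqrtr_gt0.
have y0 : 0 <= y by rewrite divr_ge0 ?mulr_ge0 ?sqrtr_ge0.
have y2 : y ^+ 2 = q / (8 * t) by rewrite /y exprMn exprVn exprMn !sqr_sqrtr// ltW.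
have s8le : Num.sqrt 8 <= 4 :> R.
  by rewrite -(@ler_pXn2r _ 2) ?nnegrE ?sqrtr_ge0// sqr_sqrtr//; lra.
rewrite -y2 t2 /cK.
apply: (@le_trans _ _ (l1norm a * Num.sqrt q / (2 * t) * 2 `^ (n%:R / 2) * expR (- y ^+ 2))).
  by rewrite !ler_wpM2r ?expR_ge0 ?powR_ge0 ?invr_ge0 ?mulr_ge0 ?(ltW t0)// dotv_le.
have -> : l1norm a * Num.sqrt q / (2 * t) * 2 `^ (n%:R / 2) * expR (- y ^+ 2) =
  l1norm a * 2 `^ (n%:R / 2) / Num.sqrt t * (Num.sqrt 8 / 2 * (y * expR (- y ^+ 2))).
  rewrite [in 2 * t]tE /y; field; by rewrite !gt_eqF.
have -> : 2 * l1norm a * 2 `^ (n%:R / 2) / Num.sqrt t = l1norm a * 2 `^ (n%:R / 2) / Num.sqrt t * 2 by ring.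
rewrite ler_wpM2l ?divr_ge0 ?mulr_ge0 ?l1norm_ge0 ?powR_ge0 ?sqrtr_ge0//.
have := mul_expN y0; have := mulr_ge0 y0 (expR_ge0 (- y ^+ 2)).
by move: (y * _) => e; nra.
Qed.

Lemma L1_gauss t : 0 < t -> L1 mu (gauss t) 1.
Proof.
move=> t0; split; first exact: measurable_gauss.
under eq_integral do rewrite ger0_norm ?gauss_ge0//.
by rewrite integral_gauss.
Qed.

Lemma RI_gauss t : 0 < t -> RI mu (gauss t) = 1.
Proof. by move=> t0; rewrite /RI /Rintegral integral_gauss. Qed.

Lemma L1_K1 a t : 0 < t -> L1 mu (K1 a t) (cK a * t `^ (- 2^-1)).
Proof.
move=> t0; apply: (L1_le (fun z => cK a * t `^ (- 2^-1) * gauss (2 * t) z)).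
- exact: measurable_K1.
- by move=> z; exact: K1_le.
- have c0 : 0 <= cK a * t `^ (- 2^-1) by rewrite mulr_ge0 ?cK_ge0 ?powR_ge0.
  rewrite -[X in L1 _ _ X](ger0_norm c0) -[X in L1 _ _ X]mulr1.
  by apply: L1_scale; apply: L1_gauss; rewrite mulr_gt0.
Qed.

Lemma gauss_sup t z : 0 < t -> `|gauss t z| <= t `^ (- (n%:R / 2)).
Proof.
move=> t0; rewrite ger0_norm ?gauss_ge0//; apply: le_trans (gauss_le _ (ltW t0)) _.
have p1 : 1 <= 4 * pi :> R by have := @pi_ge2 R; lra.
rewrite powRM ?(le_trans ler01 p1) ?(ltW t0)//.
rewrite ler_piMl ?powR_ge0// powRN invf_le1 ?powR_gt0 ?(lt_le_trans ltr01 p1)//.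
by rewrite -{1}(powRr0 (4 * pi)) ler_powR// divr_ge0.
Qed.

Lemma gauss_gt0_powR t : 0 < t -> (2 * t) `^ (- (n%:R / 2)) <= t `^ (- (n%:R / 2)).
Proof.
move=> t0; rewrite powRM ?(ltW t0)// ler_piMl ?powR_ge0// powRN invf_le1 ?powR_gt0//.
by rewrite -{1}(powRr0 2) ler_powR ?divr_ge0//; lra.
Qed.

Lemma K1_sup a t z : 0 < t -> `|K1 a t z| <= cK a * t `^ (- 2^-1) * t `^ (- (n%:R / 2)).
Proof.
move=> t0; apply: le_trans (K1_le _ _ t0) _; apply: ler_wpM2l.
  by rewrite mulr_ge0 ?cK_ge0 ?powR_ge0.
apply: le_trans (gauss_gt0_powR t0); apply: le_trans (ler_norm _) _; apply: gauss_sup.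
by rewrite mulr_gt0.
Qed.

Let expR_taylor (x : R) : `|expR x - 1 - x| <= x ^+ 2 * expR `|x|.
Proof.
have h1 : 0 <= expR x - 1 - x by have := expR_ge1Dx x; lra.
rewrite ger0_norm//.
have h2 : expR x - 1 <= x * expR x.
  have := expR_ge1Dx (- x); rewrite expRN => h; have e0 := expR_gt0 x.
  have : (1 - x) * expR x <= 1 by rewrite -ler_pdivlMr// div1r.
  lra.
have e1 : 1 <= expR `|x| by rewrite -expR0 ler_expR.
have [x0|x0] := leP 0 x.
  rewrite ger0_norm//; have := expR_gt0 x; nra.
have h3 := expR_ge1Dx x.
nra.
Qed.

Lemma sqnormD a z h : sqnorm (z + h *: a) = sqnorm z + 2 * h * dotv a z + h ^+ 2 * sqnorm a.
Proof.
rewrite /sqnorm /dotv !mulr_sumr -!big_split; apply: eq_bigr => i _ /=.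
by rewrite !mxE; ring.
Qed.

(** The quadratic remainder is dominated by one integrable kernel, with M depending on t but not on
    z: integrated against a function, it gives the derivative of a convolution without
    differentiation under the integral sign. *)
Lemma gauss_taylor a t : 0 < t -> exists2 M, 0 <= M & forall h z, `|h| <= 1 ->
  `|gauss t (z + h *: a) - gauss t z - h * K1 a t z| <= M * h ^+ 2 * gauss (2 * t) z.
Proof.
move=> t0; set A := l1norm a; set A2 := sqnorm a.
have A0 : 0 <= A by exact: l1norm_ge0.
have A20 : 0 <= A2 by exact: sqnorm_ge0.
exists (2 `^ (n%:R / 2) * ((2 + A2 / (4 * t)) * expR (2 * A ^+ 2 / t + A2 / (2 * t)))).
  by rewrite mulr_ge0 ?powR_ge0// mulr_ge0 ?expR_ge0// addr_ge0// divr_ge0// mulr_ge0// (ltW t0).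
move=> h z h1; set q := sqnorm z; set r := Num.sqrt q.
have r0 : 0 <= r by exact: sqrtr_ge0.
have r2 : r ^+ 2 = q by rewrite sqr_sqrtr// sqnorm_ge0.
have dr : `|dotv a z| <= A * r by exact: dotv_le.
(* [de] is the increment of the exponent when z moves by h a; [eta] bounds |de| / |h|. *)
pose de := - (2 * h * dotv a z + h ^+ 2 * A2) / (4 * t).
pose eta := (2 * A * r + A2) / (4 * t).
have eta0 : 0 <= eta by rewrite divr_ge0 ?mulr_ge0 ?addr_ge0 ?mulr_ge0// (ltW t0).
have hE : gauss t (z + h *: a) - gauss t z - h * K1 a t z =
   gauss t z * (expR de - 1 - de - h ^+ 2 * (A2 / (4 * t))).
  have -> : gauss t (z + h *: a) = gauss t z * expR de.
    rewrite /gauss -[RHS]mulrA -expRD sqnormD; congr (_ * expR _).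
    by rewrite /de /A2; field; rewrite gt_eqF.
  by rewrite /K1 /de; field; rewrite gt_eqF.
have hh : h ^+ 2 <= `|h| by rewrite -(real_normK (num_real h)) expr2 ler_piMl.
have dele : `|de| <= `|h| * eta.
  rewrite /de /eta normrM normrN normfV (gtr0_norm (mulr_gt0 (@ltr0Sn R 3) t0)) mulrA ler_wpM2r ?invr_ge0 ?mulr_ge0 ?(ltW t0)//.
  apply: le_trans (ler_normD _ _) _; rewrite [`|2 * h * _|]normrM [`|2 * h|]normrM normr_nat (ger0_norm (mulr_ge0 (sqr_ge0 h) A20)).
  have p1 : `|h| * `|dotv a z| <= `|h| * (A * r) by rewrite ler_wpM2l.
  have p2 : h ^+ 2 * A2 <= `|h| * A2 by rewrite ler_wpM2r.
  lra.
have dele1 : `|de| <= eta by apply: le_trans dele _; rewrite ler_piMl.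
rewrite hE normrM (ger0_norm (gauss_ge0 _ _)) (gauss_double z t0).
rewrite -/q [X in _ <= X](_ : _ = 2 `^ (n%:R / 2) * gauss (2 * t) z *
   (h ^+ 2 * ((2 + A2 / (4 * t)) * expR (2 * A ^+ 2 / t + A2 / (2 * t))))); last by ring.
rewrite [X in X <= _](_ : _ = 2 `^ (n%:R / 2) * gauss (2 * t) z *
   (expR (- (q / (8 * t))) * `|expR de - 1 - de - h ^+ 2 * (A2 / (4 * t))|)); last by ring.
rewrite ler_wpM2l ?mulr_ge0 ?powR_ge0 ?gauss_ge0//.
have b1 : `|expR de - 1 - de - h ^+ 2 * (A2 / (4 * t))| <= h ^+ 2 * ((2 + A2 / (4 * t)) * expR (2 * eta)).
  apply: le_trans (ler_normB _ _) _.
  rewrite [X in _ + X]ger0_norm; last by rewrite mulr_ge0 ?sqr_ge0 ?divr_ge0 ?mulr_ge0 ?(ltW t0).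
  have c1 : `|expR de - 1 - de| <= h ^+ 2 * (eta ^+ 2 * expR eta).
    apply: le_trans (expR_taylor _) _; rewrite mulrA; apply: ler_pM; rewrite ?sqr_ge0 ?expR_ge0 ?ler_expR//.
    rewrite -(real_normK (num_real de)) -(real_normK (num_real h)) -exprMn.
    by rewrite ler_pXn2r// nnegrE mulr_ge0.
  have c2 : eta ^+ 2 * expR eta <= 2 * expR (2 * eta).
    have -> : expR (2 * eta) = expR eta * expR eta by rewrite -expRD; congr expR; ring.
    rewrite mulrA ler_wpM2r ?expR_ge0//; have := @expR_ge1Dxn R eta 1 eta0; rewrite (_ : 2`! = 2)//; lra.
  have c3 : 1 <= expR (2 * eta) by rewrite -expR0 ler_expR mulr_ge0.
  have c4 : 0 <= A2 / (4 * t) by rewrite divr_ge0 ?mulr_ge0// (ltW t0).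
  have c5 : 0 <= h ^+ 2 by exact: sqr_ge0.
  apply: (le_trans (lerD (le_trans c1 (ler_wpM2l c5 c2)) (lexx _))).
  rewrite -mulrDr ler_wpM2l//; move: c3 c4; move: (expR (2 * eta)) (A2 / (4 * t)) => E D; nra.
apply: (@le_trans _ _ (expR (- (q / (8 * t))) * (h ^+ 2 * ((2 + A2 / (4 * t)) * expR (2 * eta))))).
  by rewrite ler_wpM2l ?expR_ge0.
rewrite mulrCA ler_wpM2l ?sqr_ge0// mulrCA ler_wpM2l ?addr_ge0 ?divr_ge0 ?mulr_ge0 ?(ltW t0)//.
(* Completing the square in r: the Gaussian factor absorbs e^{2 eta} up to the constant exponent
   that appears in M. *)
rewrite -expRD ler_expR -subr_ge0 [X in 0 <= X](_ : _ = (r - 4 * A) ^+ 2 / (8 * t)).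
  by rewrite divr_ge0 ?sqr_ge0 ?mulr_ge0 ?(ltW t0).
by rewrite -r2 /eta; field; rewrite gt_eqF.
Qed.

End kernel.

(** * Differentiation of the heat semigroup *)

Section deriv.
Context {R : realType} {n : nat}.
Notation V := 'rV[R]_n.
Notation mu := (rvm n).
Implicit Types (a x z : V) (t s h : R) (g : V -> R).

Lemma derive_bound (F : V -> R) a x (l M : R) :
  (forall h, `|h| <= 1 -> `|F (x + h *: a) - F x - h * l| <= M * h ^+ 2) -> 'D_a F x = l.
Proof.
move=> H; apply: cvg_lim => //; apply/cvgrPdist_le => e e0.
have M0 : 0 <= M.
  by have := H 1; rewrite normr1 lexx expr1n mulr1 => /(_ erefl); exact: le_trans.
near=> h.
have h0 : h != 0 by near: h; exact: nbhs_dnbhs_neq.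
have h1 : `|h| <= 1.
  by near: h; apply: dnbhs0_le.
have he : `|h| <= e / (M + 1).
  by near: h; apply: dnbhs0_le; rewrite divr_gt0// ltr_wpDl.
have := H h h1; rewrite [x + _]addrC => Hh.
rewrite distrC (_ : h^-1 *: _ - l = h^-1 * (F (h *: a + x) - F x - h * l)); last first.
  by rewrite mulrBr mulKf.
rewrite normrM normfV ler_pdivrMl ?normr_gt0//.
apply: le_trans Hh _; rewrite -(real_normK (num_real h)) expr2 mulrA.
have hp : 0 < `|h| by rewrite normr_gt0.
rewrite mulrC; apply: ler_wpM2l => //.
apply: (@le_trans _ _ ((M + 1) * `|h|)); first by apply: ler_wpM2r => //; lra.
by rewrite mulrC -ler_pdivlMr// ltr_wpDl.
Unshelve. all: by end_near. Qed.

Lemma heatE t g : (rvm n).-integrable setT (EFin \o g) -> 0 < t ->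
  heat t g = cnv (gauss t) g.
Proof.
move=> ig t0; apply/funext => x.
rewrite /heat /iintR /cnv /RI /Rintegral iintE//.
have := cnv_intg2 x (measurable_gauss t) (fun z => gauss_sup z t0) (L1_intI ig).
by move/L1_Itg.
Qed.

(** The remainder kernel is small both in L^1 and pointwise, which gives the two conclusions; the
    factor 1 + G0 covers both constants. The L^1 bound serves the integration by parts in
    [adheat_fnl_orth]. *)
Lemma cnv_taylor a t : 0 < t -> exists2 M, 0 <= M & forall g B, L1 mu g B -> forall h, `|h| <= 1 ->
  L1 mu (fun x => cnv (gauss t) g (x + h *: a) - cnv (gauss t) g x - h * cnv (K1 a t) g x) (M * h ^+ 2 * B) /\
  forall x, `|cnv (gauss t) g (x + h *: a) - cnv (gauss t) g x - h * cnv (K1 a t) g x| <= M * h ^+ 2 * B.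
Proof.
move=> t0; have [M M0 HM] := gauss_taylor a t0.
have t20 : 0 < 2 * t by rewrite mulr_gt0.
pose G0 := (2 * t) `^ (- (n%:R / 2)).
have G00 : 0 <= G0 by exact: powR_ge0.
exists (M * (1 + G0)); first by rewrite mulr_ge0 ?addr_ge0.
move=> g B hg h h1.
have B0 := L1_ge0 hg.
pose k z := gauss t (z + h *: a) - gauss t z - h * K1 a t z.
have mk : measurable_fun setT k.
  apply: measurable_funB.
    apply: measurable_funB; last exact: measurable_gauss.
    exact: (L1_trans (h *: a) (L1_gauss t0)).1.
  by apply: measurable_funM => //; exact: measurable_K1.
have hkL : L1 mu k (M * h ^+ 2).
  apply: (L1_le (fun z => M * h ^+ 2 * gauss (2 * t) z)) => //.
    by move=> z; exact: HM.
  have c0 : 0 <= M * h ^+ 2 by rewrite mulr_ge0 ?sqr_ge0.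
  rewrite -[X in L1 _ _ X](ger0_norm c0) -[X in L1 _ _ X]mulr1.
  by apply: L1_scale; exact: L1_gauss.
have ks z : `|k z| <= M * h ^+ 2 * G0.
  apply: le_trans (HM h z h1) _; rewrite (ler_wpM2l (mulr_ge0 M0 (sqr_ge0 h)))//.
  exact: le_trans (ler_norm _) (gauss_sup z t20).
have kE x : cnv (gauss t) g (x + h *: a) - cnv (gauss t) g x - h * cnv (K1 a t) g x = cnv k g x.
  have i1 : L1 mu (fun y => gauss t (x + h *: a - y) * g y) _ :=
    cnv_intg2 (x + h *: a) (measurable_gauss t) (fun z => gauss_sup z t0) hg.
  have i2 := cnv_intg2 x (measurable_gauss t) (fun z => gauss_sup z t0) hg.
  have i3 := cnv_intg2 x (measurable_K1 a t) (fun z => K1_sup a z t0) hg.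
  rewrite /cnv -(I_scale h i3) -(I_sub i1 i2) -(I_sub (L1_sub i1 i2) (L1_scale h i3)).
  by apply: eq_I => y; rewrite /k [x + _ - y]addrAC; ring.
split.
  apply: (@eq_L1 _ _ _ _ (cnv k g)) => //.
  apply: L1_weak (cnv_L1 hkL hg).
  rewrite ler_wpM2r// [X in _ <= X]mulrAC ler_peMr ?(mulr_ge0 M0 (sqr_ge0 h))//.
  by rewrite lerDl.
move=> x; rewrite kE; apply: le_trans (cnv_sup2 x mk ks hg) _.
rewrite ler_wpM2r// [X in _ <= X]mulrAC (ler_wpM2l (mulr_ge0 M0 (sqr_ge0 h)))//.
by rewrite lerDr.
Qed.

Lemma adgrad_heat a t g : 0 < t -> (rvm n).-integrable setT (EFin \o g) ->
  adgrad a (heat t g) = cnv (K1 a t) g.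
Proof.
move=> t0 ig; apply/funext => x; rewrite heatE// /adgrad.
have [M M0 HM] := cnv_taylor a t0.
apply: (@derive_bound _ _ _ _ (M * RI mu (fun x => `|g x|))) => h h1.
have [_] := HM _ _ (L1_intI ig) h h1 => /(_ x).
by rewrite mulrAC.
Qed.

Lemma adgrad_gauss a t : 0 < t -> adgrad a (@gauss R n t) = K1 a t.
Proof.
move=> t0; apply/funext => x; rewrite /adgrad.
have [M M0 HM] := gauss_taylor a t0.
apply: (@derive_bound _ _ _ _ (M * gauss (2 * t) x)) => h h1.
by have := HM h x h1; rewrite mulrAC.
Qed.

Lemma cnv_gauss_gauss s t : 0 < s -> 0 < t -> cnv (gauss t) (gauss s) = @gauss R n (s + t).
Proof.
by move=> s0 t0; apply/funext => x; rewrite /cnv /RI /Rintegral integral_gauss_mul.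
Qed.

(** The semigroup law, differentiated in the direction a. *)
Lemma cnv_K1_gauss a s t : 0 < s -> 0 < t -> cnv (K1 a t) (gauss s) = @K1 R n a (s + t).
Proof.
move=> s0 t0; rewrite -adgrad_heat//; last exact: L1_Itg (L1_gauss s0).
rewrite heatE//; last exact: L1_Itg (L1_gauss s0).
by rewrite cnv_gauss_gauss// adgrad_gauss// addr_gt0.
Qed.

Lemma cnv_gauss_K1 a s t : 0 < s -> 0 < t -> cnv (gauss s) (K1 a t) = @K1 R n a (s + t).
Proof.
move=> s0 t0; rewrite -cnv_K1_gauss//; apply/funext => x.
by rewrite cnvC//; [exact: measurable_gauss|exact: measurable_K1].
Qed.

Lemma heat_heat s t g B x : 0 < s -> 0 < t -> L1 mu g B ->
  cnv (gauss s) (cnv (gauss t) g) x = cnv (gauss (s + t)) g x.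
Proof.
move=> s0 t0 hg.
apply: (etrans (cnvA x (measurable_gauss s) (fun z => gauss_sup z s0) (L1_gauss t0) (fun z => gauss_sup z t0) hg)).
by congr (cnv _ g x); rewrite addrC; exact: cnv_gauss_gauss.
Qed.

Lemma heat_adheat a s t g B x : 0 < s -> 0 < t -> L1 mu g B ->
  cnv (gauss s) (cnv (K1 a t) g) x = cnv (K1 a (s + t)) g x.
Proof.
move=> s0 t0 hg.
apply: (etrans (cnvA x (measurable_gauss s) (fun z => gauss_sup z s0) (L1_K1 a t0) (fun z => K1_sup a z t0) hg)).
by congr (cnv _ g x); exact: cnv_gauss_K1.
Qed.

Lemma adheat_heat a s t g B x : 0 < s -> 0 < t -> L1 mu g B ->
  cnv (K1 a s) (cnv (gauss t) g) x = cnv (K1 a (s + t)) g x.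
Proof.
move=> s0 t0 hg.
apply: (etrans (cnvA x (measurable_K1 a s) (fun z => K1_sup a z s0) (L1_gauss t0) (fun z => gauss_sup z t0) hg)).
by congr (cnv _ g x); rewrite addrC; exact: cnv_K1_gauss.
Qed.

End deriv.

(** * The Duhamel operator *)

Section beta_integrals.
Context {R : realType}.
Implicit Types (s t c h x y : R) (f b : R -> R).

(** Truncation to the open interval: time integrals become integrals over the line, to which [L1],
    [RI] and the Fubini lemmas apply, and the endpoints, where the kernels degenerate, are left
    out. *)
Definition tcut t f s : R := if (0 < s) && (s < t) then f s else 0.

Lemma tcutE t f s : 0 < s -> s < t -> tcut t f s = f s.
Proof. by rewrite /tcut => -> ->. Qed.

Lemma measurable_cut t f : measurable_fun setT f -> measurable_fun setT (tcut t f).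
Proof.
move=> mf; apply: measurable_fun_ifT => //.
by apply: measurable_and; exact: measurable_fun_ltr.
Qed.

Lemma measurable_powR_comp d (T : measurableType d) (k : T -> R) (p : R) :
  measurable_fun setT k -> measurable_fun setT (fun x : T => k x `^ p).
Proof. by move=> mk; exact: (measurableT_comp (measurable_powR p) mk). Qed.

(** For c < 1 the integrand is singular at 0: the fundamental theorem of calculus is applied on
    [t/(k+2), t], and monotone convergence removes the lower endpoint. *)
Lemma L1_cut_powR (c t : R) : 0 < c -> 0 < t ->
  L1 leb (tcut t (fun s => s `^ (c - 1))) (c^-1 * t `^ c).
Proof.
move=> c0 t0; pose f s := s `^ (c - 1).
have mf : measurable_fun setT f by exact: measurable_powR.
split; first exact: measurable_cut.
(* With k+2 rather than k+1 the interval is nondegenerate already for k = 0. *)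
pose fk (k : nat) s := (if t / k.+2%:R <= s then tcut t f s else 0)%:E.
have mfk k : measurable_fun setT (fk k).
  apply/measurable_EFinP; apply: measurable_fun_ifT => //; last exact: measurable_cut.
  exact: measurable_fun_ler.
have cut0 s : 0 <= tcut t f s by rewrite /tcut; case: ifP => // _; exact: powR_ge0.
have fk0 k s : (0 <= fk k s)%E by rewrite lee_fin; case: ifP.
have ndfk s : {homo fk ^~ s : k m / (k <= m)%N >-> (k <= m)%E}.
  move=> k m km; rewrite /fk lee_fin; case: ifPn => h1; last by case: ifP.
  rewrite ifT//; apply: le_trans h1; rewrite ler_pM2l// lef_pV2 ?posrE//.
  by rewrite ler_nat ltnS ltnS.
have cvfk s : fk ^~ s @ \oo --> (`|tcut t f s|)%:E.
  rewrite ger0_norm//; have [s0|s0] := ltP 0 s; last first.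
    rewrite {1}/tcut ltNge s0 /=; apply: cvg_near_cst; apply: nearW => k.
    rewrite /fk leNgt; case: ltP => // h; exfalso; move: s0; rewrite leNgt; case/negP.
    by apply: lt_le_trans h; rewrite divr_gt0.
  apply: cvg_near_cst; exists (Num.truncn (t / s)) => // k /= hk.
  rewrite /fk ifT// ler_pdivrMr// mulrC -ler_pdivrMr//.
  apply: (le_trans (ltW (truncnS_gt _))); rewrite ler_nat; exact: (leq_trans hk).
have := @cvg_monotone_convergence _ _ R leb setT measurableT fk mfk (fun k s _ => fk0 k s) (fun s _ => ndfk s).
have -> : (\int[leb]_x limn (fk ^~ x) = \int[leb]_x (`|tcut t f x|)%:E)%E.
  by apply: eq_integral => x _; apply: cvg_lim => //; exact: cvfk.
move=> cv; rewrite -(cvg_lim _ cv)//; apply: lime_le; first by apply/cvg_ex; eexists; exact: cv.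
apply: nearW => k; set e := t / k.+2%:R.
have e0 : 0 < e by rewrite divr_gt0.
have et : e < t by rewrite ltr_pdivrMr// ltr_pMr// ltr1n.
pose F s := c^-1 * s `^ c.
have posI s : s \in `[e, t] -> 0 < s.
  by rewrite in_itv/= => /andP[es _]; exact: lt_le_trans es.
have dF s : 0 < s -> is_derive s 1 F (f s).
  move=> s0.
  have d1 : derivable (@powR R ^~ c) s 1 by apply: derivable_powR; rewrite in_itv/= s0.
  have d2 : 'D_1 (@powR R ^~ c) s = c * s `^ (c - 1).
    by rewrite -derive1E powR_derive1// in_itv/= s0.
  have := is_deriveZ c^-1 (DeriveDef d1 d2).
  by rewrite /F /f => h; apply: is_derive_eq h _; rewrite -[LHS]/(c^-1 * (c * _)) mulKf// gt_eqF.
have cf : {within `[e, t], continuous f}.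
  apply: continuous_in_subspaceT => s /set_mem/posI s0.
  apply: differentiable_continuous; apply/derivable1_diffP.
  by apply: derivable_powR; rewrite in_itv/= s0.
have cF s : 0 < s -> {for s, continuous F}.
  by move=> s0; apply: differentiable_continuous; apply/derivable1_diffP; have [] := dF s s0.
have DF : derivable_oo_LRcontinuous F e t.
  split.
  - move=> s; rewrite in_itv/= => /andP[es _]; have [] // := dF s (lt_trans e0 es).
  - exact/cvg_at_right_filter/cF.
  - by apply/cvg_at_left_filter/cF.
have F'f : {in `]e, t[, derive1 F =1 f}.
  move=> s; rewrite in_itv/= => /andP[es _]; rewrite derive1E.
  by have [] := dF s (lt_trans e0 es).
have := continuous_FTC2 et cf DF F'f.
rewrite integral_leb//; last first.
  by apply/measurable_EFinP; apply: measurable_funTS.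
move=> FTC.
apply: (@le_trans _ _ (\int[leb]_(x in `[e, t]) (f x)%:E)%E).
  rewrite [leRHS]integral_mkcond; apply: ge0_le_integral => //.
  - apply/(measurable_restrictT _ _).1 => //; apply: measurable_funTS.
    exact/measurable_EFinP.
  - move=> x _; rewrite /fk patchE; case: ifPn => h1; last first.
      by case: ifP => // _; rewrite lee_fin powR_ge0.
    rewrite /tcut; case: ifPn => [/andP[h2 h3]|_]; last first.
      by case: ifP => // _; rewrite lee_fin powR_ge0.
    by rewrite ifT// inE/= in_itv/= h1 ltW.
rewrite FTC -EFinD lee_fin /F gerBl.
by rewrite mulr_ge0 ?invr_ge0 ?powR_ge0// ltW.
Qed.

Lemma L1_cut_refl t f B : L1 leb (tcut t f) B -> L1 leb (tcut t (fun s => f (t - s))) B.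
Proof.
move=> [mf fB].
have E s : tcut t (fun s => f (t - s)) s = tcut t f (-1 * s + t).
  by rewrite /tcut mulN1r [- s + t]addrC subr_gt0 gtrBl andbC.
have N1 : -1 != 0 :> R by rewrite oppr_eq0 oner_neq0.
have m1 : measurable_fun setT (fun s : R => -1 * s + t).
  by apply: measurable_funD => //; exact: measurable_funM.
split.
  by rewrite (funext E); exact: (measurableT_comp mf m1).
under eq_integral do rewrite E.
have := @ge0_integral_leb_affine R (-1) t (fun s => (`|tcut t f s|)%:E) N1.
rewrite normrN1 invr1 mul1e => -> //.
by apply/measurable_EFinP; exact: measurableT_comp.
Qed.

(* bounds the beta integral of [(t - s)^{-1/2} s^{-c}] over [0, t], up to the factor [t^{1/2-c}] *)
Definition cB c : R := 2 * 2 `^ c + 2 `^ 2^-1 / (1 - c).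

Lemma cB_ge0 c : c < 1 -> 0 <= cB c.
Proof. move=> c1; have h : 0 <= 1 - c by rewrite subr_ge0 ltW.
by rewrite /cB; apply: addr_ge0; [rewrite mulr_ge0 ?powR_ge0|rewrite divr_ge0 ?powR_ge0]. Qed.

Lemma L1_cut_half t : 0 < t -> L1 leb (tcut t (fun s => (t - s) `^ (- 2^-1))) (2 * t `^ 2^-1).
Proof.
move=> t0; have h := @L1_cut_powR 2^-1 t _ t0.
apply: (@L1_cut_refl t (fun s => s `^ (- 2^-1))).
rewrite (_ : - 2^-1 = 2^-1 - 1 :> R); last by lra.
by have := h (_ : 0 < 2^-1); rewrite invrK; apply; rewrite invr_gt0.
Qed.

(** On s >= t/2 the factor s^{-c} is at most (t/2)^{-c}, on s < t/2 the factor (t - s)^{-1/2} is at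
    most (t/2)^{-1/2}; the two majorants give the two terms of [cB]. *)
Lemma L1_cut_beta c t : 0 <= c -> c < 1 -> 0 < t ->
  L1 leb (tcut t (fun s => (t - s) `^ (- 2^-1) * s `^ (- c))) (cB c * t `^ (2^-1 - c)).
Proof.
move=> c0 c1 t0.
have h1 := L1_cut_half t0.
have c1' : 0 < 1 - c by rewrite subr_gt0.
have h2 := L1_cut_powR c1' t0.
rewrite (_ : 1 - c - 1 = - c) in h2; last by ring.
have t20 : 0 < t / 2 by rewrite divr_gt0.
have h := L1_add (L1_scale ((t / 2) `^ (- c)) h1) (L1_scale ((t / 2) `^ (- 2^-1)) h2).
have E : `|(t / 2) `^ (- c)| * (2 * t `^ 2^-1) + `|(t / 2) `^ (- 2^-1)| * ((1 - c)^-1 * t `^ (1 - c))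
   = cB c * t `^ (2^-1 - c).
  rewrite !ger0_norm ?powR_ge0// ![(t / 2) `^ _]powRM ?invr_ge0 ?(ltW t0)//.
  have i2 r : (2^-1 : R) `^ (- r) = 2 `^ r by rewrite -powR_inv1// -powRrM mulN1r opprK.
  rewrite !i2 /cB.
  have -> : t `^ (2^-1 - c) = t `^ (- c) * t `^ 2^-1.
    by rewrite -powRD 1?addrC// (gt_eqF t0) implybT.
  have -> : t `^ (1 - c) = t `^ (- c) * t `^ 2^-1 * t `^ 2^-1.
    by rewrite -!powRD ?(gt_eqF t0) ?implybT//; congr (_ `^ _); lra.
  have : t `^ (- 2^-1) * t `^ 2^-1 = 1 by rewrite powRN mulVf// gt_eqF// powR_gt0.
  move: (t `^ (- 2^-1)) (t `^ 2^-1) (t `^ (- c)) => x y z xy.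
  rewrite (_ : x * 2 `^ 2^-1 * _ = 2 `^ 2^-1 / (1 - c) * (z * y) * (x * y)); last by ring.
  by rewrite xy; ring.
rewrite -E; apply: (L1_le _ _ _ _ h).
- apply: measurable_cut; apply: measurable_funM; apply: measurable_powR_comp => //.
  exact: measurable_funB.
- move=> s; rewrite /tcut; case: ifPn => [/andP[s0 st]|_]; last by rewrite normr0 !mulr0 addr0.
  rewrite ger0_norm ?mulr_ge0 ?powR_ge0//.
  have anti (p x y : R) : 0 <= p -> 0 < x -> x <= y -> y `^ (- p) <= x `^ (- p).
    move=> p0 x0 xy; rewrite !powRN lef_pV2 ?posrE ?powR_gt0//; last exact: lt_le_trans xy.
    by apply: ge0_ler_powR => //; rewrite nnegrE ltW// (lt_le_trans x0).
  have [hs|hs] := leP (t / 2) s.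
    apply: ler_wpDr; first by rewrite mulr_ge0 ?powR_ge0.
    by rewrite mulrC ler_wpM2r ?powR_ge0//; exact: anti.
  apply: ler_wpDl; first by rewrite mulr_ge0 ?powR_ge0.
  by rewrite ler_wpM2r ?powR_ge0//; apply: anti => //; lra.
Qed.

End beta_integrals.

(** * Duhamel integrals in kernel form *)

Section duhamel_operator.
Context {R : realType} {n : nat}.
Notation V := 'rV[R]_n.
Notation mu := (rvm n).
Variable (a : V).
Implicit Types (x : V) (s t : R) (g : R -> V -> R) (w k : V -> R) (b : R -> R) (A B C : R).

Definition jmeas g := measurable_fun setT (fun z : R * V => g z.1 z.2).

(** The derivative is carried out on the kernel, and the measures are those for which Fubini is
    available; [duhamelE] identifies this with [duhamel]. *)
Definition duh g t x : R := RI leb (tcut t (fun s => cnv (K1 a (t - s)) (g s) x)).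

Lemma jmeas_meas g s : jmeas g -> measurable_fun setT (g s).
Proof. by move=> mg; exact: (measurable_fun_pair2 s mg). Qed.

(** Kernel time and source time are independent variables, so that shifted kernels a . grad e^{(t -
    s + r) Delta} are covered as well. *)
Lemma measurable_cnvK g : jmeas g -> measurable_fun setT (fun z : (R * R) * V => cnv (K1 a z.1.1) (g z.1.2) z.2).
Proof.
move=> mg.
apply: (measurable_I2 mu (H := fun w : ((R * R) * V) * V => K1 a w.1.1.1 (w.1.2 - w.2) * g w.1.1.2 w.2)).
have p1 : measurable_fun setT (fun w : ((R * R) * V) * V => w.1.1).
  by do 2 apply: measurable_fst_comp.
have p2 : measurable_fun setT (fun w : ((R * R) * V) * V => w.1.2 - w.2).
  apply: (measurable_comp2 (F := fun z : V * V => z.1 - z.2) measurable_subV) => //.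
  by apply: measurable_snd_comp; exact: measurable_fst.
apply: measurable_funM.
  exact: (measurable_comp2 (measurable_K1_2 a) (measurable_fst_comp p1) p2).
exact: (measurable_comp2 mg (measurable_snd_comp p1) measurable_snd).
Qed.

Let mH3 g : jmeas g -> measurable_fun setT (fun w : (R * V) * R =>
  tcut w.1.1 (fun s => cnv (K1 a (w.1.1 - s)) (g s) w.1.2) w.2).
Proof.
move=> mg.
have p1 : measurable_fun setT (fun w : (R * V) * R => w.1.1) by do 2 apply: measurable_fst_comp.
have p2 : measurable_fun setT (fun w : (R * V) * R => w.1.2).
  by apply: measurable_snd_comp; exact: measurable_fst.
apply: measurable_fun_ifT => //.
  by apply: measurable_and; apply: measurable_fun_ltr.
have p3 : measurable_fun setT (fun w : (R * V) * R => (w.1.1 - w.2, w.2)).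
  by apply: measurable_fun_pair => //; exact: measurable_funB.
exact: (measurable_comp2 (measurable_cnvK mg) p3 p2).
Qed.

Lemma jmeas_S g : jmeas g -> jmeas (duh g).
Proof. by move=> mg; exact: (measurable_I2 leb (mH3 mg)). Qed.

Let H g t (z : R * V) : R := tcut t (fun s => cnv (K1 a (t - s)) (g s) z.2) z.1.

Let mH g t : jmeas g -> measurable_fun setT (H g t).
Proof.
move=> mg; have p1 : measurable_fun setT (fun z : R * V => (t, z.2)) by exact: measurable_fun_pair.
exact: (measurable_comp2 (mH3 mg) p1 measurable_fst).
Qed.

Lemma measurable_cutcnv g t x : jmeas g -> measurable_fun setT (tcut t (fun s => cnv (K1 a (t - s)) (g s) x)).
Proof. by move=> mg; exact: (measurable_fun_pair1 x (mH t mg)). Qed.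

Lemma duh_sup g t x b B : jmeas g -> (forall s, 0 < s -> s < t -> `|cnv (K1 a (t - s)) (g s) x| <= b s) ->
  L1 leb (tcut t b) B -> `|duh g t x| <= B /\
  L1 leb (tcut t (fun s => cnv (K1 a (t - s)) (g s) x)) B.
Proof.
move=> mg hb hB.
suff h : L1 leb (tcut t (fun s => cnv (K1 a (t - s)) (g s) x)) B by split=> //; exact: L1_I h.
apply: (L1_le _ _ _ _ hB); first exact: measurable_cutcnv.
by move=> s; rewrite /tcut; case: ifPn => [/andP[]|_]; [exact: hb|rewrite normr0].
Qed.

Section duh_L1.
Variables (g : R -> V -> R) (t : R) (b : R -> R) (B : R).
Hypothesis mg : jmeas g.
Hypothesis gb : forall s, 0 < s -> s < t -> L1 mu (g s) (b s).
Hypothesis hB : L1 leb (tcut t (fun s => cK a * (t - s) `^ (- 2^-1) * b s)) B.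

Let Hb s : (\int[mu]_x (`|H g t (s, x)|)%:E <= (tcut t (fun s => cK a * (t - s) `^ (- 2^-1) * b s) s)%:E)%E.
Proof.
rewrite /H /tcut /=; case: ifPn => [/andP[s0 st]|_]; last first.
  by under eq_integral do rewrite normr0; rewrite integral0.
by apply: (cnv_L1 _ (gb s0 st)).2; apply: L1_K1; rewrite subr_gt0.
Qed.

Lemma duh_L1 : L1 mu (duh g t) B.
Proof. exact: (fub_L1 (mH t mg) hB Hb). Qed.

(** Fubini in (s, x): testing commutes with the time integral. With w a reflected kernel this
    becomes [duh_cnv], by which e^{r Delta} acts inside a Duhamel integral. *)
Lemma duh_pair w C : measurable_fun setT w -> (forall x, `|w x| <= C) ->
  RI mu (fun x => w x * duh g t x) =
  RI leb (tcut t (fun s => RI mu (fun x => w x * cnv (K1 a (t - s)) (g s) x))) /\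
  L1 leb (tcut t (fun s => RI mu (fun x => w x * cnv (K1 a (t - s)) (g s) x))) (C * B).
Proof.
move=> mw wC; have C0 : 0 <= C by exact: le_trans (wC 0).
pose Hw (z : R * V) := w z.2 * H g t z.
have mHw : measurable_fun setT Hw.
  by apply: measurable_funM; [exact: (measurableT_comp mw)|exact: mH].
have hBC := L1_scale C hB; rewrite (ger0_norm C0) in hBC.
have mHx s : measurable_fun setT (fun x => H g t (s, x)) by exact: (measurable_fun_pair2 s (mH t mg)).
have Hwb s : (\int[mu]_x (`|Hw (s, x)|)%:E <= (C * tcut t (fun s => cK a * (t - s) `^ (- 2^-1) * b s) s)%:E)%E.
  have h : L1 mu (fun x => H g t (s, x)) (tcut t (fun s => cK a * (t - s) `^ (- 2^-1) * b s) s).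
    by split; [exact: mHx|exact: Hb].
  have := (L1_mulb h mw wC).2; rewrite mulrC; apply: le_trans.
  by rewrite le_eqVlt; apply/orP; left; apply/eqP; apply: eq_integral => x _; rewrite /Hw /= mulrC.
have E : (fun s => RI mu (fun x => Hw (s, x))) =1 tcut t (fun s => RI mu (fun x => w x * cnv (K1 a (t - s)) (g s) x)).
  move=> s; rewrite /Hw /H /tcut /=; case: ifPn => // _.
  under eq_I do rewrite mulr0.
  by rewrite /RI Rintegral_cst// mul0r.
split; last first.
  apply: (eq_L1 E); split; first exact: measurable_I2.
  apply: le_trans (hBC.2); apply: ge0_le_integral => //.
  - by apply/measurable_EFinP; apply: measurableT_comp => //; exact: measurable_I2.
  - by apply/measurable_EFinP; apply: measurableT_comp => //; exact: hBC.1.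
  - move=> s _; apply: (@le_trans _ _ (C * tcut t (fun s => cK a * (t - s) `^ (- 2^-1) * b s) s)%:E).
      by apply: abs_I_le (Hwb s); exact: (measurable_fun_pair2 s mHw).
    by rewrite lee_fin ler_norm.
rewrite -(eq_I leb E) (fub_swap mHw hBC Hwb); apply: ae_eq_I.
- by apply: measurable_funM => //; exact: (duh_L1).1.
- exact: measurable_I1.
(* The time integral is known to converge for almost every x, and it is there that w x is taken out
   of it. *)
- have := fub_ae (mH t mg) hB Hb; apply: filterS => x ix _.
  by rewrite /duh /RI /Hw /= RintegralZl.
Qed.

Lemma duh_cnv k C x : measurable_fun setT k -> (forall y, `|k y| <= C) ->
  cnv k (duh g t) x = RI leb (tcut t (fun s => cnv k (cnv (K1 a (t - s)) (g s)) x)) /\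
  L1 leb (tcut t (fun s => cnv k (cnv (K1 a (t - s)) (g s)) x)) (C * B).
Proof.
move=> mk kC.
exact: (duh_pair (measurableT_comp mk (measurable_reflV x)) (fun y => kC (x - y))).
Qed.

End duh_L1.
End duhamel_operator.

Section time_integrals.
Context {R : realType}.
Implicit Types (s t c h x y : R) (F f b : R -> R).

Lemma ae_neq (r : R) : {ae leb, forall s : R, s != r}.
Proof.
exists [set r]; split.
- exact: measurable_set1.
- exact: lebesgue_measure_set1.
- by move=> s /= /negP; rewrite negbK => /eqP.
Qed.

Lemma ae_neq2 (r t : R) : {ae leb, forall s : R, s != r /\ s != t}.
Proof.
exists ([set r] `|` [set t]); split.
- by apply: measurableU; exact: measurable_set1.
- by apply: (@countable_lebesgue_measure0 R); apply: finite_set_countable; rewrite finite_setU.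
- move=> s /= /not_andP[] /negP; rewrite negbK => /eqP; [by left|by right].
Qed.

Lemma RI_leb_trans c (f : R -> R) : measurable_fun setT f ->
  RI leb (fun s => f (s + c)) = RI leb f.
Proof.
move=> mf.
have h (g : R -> \bar R) : measurable_fun setT g -> (forall x, 0 <= g x)%E ->
    (\int[leb]_s g (s + c)%R = \int[leb]_s g s)%E.
  move=> mg g0; have := ge0_integral_leb_affine c (oner_neq0 R) mg g0.
  rewrite normr1 invr1 mul1e => <-.
  by apply: eq_integral => s _; rewrite mul1r.
rewrite /RI /Rintegral integralE [in RHS]integralE; congr (fine (_ - _)%E).
  transitivity (\int[leb]_s (EFin \o f)^\+%E (s + c)%R)%E.
    by apply: eq_integral => s _; rewrite !funeposE.
  by rewrite h//; apply: measurable_funepos; exact/measurable_EFinP.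
transitivity (\int[leb]_s (EFin \o f)^\-%E (s + c)%R)%E.
  by apply: eq_integral => s _; rewrite !funenegE.
by rewrite h//; apply: measurable_funeneg; exact/measurable_EFinP.
Qed.

Lemma RI_cut_split F t h A B : 0 < t -> 0 < h -> L1 leb (tcut t F) A ->
  L1 leb (tcut h (fun s => F (t + s))) B ->
  RI leb (tcut (t + h) F) = RI leb (tcut t F) + RI leb (tcut h (fun s => F (t + s))).
Proof.
move=> t0 h0 hA hB.
set G := tcut h _ in hB *.
have mt : measurable_fun setT (fun s : R => s - t) by exact: measurable_funB.
have mG : measurable_fun setT (fun s => G (s - t)) by exact: (measurableT_comp hB.1 mt).
have hG : L1 leb (fun s => G (s - t)) B.
  split=> //; have := @ge0_integral_leb_affine R 1 (- t) (fun s => (`|G s|)%:E) (oner_neq0 R).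
  rewrite normr1 invr1 mul1e => E.
  apply: le_trans hB.2; rewrite -E//.
    by rewrite le_eqVlt; apply/orP; left; apply/eqP; apply: eq_integral => s _; rewrite mul1r.
  by apply/measurable_EFinP; apply: measurableT_comp => //; exact: hB.1.
rewrite -(RI_leb_trans (- t) hB.1) -(I_add hA hG).
(* Both truncations on the right vanish at s = t, hence the exception. *)
have E s : s != t -> tcut (t + h) F s = tcut t F s + G (s - t).
  move=> st; rewrite /G /tcut; have [s0|s0] /= := ltP 0 s; last first.
    by rewrite subr_gt0 ltNge (le_trans s0 (ltW t0))/= addr0.
  rewrite subr_gt0 ltrBlDr [t + (s - t)]addrC subrK [h + t]addrC.
  have [ts|ts|ts] := ltgtP s t.
  - by rewrite (lt_trans ts) ?ltrDl//= addr0.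
  - by rewrite /= add0r.
  - by rewrite ts eqxx in st.
apply: ae_eq_I.
(* Measurability of the left side is inherited from the two pieces and one exceptional value. *)
- rewrite (_ : tcut (t + h) F = fun s => if s == t then tcut (t + h) F t else tcut t F s + G (s - t)); last first.
    by apply/funext => s; case: (eqVneq s t) => [->//|/E].
  apply: measurable_fun_ifT => //; first exact: measurable_fun_eqr.
  by apply: measurable_funD => //; exact: hA.1.
- by apply: measurable_funD => //; exact: hA.1.
- by have := ae_neq t; apply: filterS => s st _; exact: E.
Qed.

Lemma ler_powRN c x y : 0 <= c -> 0 < x -> x <= y -> y `^ (- c) <= x `^ (- c).
Proof.
move=> c0 x0 xy; rewrite !powRN lef_pV2 ?posrE ?powR_gt0//; last exact: lt_le_trans xy.
by apply: ge0_ler_powR => //; rewrite nnegrE ltW// (lt_le_trans x0).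
Qed.

Lemma powR_half c t : 0 < t -> (t / 2) `^ (- c) = 2 `^ c * t `^ (- c).
Proof.
move=> t0; rewrite powRM ?invr_ge0 ?(ltW t0)// mulrC; congr (_ * _).
by rewrite -powR_inv1// -powRrM mulN1r opprK.
Qed.

Lemma eq_cut t f b : (forall s, 0 < s -> s < t -> f s = b s) -> tcut t f = tcut t b.
Proof. by move=> fb; apply/funext => s; rewrite /tcut; case: ifPn => // /andP[]; exact: fb. Qed.

Lemma L1_cut_le t f b B : measurable_fun setT (tcut t f) ->
  (forall s, 0 < s -> s < t -> `|f s| <= b s) -> L1 leb (tcut t b) B -> L1 leb (tcut t f) B.
Proof.
move=> mf fb hB; apply: (L1_le _ _ mf _ hB) => s; rewrite /tcut.
by case: ifPn => [/andP[]|_]; [exact: fb|rewrite normr0].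
Qed.

Lemma L1_cut_scale t f c B : L1 leb (tcut t f) B -> 0 <= c -> L1 leb (tcut t (fun s => c * f s)) (c * B).
Proof.
move=> hB c0; have := L1_scale c hB; rewrite (ger0_norm c0); apply: eq_L1 => s.
by rewrite /tcut; case: ifP => // _; rewrite mulr0.
Qed.

Lemma eq_L1cut t f b B : (forall s, 0 < s -> s < t -> f s = b s) -> L1 leb (tcut t f) B -> L1 leb (tcut t b) B.
Proof. by move=> /eq_cut ->. Qed.

End time_integrals.

(** * Decay and restart of Duhamel integrals *)

Section duhamel_estimates.
Context {R : realType} {n : nat}.
Notation V := 'rV[R]_n.
Notation mu := (rvm n).
Variable (a : V).
Implicit Types (x : V) (s t : R) (g : R -> V -> R) (w k : V -> R) (b : R -> R) (A B C : R).

Lemma cnv_ae (k g1 g2 : V -> R) x : measurable_fun setT k -> measurable_fun setT g1 ->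
  measurable_fun setT g2 -> ae_eq mu setT g1 g2 -> cnv k g1 x = cnv k g2 x.
Proof.
move=> mk m1 m2 g12; apply: ae_eq_I.
- by apply: measurable_funM => //; exact: (measurableT_comp mk (measurable_reflV x)).
- by apply: measurable_funM => //; exact: (measurableT_comp mk (measurable_reflV x)).
- by apply: filterS g12 => y h hy; rewrite h.
Qed.

Lemma L1_ae (g1 g2 : V -> R) B : measurable_fun setT g2 -> ae_eq mu setT g1 g2 -> L1 mu g1 B -> L1 mu g2 B.
Proof.
move=> m2 g12 [m1 h1]; split=> //; apply: le_trans h1.
rewrite le_eqVlt; apply/orP; left; apply/eqP; apply: ae_eq_integral => //.
- by apply/measurable_EFinP; exact: measurableT_comp.
- by apply/measurable_EFinP; exact: measurableT_comp.
- by apply: filterS g12 => y h hy; rewrite h.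
Qed.

(** Here g' may come from the given solution, measurable at each fixed time only, and g from its
    jointly measurable version. Convolution erases the null sets on which they differ, and the
    endpoints s = 0 and s = t form a null set. *)
Lemma duhamelE g g' t x : jmeas g -> (forall s, 0 < s -> s < t -> exists B, L1 mu (g s) B) ->
  (forall s, 0 < s -> s < t -> measurable_fun setT (g' s) /\ ae_eq mu setT (g s) (g' s)) ->
  duhamel a g' t x = duh a g t x.
Proof.
move=> mg gL gg'; rewrite /duhamel.
pose F s := adgrad a (heat (t - s) (g' s)) x; rewrite -/F.
have FE s : 0 < s -> s < t -> F s = cnv (K1 a (t - s)) (g s) x.
  move=> s0 st; rewrite /F; have [m' g12] := gg' s s0 st; have [B gB] := gL s s0 st.
  rewrite adgrad_heat ?subr_gt0//; last exact: L1_Itg (L1_ae m' g12 gB).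
  apply/esym/cnv_ae => //; [exact: measurable_K1|exact: jmeas_meas].
pose G := F \_ `[0, t].
have GE : G = fun s => if s == 0 then G 0 else if s == t then G t else tcut t (fun s => cnv (K1 a (t - s)) (g s) x) s.
  apply/funext => s; case: eqVneq => [->//|s0]; case: eqVneq => [->//|st].
  rewrite /G patchE /tcut mem_setE in_itv/= !le_eqVlt (negbTE st) eq_sym (negbTE s0) /=.
  by case: ifPn => // /andP[]; exact: FE.
have mcut := measurable_cutcnv a t x mg.
have mG : measurable_fun setT G.
  rewrite GE; apply: measurable_fun_ifT => //; first exact: measurable_fun_eqr.
  by apply: measurable_fun_ifT => //; exact: measurable_fun_eqr.
rewrite Rintegral_leb//; last by apply/(measurable_restrictT _ _) => //.
rewrite Rintegral_mkcond; apply: ae_eq_I => //.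
have := ae_neq2 0 t; apply: filterS => s [s0 st] _.
by rewrite -[LHS]/(G s) GE (negbTE s0) (negbTE st).
Qed.

Definition cS c : R := cK a * 2 `^ (n%:R / 2) * cB c.

Lemma cS_ge0 c : c < 1 -> 0 <= cS c.
Proof. by move=> c1; rewrite /cS mulr_ge0 ?cB_ge0// mulr_ge0 ?cK_ge0 ?powR_ge0. Qed.

(** The factor t^{-n/2} comes from the pointwise bound on the source when s >= t/2, and from the
    pointwise bound on the kernel, paired with the L^1 norm of the source, when s < t/2. Halving t
    costs the factor 2^{n/2} in [cS]. *)
Lemma duh_scaled_sup c (M : R) g t x : 0 <= c -> c < 1 -> 0 <= M -> 0 < t -> jmeas g ->
  (forall s, 0 < s -> s < t -> L1 mu (g s) (M * s `^ (- c))) ->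
  (forall s x, 0 < s -> s < t -> `|g s x| <= M * s `^ (- c) * s `^ (- (n%:R / 2))) ->
  `|duh a g t x| <= cS c * M * t `^ (2^-1 - c) * t `^ (- (n%:R / 2)) /\
  L1 leb (tcut t (fun s => cnv (K1 a (t - s)) (g s) x)) (cS c * M * t `^ (2^-1 - c) * t `^ (- (n%:R / 2))).
Proof.
move=> c0 c1 M0 t0 mg gL gs.
have n20 : 0 <= n%:R / 2 :> R by rewrite divr_ge0.
have hbeta := L1_cut_beta c0 c1 t0.
have CM0 : 0 <= cK a * M by rewrite mulr_ge0 ?cK_ge0.
have CM0' : 0 <= cK a * M * (2 `^ (n%:R / 2) * t `^ (- (n%:R / 2))).
  by rewrite mulr_ge0 ?CM0// mulr_ge0 ?powR_ge0.
rewrite (_ : cS c * M * _ * _ = cK a * M * (2 `^ (n%:R / 2) * t `^ (- (n%:R / 2))) * (cB c * t `^ (2^-1 - c))); last first.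
  by rewrite /cS; ring.
apply: (duh_sup mg _ (L1_cut_scale hbeta CM0')).
  move=> s s0 st; have ts : 0 < t - s by rewrite subr_gt0.
  rewrite -(powR_half (n%:R / 2) t0).
  have [hs|hs] := leP (t / 2) s.
    apply: le_trans (cnv_sup x (L1_K1 a ts) (jmeas_meas s mg) (fun y => gs s y s0 st)) _.
    rewrite (_ : _ * _ = cK a * M * s `^ (- (n%:R / 2)) * ((t - s) `^ (- 2^-1) * s `^ (- c))); last by ring.
    apply: ler_wpM2r; first by rewrite mulr_ge0 ?powR_ge0.
    by apply: ler_wpM2l => //; apply: ler_powRN => //; rewrite divr_gt0.
  apply: le_trans (cnv_sup2 x (measurable_K1 a _) (fun z => K1_sup a z ts) (gL s s0 st)) _.
  rewrite (_ : _ * _ = cK a * M * (t - s) `^ (- (n%:R / 2)) * ((t - s) `^ (- 2^-1) * s `^ (- c))); last by ring.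
  apply: ler_wpM2r; first by rewrite mulr_ge0 ?powR_ge0.
  apply: ler_wpM2l => //; apply: ler_powRN => //; first by rewrite divr_gt0.
  by lra.
Qed.

Lemma duh_scaled c (M : R) g t : 0 <= c -> c < 1 -> 0 <= M -> 0 < t -> jmeas g ->
  (forall s, 0 < s -> s < t -> L1 mu (g s) (M * s `^ (- c))) ->
  (forall s x, 0 < s -> s < t -> `|g s x| <= M * s `^ (- c) * s `^ (- (n%:R / 2))) ->
  L1 mu (duh a g t) (cS c * M * t `^ (2^-1 - c)) /\
  forall x, `|duh a g t x| <= cS c * M * t `^ (2^-1 - c) * t `^ (- (n%:R / 2)).
Proof.
move=> c0 c1 M0 t0 mg gL gs.
have n20 : 0 <= n%:R / 2 :> R by rewrite divr_ge0.
have two1 : 1 <= 2 `^ (n%:R / 2) :> R by rewrite -{1}(powRr0 2) ler_powR//; lra.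
have hbeta := L1_cut_beta c0 c1 t0.
have CM0 : 0 <= cK a * M by rewrite mulr_ge0 ?cK_ge0.
have cB0 := cB_ge0 c1.
split; last first.
  by move=> x; exact: (duh_scaled_sup x c0 c1 M0 t0 mg gL gs).1.
apply: (@L1_weak _ _ _ _ _ (cK a * M * (cB c * t `^ (2^-1 - c)))).
    rewrite (_ : cS c * M * _ = 2 `^ (n%:R / 2) * (cK a * M * (cB c * t `^ (2^-1 - c)))).
      by apply: ler_peMl => //; rewrite (mulr_ge0 CM0)// mulr_ge0 ?powR_ge0.
    by rewrite /cS; ring.
  apply: (duh_L1 mg gL); apply: eq_L1cut (L1_cut_scale hbeta CM0) => s _ _.
  by ring.
Qed.

(** Short-time estimate: L^1 and pointwise bounds on the source both pass to the integral with a
    factor of order t^{1/2}. *)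
Lemma duh_local g t B1 B2 : 0 < t -> 0 <= B1 -> 0 <= B2 -> jmeas g ->
  (forall s, 0 < s -> s < t -> L1 mu (g s) B1) ->
  (forall s x, 0 < s -> s < t -> `|g s x| <= B2) ->
  L1 mu (duh a g t) (2 * cK a * B1 * t `^ 2^-1) /\
  forall x, `|duh a g t x| <= 2 * cK a * B2 * t `^ 2^-1.
Proof.
move=> t0 B10 B20 mg gL gs; have h := L1_cut_half t0.
have C1 : 0 <= cK a * B1 by rewrite mulr_ge0 ?cK_ge0.
have C2 : 0 <= cK a * B2 by rewrite mulr_ge0 ?cK_ge0.
split.
  rewrite (_ : 2 * _ * _ * _ = cK a * B1 * (2 * t `^ 2^-1)); last by ring.
  apply: (duh_L1 mg gL); apply: eq_L1cut (L1_cut_scale h C1) => s _ _.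
  by ring.
move=> x; rewrite (_ : 2 * _ * _ * _ = cK a * B2 * (2 * t `^ 2^-1)); last by ring.
apply: (duh_sup mg _ (L1_cut_scale h C2)).1 => s s0 st; have ts : 0 < t - s by rewrite subr_gt0.
apply: le_trans (cnv_sup x (L1_K1 a ts) (jmeas_meas s mg) (fun y => gs s y s0 st)) _.
by rewrite mulrAC.
Qed.

Lemma jmeas_shift g t : jmeas g -> jmeas (fun s => g (t + s)).
Proof.
move=> mg; apply: (measurable_comp2 mg _ measurable_snd).
by apply: measurable_funD => //; exact: measurable_fst.
Qed.

(** For s < t the semigroup law writes the kernel at time t + h - s as e^{h Delta} applied to the
    kernel at time t - s; for s > t the integral is shifted in time. *)
Lemma duh_restart g t h b B B' x : 0 < t -> 0 < h -> jmeas g ->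
  (forall s, 0 < s -> s < t -> L1 mu (g s) (b s)) ->
  L1 leb (tcut t (fun s => cK a * (t - s) `^ (- 2^-1) * b s)) B ->
  L1 leb (tcut h (fun s => cnv (K1 a (h - s)) (g (t + s)) x)) B' ->
  duh a g (t + h) x = cnv (gauss h) (duh a g t) x + duh a (fun s => g (t + s)) h x.
Proof.
move=> t0 h0 mg gb hB hB'.
have [E LE] := duh_cnv mg gb hB x (measurable_gauss h) (fun z => gauss_sup z h0).
pose F s := cnv (K1 a (t + h - s)) (g s) x.
have EF : tcut t (fun s => cnv (gauss h) (cnv (K1 a (t - s)) (g s)) x) = tcut t F.
  apply: eq_cut => s s0 st; apply: (etrans (heat_adheat a x h0 _ (gb s s0 st))); first by rewrite subr_gt0.
  by rewrite /F addrA [h + t]addrC.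
have EG : tcut h (fun s => cnv (K1 a (h - s)) (g (t + s)) x) = tcut h (fun s => F (t + s)).
  by apply: eq_cut => s _ _; rewrite /F opprD addrACA subrr add0r.
have LF : L1 leb (tcut t F) (h `^ (- (n%:R / 2)) * B) by move: LE; rewrite EF.
have LG : L1 leb (tcut h (fun s => F (t + s))) B' by move: hB'; rewrite EG.
have e1 : duh a g (t + h) x = RI leb (tcut (t + h) F) by [].
have e2 : duh a (fun s => g (t + s)) h x = RI leb (tcut h (fun s => F (t + s))) := congr1 (RI leb) EG.
have e3 : cnv (gauss h) (duh a g t) x = RI leb (tcut t F) := etrans E (congr1 (RI leb) EF).
by rewrite e1 e2 e3; exact: (RI_cut_split t0 h0 LF LG).
Qed.

End duhamel_estimates.

(** * The nonlinearity *)

Section fnl.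
Context {R : realType}.
Implicit Types (p r x y : R).

(** The fractions x/(x+y) and y/(x+y) add up to 1, and each such fraction z satisfies z <= z^k. *)
Lemma powR_subadd k x y : 0 <= k <= 1 -> 0 <= x -> 0 <= y -> (x + y) `^ k <= x `^ k + y `^ k.
Proof.
move=> /andP[k0 k1] x0 y0; have [->|x0'] := eqVneq x 0.
  by rewrite add0r lerDr powR_ge0.
have s0 : 0 < x + y by rewrite ltr_wpDr// lt_def x0' x0.
have key z : 0 <= z -> z <= x + y -> (x + y) `^ k * (z / (x + y)) <= z `^ k.
  move=> z0 zs; rewrite -{2}(divfK (lt0r_neq0 s0) z) powRM ?divr_ge0 ?(ltW s0)//.
  rewrite [leRHS]mulrC ler_wpM2l ?powR_ge0//.
  have [->|z0'] := eqVneq z 0; first by rewrite mul0r powR_ge0.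
  have zp : 0 < z / (x + y) by rewrite divr_gt0// lt_def z0' z0.
  rewrite -{1}(powRr1 (ltW zp)); apply: ger_powR => //.
  by rewrite zp ler_pdivrMr// mul1r.
have := lerD (key x x0 _) (key y y0 _).
rewrite -mulrDr -mulrDl divff ?lt0r_neq0// mulr1; apply; lra.
Qed.

Lemma powR_dist k x y : 0 <= k <= 1 -> 0 <= x -> 0 <= y -> `|x `^ k - y `^ k| <= `|x - y| `^ k.
Proof.
move=> k01; wlog xy : x y / y <= x => [hw|] x0 y0.
  have [|/ltW] := leP y x => h; first exact: hw.
  by rewrite distrC [in leRHS]distrC; apply: hw.
have k0 : 0 <= k by case/andP: k01.
rewrite !ger0_norm ?subr_ge0//; last by apply: ge0_ler_powR.
rewrite lerBlDr -{1}(subrK y x); apply: powR_subadd => //; by rewrite subr_ge0.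
Qed.

Lemma fnlN p x : fnl p (- x) = - fnl p x.
Proof. by rewrite /fnl normrN mulrN. Qed.

Lemma fnlE p x : 0 < p -> 0 <= x -> fnl p x = x `^ p.
Proof. by move=> p0 x0; rewrite /fnl ger0_norm// mulrC mulr_powRB1. Qed.

Lemma fnl0 p : fnl p 0 = 0 :> R.
Proof. by rewrite /fnl mulr0. Qed.

Lemma fnlM p x y : fnl p (x * y) = fnl p x * fnl p y.
Proof. by rewrite /fnl normrM powRM//; ring. Qed.

Lemma norm_fnl p x : `|fnl p x| = `|x| `^ (p - 1) * `|x|.
Proof. by rewrite /fnl normrM (ger0_norm (powR_ge0 _ _)). Qed.

(** Power rule for x > 0, oddness for x < 0; at 0 the difference quotient is |h|^{p-1}, which tends
    to 0. *)
Lemma is_derive_fnl p x : 1 < p -> is_derive x 1 (fnl p) (p * `|x| `^ (p - 1)).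
Proof.
move=> p1; have p0 : 0 < p by lra.
have pos y : 0 < y -> is_derive y 1 (fnl p) (p * y `^ (p - 1)).
  move=> y0.
  have d1 : derivable (@powR R ^~ p) y 1 by apply: derivable_powR; rewrite in_itv/= y0.
  have d2 : 'D_1 (@powR R ^~ p) y = p * y `^ (p - 1).
    by rewrite -derive1E powR_derive1// in_itv/= y0.
  apply: (near_eq_is_derive _ (DeriveDef d1 d2)).
  have := lt_nbhsr y0.
  by apply: filterS => z z0; rewrite fnlE// ltW.
have [x0|x0|x0] := ltgtP x 0.
- rewrite ltr0_norm//; have x0' : 0 < - x by rewrite oppr_gt0.
  have -> : fnl p = (fun z => - fnl p (- z)) by apply/funext => z; rewrite fnlN opprK.
  have dN : is_derive x 1 (-%R : R -> R) (- 1) by apply: is_deriveN.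
  have h := pos _ x0'.
  by apply: is_derive_eq (is_deriveN (is_derive1_comp h dN)) _; rewrite mulrN1 opprK.
- by rewrite gtr0_norm//; exact: pos.
- rewrite x0 normr0 powR0 ?mulr0; last by apply: lt0r_neq0; lra.
  have cv : h^-1 *: ((fnl p \o shift 0) (h *: 1) - fnl p 0) @[h --> 0^'] --> (0 : R).
    have c : `|h| `^ (p - 1) @[h --> (0:R)^'] --> (0 : R).
      have q0 : 0 < p - 1 by lra.
      apply/cvgr0Pnorm_lt => e e0; near=> h.
      rewrite (ger0_norm (powR_ge0 _ _)).
      have -> : e = (e `^ (p - 1)^-1) `^ (p - 1).
        by rewrite -powRrM mulVf ?lt0r_neq0// powRr1// ltW.
      apply: gt0_ltr_powR; rewrite ?nnegrE ?powR_ge0//.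
      by near: h; apply: dnbhs0_lt; rewrite powR_gt0.
    apply: cvg_trans c; apply: near_eq_cvg; near=> h.
    have h0 : h != 0 by near: h; exact: nbhs_dnbhs_neq.
    by rewrite /= fnl0 subr0 addr0 /GRing.scale /= mulr1 /fnl mulrCA mulVf// mulr1.
  by apply: DeriveDef; [apply/cvg_ex; eexists; exact: cv|exact: cvg_lim cv].
Unshelve. all: by end_near. Qed.

Lemma derive1_fnl p x : 1 < p -> derive1 (fnl p) x = p * `|x| `^ (p - 1).
Proof. by move=> p1; rewrite derive1E; have [_ ->] := is_derive_fnl x p1. Qed.

Lemma mvt_between (F dF : R -> R) a b : (forall x, is_derive x 1 F (dF x)) ->
  exists c, [/\ F b - F a = dF c * (b - a), `|c - a| <= `|b - a|,
    `|c - b| <= `|b - a| & `|c| <= Num.max `|a| `|b|].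
Proof.
move=> dF1.
have key x y : x <= y -> exists c, [/\ F y - F x = dF c * (y - x), x <= c & c <= y].
  move=> xy; have [] := @MVT_segment _ F dF x y xy (fun z _ => dF1 z).
    apply: continuous_subspaceT => z; apply: differentiable_continuous.
    by apply/derivable1_diffP; have [] := dF1 z.
  by move=> c; rewrite in_itv/= => /andP[xc cy] E; exists c.
have [ab|/ltW ba] := leP a b.
  have [c [E ac cb]] := key _ _ ab; exists c; split=> //.
  - by rewrite !ger0_norm ?subr_ge0//; lra.
  - by rewrite distrC !ger0_norm ?subr_ge0//; lra.
  - rewrite le_max; have := ler_norm b; have := ler_norm (- a); rewrite normrN.
    case: (ger0P c) => c0 h1 h2; apply/orP; [right|left]; lra.
have [c [E ac cb]] := key _ _ ba; exists c; split=> //.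
- by lra.
- by rewrite [in leRHS]distrC [leLHS]distrC !ger0_norm ?subr_ge0//; lra.
- by rewrite [in leRHS]distrC !ger0_norm ?subr_ge0//; lra.
- rewrite le_max; have := ler_norm a; have := ler_norm (- b); rewrite normrN.
  case: (ger0P c) => c0 h1 h2; apply/orP; [left|right]; lra.
Qed.

Lemma fnl_lip p K a b : 1 < p -> `|a| <= K -> `|b| <= K ->
  `|fnl p b - fnl p a| <= p * K `^ (p - 1) * `|b - a|.
Proof.
move=> p1 aK bK; have K0 : 0 <= K by exact: le_trans aK.
have [c [-> _ _ hc]] := mvt_between a b (fun x => is_derive_fnl x p1).
rewrite normrM ler_wpM2r// ger0_norm ?mulr_ge0 ?powR_ge0//; last by lra.
apply: ler_wpM2l; first by lra.
apply: ge0_ler_powR; rewrite ?nnegrE//; first by lra.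
by apply: le_trans hc _; rewrite ge_max aK bK.
Qed.

(** The increment of |.|^{p-1} factors as a difference times a sum of k-th powers, with k = (p -
    1)/2. As k <= 1, the difference is controlled by Hoelder continuity, whether or not p - 1
    exceeds 1. *)
Lemma fnl_taylor p K a b : 1 < p -> p <= 3 -> `|a| <= K -> `|b| <= K ->
  `|fnl p b - fnl p a - derive1 (fnl p) a * (b - a)| <=
  2 * p * K `^ ((p - 1) / 2) * (`|b - a| `^ ((p - 1) / 2) * `|b - a|).
Proof.
move=> p1 p3 aK bK; have K0 : 0 <= K by exact: le_trans aK.
set k := (p - 1) / 2; have k01 : 0 <= k <= 1 by rewrite /k; apply/andP; split; lra.
have k0 : 0 <= k by case/andP: k01.
have [c [-> hca _ hc]] := mvt_between a b (fun x => is_derive_fnl x p1).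
have cK : `|c| <= K by apply: le_trans hc _; rewrite ge_max aK bK.
rewrite derive1_fnl// -mulrBl -mulrBr !normrM (ger0_norm (_ : 0 <= p)); last by lra.
rewrite mulrA ler_wpM2r//.
have E x : `|x| `^ (p - 1) = `|x| `^ k * `|x| `^ k.
  have [->|x0] := eqVneq x 0.
    by rewrite normr0 !powR0 ?mulr0//; apply: lt0r_neq0; rewrite /k; lra.
  by rewrite -powRD ?normr_eq0 ?x0 ?implybT//; congr (_ `^ _); rewrite /k; lra.
have kb (u v : R) : `|u| <= v -> `|u| `^ k <= v `^ k.
  by move=> uv; apply: ge0_ler_powR; rewrite ?nnegrE// (le_trans _ uv).
have h1 : `| `|c| `^ k - `|a| `^ k| <= `|b - a| `^ k.
  apply: le_trans (powR_dist k01 (normr_ge0 c) (normr_ge0 a)) _.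
  apply: le_trans (_ : `|c - a| `^ k <= _); last by apply: ge0_ler_powR.
  by apply: ge0_ler_powR; rewrite ?nnegrE//; exact: ler_dist_dist.
have h2 := kb _ _ cK; have h3 := kb _ _ aK.
rewrite !E (_ : _ - _ = (`|c| `^ k - `|a| `^ k) * (`|c| `^ k + `|a| `^ k)); last by ring.
have h4 : 0 <= `|c| `^ k + `|a| `^ k by rewrite addr_ge0 ?powR_ge0.
rewrite normrM (ger0_norm h4).
rewrite (_ : 2 * p * _ * _ = p * (`|b - a| `^ k * (K `^ k + K `^ k))); last by ring.
apply: ler_wpM2l; first by lra.
by apply: ler_pM => //; exact: lerD.
Qed.

(** [fnl p x * x] is |x|^{p+1}, whose derivative is p + 1 times [fnl p x]; the mean value theorem
    and the Lipschitz bound on [fnl p] then give a quadratic remainder. *)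
Lemma fnl_prim p K a b : 1 < p -> `|a| <= K -> `|b| <= K ->
  `|fnl p b * b - fnl p a * a - (p + 1) * (fnl p a * (b - a))| <= (p + 1) * (p * K `^ (p - 1)) * (b - a) ^+ 2.
Proof.
move=> p1 aK bK; have K0 : 0 <= K by exact: le_trans aK.
have D x : is_derive x 1 (fun x => fnl p x * x) ((p + 1) * fnl p x).
  have h1 := is_derive_fnl x p1.
  have h2 := is_deriveM h1 (is_derive_id x 1).
  apply: is_derive_eq h2 _; rewrite /GRing.scale /= /fnl; ring.
have [c [-> hca _ hc]] := mvt_between a b D.
have cK : `|c| <= K by apply: le_trans hc _; rewrite ge_max aK bK.
rewrite -mulrA -mulrBr -mulrBl !normrM (ger0_norm (_ : 0 <= p + 1)); last by lra.
rewrite -mulrA ler_wpM2l//; first by lra.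
apply: le_trans (ler_wpM2r (normr_ge0 _) (fnl_lip p1 aK cK)) _.
rewrite -(mulrA _ `|c - a|); apply: ler_wpM2l; first by rewrite mulr_ge0 ?powR_ge0//; lra.
by rewrite -real_normK ?num_real// expr2 ler_wpM2r.
Qed.

Lemma powR_lip r K a b : 1 <= r -> 0 <= a <= K -> 0 <= b <= K ->
  `|b `^ r - a `^ r| <= r * K `^ (r - 1) * `|b - a|.
Proof.
move=> r1 /andP[a0 aK] /andP[b0 bK].
have [<-|rN1] := eqVneq 1 r; first by rewrite subrr powRr0 !powRr1// !mul1r.
have r1' : 1 < r by rewrite lt_def eq_sym rN1.
have r0 : 0 < r by lra.
rewrite -(fnlE r0 a0) -(fnlE r0 b0).
by apply: fnl_lip; rewrite ?ger0_norm.
Qed.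

Lemma measurable_fnl p : measurable_fun setT (@fnl R p).
Proof.
apply: measurable_funM => //.
exact: (measurableT_comp (measurable_powR (p - 1)) (@normr_measurable R setT)).
Qed.

End fnl.

(** * Regular version of the solution *)

Section norms.
Context {R : realType} {n : nat}.
Notation V := 'rV[R]_n.
Notation mu := (rvm n).
Implicit Types (f g : V -> R) (r M C : R).

Lemma Lq1E g : measurable_fun setT g -> Lq 1%E g = (\int[mu]_x (`|g x|)%:E)%E.
Proof.
move=> mg; rewrite /Lq /= invr1 ge0_iintE.
- rewrite poweRe1; first by apply: eq_integral => x _; rewrite powRr1.
  by apply: integral_ge0 => x _; rewrite lee_fin powR_ge0.
- apply/measurable_EFinP; apply: measurable_powR_comp; exact: measurableT_comp.
- by move=> x; rewrite lee_fin powR_ge0.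
Qed.

(** The strict inequality provides an admissible level z < M in the infimum that defines
    [esssup]. *)
Lemma esssup_lt_ae g M : measurable_fun setT g -> (esssup g < M%:E)%E -> {ae mu, forall x : V, `|g x| < M}.
Proof.
move=> mg /ereal_inf_lt[z /= nz zM].
have := rn_null_negligible nz; apply: negligibleS => x /= /negP; rewrite -leNgt => h.
by apply: lt_le_trans zM _; rewrite lee_fin.
Qed.

End norms.

Section clamp.
Context {R : realType}.
Implicit Types K z : R.
(** Turns bounds that hold almost everywhere into bounds that hold everywhere. *)
Definition clamp K z : R := Num.max (- K) (Num.min K z).

Lemma clamp_le K z : 0 <= K -> `|clamp K z| <= K.
Proof.
move=> K0; rewrite ler_norml /clamp le_max lexx /= ge_max ge_min lexx/= andbT.
by lra.
Qed.

Lemma clamp_id K z : `|z| <= K -> clamp K z = z.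
Proof.
rewrite ler_norml /clamp => /andP[h1 h2].
by rewrite min_r// max_r.
Qed.

Lemma measurable_clamp K : measurable_fun setT (clamp K).
Proof. by apply: measurable_maxr => //; exact: measurable_minr. Qed.

End clamp.

(** * Joint measurability in time and space *)

Section jointrep.
Context {R : realType} {n : nat}.
Notation V := 'rV[R]_n.
Notation mu := (rvm n).
Implicit Types (u : R -> V -> R) (s : R) (y : V).

(** The grid point following s. The successor keeps it positive, where the hypotheses on u apply. *)
Let sm (m : nat) s : R := (Num.truncn (s * m.+1%:R)).+1%:R / m.+1%:R.

Let sm_gt0 m s : 0 < sm m s. Proof. by rewrite divr_gt0. Qed.

Let sm_near m s : 0 < s -> `|sm m s - s| <= m.+1%:R^-1.
Proof.
move=> s0; have m0 : 0 < m.+1%:R :> R by [].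
have h : 0 <= s * m.+1%:R by rewrite mulr_ge0 ?(ltW s0).
have /andP[h1 h2] := truncn_itv h.
have -> : sm m s - s = ((Num.truncn (s * m.+1%:R)).+1%:R - s * m.+1%:R) * m.+1%:R^-1.
  by rewrite mulrBl mulfK// gt_eqF.
rewrite normrM (@ger0_norm _ m.+1%:R^-1)// -[leRHS]mul1r ler_wpM2r//.
move: h1 h2; move: (s * _) => z; rewrite -natr1 => h1 h2; rewrite ler_norml; apply/andP; split; lra.
Qed.

Let measurable_sm u m : (forall t, 0 < t -> measurable_fun setT (u t)) -> jmeas (fun s => u (sm m s)).
Proof.
move=> mu0 _ B mB; rewrite setTI.
pose h (k : nat) : V -> R := u (k.+1%:R / m.+1%:R).
have mE (k : nat) : measurable [set s : R | Num.truncn (s * m.+1%:R) = k].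
  (* [Num.truncn] is 0 on negative numbers, so the cell k = 0 is unbounded below; hence the guard
     [(0 < k)%N]. *)
  rewrite (_ : [set s : R | _] = (fun s : R => (s * m.+1%:R < k.+1%:R) && ~~ ((0 < k)%N && (s * m.+1%:R < k%:R))) @^-1` [set true]).
    rewrite -[X in measurable X]setTI; apply: (_ : measurable_fun setT _) => //.
    apply: measurable_and; first by apply: measurable_fun_ltr => //; exact: measurable_funM.
    apply: measurable_neg; apply: measurable_and => //.
    by apply: measurable_fun_ltr => //; exact: measurable_funM.
  apply/seteqP; split => s /=.
    move=> <-; rewrite truncnS_gt /=; case: (posnP (Num.truncn (s * m.+1%:R))) => [->//|k0] /=.
    by rewrite -leNgt truncn_le (le_trans ler01)// -truncn_gt0.
  rewrite -truncn_le_nat; case: k => [|k] /=; first by rewrite andbT leqn0 => /eqP.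
  by rewrite -truncn_le_nat -ltnNge => h1; apply/eqP; rewrite eqn_leq.
rewrite (_ : _ @^-1` B = \bigcup_k ([set s : R | Num.truncn (s * m.+1%:R) = k] `*` (h k @^-1` B))).
  apply: bigcup_measurable => k _; apply: measurableX => //.
  by rewrite -[X in measurable X]setTI; apply: mu0.
apply/seteqP; split => -[s y] /=; first by exists (Num.truncn (s * m.+1%:R)).
by case=> k _ /= [<-].
Qed.

(* [u] is frozen on the time grid of step [1 / m.+1]; the representative is the limsup in [m] *)
Lemma joint_representative u K : 0 <= K ->
  (forall t, 0 < t -> measurable_fun setT (u t)) ->
  (forall t, 0 < t -> {ae mu, forall x : V, `|u t x| <= K}) ->
  (forall t, 0 < t -> forall e : R, 0 < e -> exists2 d : R, 0 < d &
     forall s, 0 < s -> `|s - t| < d -> {ae mu, forall x : V, `|u s x - u t x| < e}) ->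
  exists v : R -> V -> R, [/\ jmeas v, (forall s y, `|v s y| <= K) &
    forall s, 0 < s -> ae_eq mu setT (u s) (v s)].
Proof.
move=> K0 mU uK uc.
pose h m (z : R * V) : R := clamp K (u (sm m z.1) z.2).
have hK m z : `|h m z| <= K by exact: clamp_le.
have mh m : measurable_fun setT (h m).
  exact: (measurableT_comp (measurable_clamp K) (measurable_sm m mU)).
pose w (z : R * V) : R := limn_sup (h ^~ z).
have mw : measurable_fun setT w.
  apply: measurable_fun_limn_sup => // z _.
  - by exists K => _ [m _ <-]; apply: le_trans (hK m z); exact: ler_norm.
  - exists (- K) => _ [m _ <-]; have := hK m z; rewrite ler_norml => /andP[] //.
exists (fun s y => clamp K (w (s, y))); split.
- rewrite /jmeas; apply: (measurableT_comp (measurable_clamp K)).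
  by rewrite (_ : (fun z : R * V => _) = w)//; apply/funext => -[].
- by move=> s y; exact: clamp_le.
move=> s s0.
have e0 (j : nat) : 0 < j.+1%:R^-1 :> R by rewrite invr_gt0.
have A (j : nat) : exists N, forall m : nat, (N <= m)%N ->
    {ae mu, forall x : V, `|u (sm m s) x - u s x| < j.+1%:R^-1}.
  have [d d0 hd] := uc s s0 _ (e0 j).
  exists (Num.truncn d^-1) => m hm; apply: hd => //.
  apply: le_lt_trans (sm_near m s0) _.
  rewrite invf_plt ?posrE//; apply: lt_le_trans (truncnS_gt _) _.
  by rewrite ler_nat ltnS.
have [N hN] := choice A.
have B1 : {ae mu, forall x : V, forall m, `|u (sm m s) x| <= K}.
  by apply: ae_foralln => m; exact: uK.
have B2 : {ae mu, forall x : V, forall j m, (N j <= m)%N -> `|u (sm m s) x - u s x| < j.+1%:R^-1}.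
  apply: ae_foralln => j; apply: ae_foralln => m.
  have [hm|hm] := boolP (N j <= m)%N.
    by have := hN j m hm; apply: filterS.
  by apply: aeW.
have B3 := uK s s0.
have B13 : {ae mu, forall x : V, (forall m, `|u (sm m s) x| <= K) /\ `|u s x| <= K}.
  by exact: filterI B1 B3.
have B : {ae mu, forall x : V, ((forall m, `|u (sm m s) x| <= K) /\ `|u s x| <= K) /\
  forall j m, (N j <= m)%N -> `|u (sm m s) x - u s x| < j.+1%:R^-1}.
  by exact: filterI B13 B2.
apply: filterS B => x [[b1 b3] b2] _.
(* Off the union of countably many null sets u (sm m s) tends to u s, so that the limsup w is a
   limit there. *)
suff cv : h ^~ (s, x) @ \oo --> u s x.
  have [_ E] := cvg_limn_inf_sup cv.
  by rewrite /w E clamp_id.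
apply/cvgrPdist_lt => e ep.
have [j hj] : exists j : nat, j.+1%:R^-1 < e.
  exists (Num.truncn e^-1); rewrite invf_plt ?posrE//; exact: truncnS_gt.
exists (N j) => // m /= hm.
by rewrite /h clamp_id// distrC; apply: lt_trans hj; exact: b2.
Qed.

End jointrep.

Section cnv_linearity.
Context {R : realType} {n : nat}.
Notation V := 'rV[R]_n.
Notation mu := (rvm n).
Implicit Types (k f g : V -> R) (A B C : R).

Lemma cnvD k f g A B C x : measurable_fun setT k -> (forall y, `|k y| <= C) -> L1 mu f A -> L1 mu g B ->
  cnv k (fun y => f y + g y) x = cnv k f x + cnv k g x.
Proof.
move=> mk kC hf hg; rewrite -(I_add (cnv_intg2 x mk kC hf) (cnv_intg2 x mk kC hg)).
by apply: eq_I => y; rewrite mulrDr.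
Qed.

Lemma cnvB k f g A B C x : measurable_fun setT k -> (forall y, `|k y| <= C) -> L1 mu f A -> L1 mu g B ->
  cnv k (fun y => f y - g y) x = cnv k f x - cnv k g x.
Proof.
move=> mk kC hf hg; rewrite -(I_sub (cnv_intg2 x mk kC hf) (cnv_intg2 x mk kC hg)).
by apply: eq_I => y; rewrite mulrBr.
Qed.

Lemma cnvZ k f c A C x : measurable_fun setT k -> (forall y, `|k y| <= C) -> L1 mu f A ->
  cnv k (fun y => c * f y) x = c * cnv k f x.
Proof.
move=> mk kC hf; rewrite -(I_scale c (cnv_intg2 x mk kC hf)).
by apply: eq_I => y; rewrite mulrCA.
Qed.

Lemma powR_le1 (c h : R) : 0 <= c -> 0 <= h -> h <= 1 -> h `^ c <= 1.
Proof.
move=> c0 h0 h1; have <- : (1 : R) `^ c = 1 by rewrite powR1.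
by apply: ge0_ler_powR; rewrite ?nnegrE.
Qed.

Lemma L1_fnl p f K A : L1 mu f A -> 1 < p -> 0 <= K -> (forall x, `|f x| <= K) ->
  L1 mu (fun x => fnl p (f x)) (K `^ (p - 1) * A).
Proof.
move=> hf p1 K0 fK.
have h : L1 mu (fun x => f x * `|f x| `^ (p - 1)) (A * K `^ (p - 1)).
  apply: L1_mulb => //.
    by apply: measurable_powR_comp; apply: measurableT_comp => //; exact: hf.1.
  move=> x; rewrite ger0_norm ?powR_ge0//; apply: ge0_ler_powR; rewrite ?nnegrE//.
  by lra.
by rewrite mulrC; apply: eq_L1 h => x; rewrite /fnl mulrC.
Qed.

Lemma fnl_bound p K (z : R) : 1 < p -> `|z| <= K -> `|fnl p z| <= K `^ (p - 1) * K.
Proof.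
move=> p1 zK; have K0 : 0 <= K by exact: le_trans zK.
rewrite norm_fnl; apply: ler_pM => //; rewrite ?powR_ge0//.
by apply: ge0_ler_powR; rewrite ?nnegrE//; lra.
Qed.

Lemma jmeas_fnl p (g : R -> V -> R) : jmeas g -> jmeas (fun s y => fnl p (g s y)).
Proof. by move=> mg; exact: (measurableT_comp (measurable_fnl p) mg). Qed.

Lemma jmeas_heat g : measurable_fun setT g -> jmeas (fun t => cnv (@gauss R n t) g).
Proof.
move=> mg.
apply: (measurable_I2 mu (H := fun w : (R * V) * V => gauss w.1.1 (w.1.2 - w.2) * g w.2)).
apply: measurable_funM; last exact: (measurableT_comp mg).
have p2 : measurable_fun setT (fun w : (R * V) * V => w.1.2 - w.2).
  apply: (measurable_comp2 (F := fun z : V * V => z.1 - z.2) measurable_subV) => //.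
  by apply: measurable_snd_comp; exact: measurable_fst.
have p1 : measurable_fun setT (fun w : (R * V) * V => w.1.1).
  by apply: measurable_fst_comp; exact: measurable_fst.
exact: (measurable_comp2 (F := fun z : R * V => gauss z.1 z.2) (@measurable_gauss2 R n) p1 p2).
Qed.

End cnv_linearity.

(** * A version of the solution that satisfies the equation everywhere *)

Section regular.
Context {R : realType} {n : nat}.
Notation V := 'rV[R]_n.
Notation mu := (rvm n).
Variables (a : V).
Implicit Types (s t h : R) (g : R -> V -> R).

Lemma mild_restart g u0 B0 B1 B2 t h x : 0 < t -> 0 < h -> L1 mu u0 B0 ->
  jmeas g -> (forall s, 0 < s -> L1 mu (g s) B1) -> (forall s y, 0 < s -> `|g s y| <= B2) ->
  cnv (gauss (t + h)) u0 x + duh a g (t + h) x =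
  cnv (gauss h) (fun y => cnv (gauss t) u0 y + duh a g t y) x + duh a (fun s => g (t + s)) h x.
Proof.
move=> t0 h0 hu0 mg gL gs.
have B10 := L1_ge0 (gL 1 ltr01).
have B20 : 0 <= B2 by apply: le_trans (gs 1 0 ltr01).
have C1 : 0 <= cK a * B1 by rewrite mulr_ge0 ?cK_ge0.
have C2 : 0 <= cK a * B2 by rewrite mulr_ge0 ?cK_ge0.
have gL' s : 0 < s -> s < t -> L1 mu (g s) B1 by move=> s0 _; exact: gL.
have hB : L1 leb (tcut t (fun s => cK a * (t - s) `^ (- 2^-1) * B1)) (cK a * B1 * (2 * t `^ 2^-1)).
  by apply: eq_L1cut (L1_cut_scale (L1_cut_half t0) C1) => s _ _; ring.
have hK s : 0 < s -> s < h -> `|cnv (K1 a (h - s)) (g (t + s)) x| <= cK a * B2 * (h - s) `^ (- 2^-1).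
  move=> s0 sh; have hs : 0 < h - s by rewrite subr_gt0.
  apply: le_trans (cnv_sup x (L1_K1 a hs) (jmeas_meas _ mg) (fun y => gs (t + s) y (addr_gt0 t0 s0))) _.
  by rewrite mulrAC.
have [_ hB'] := duh_sup (jmeas_shift t mg) hK (L1_cut_scale (L1_cut_half h0) C2).
rewrite (duh_restart t0 h0 mg gL' hB hB').
rewrite addrA; congr (_ + _).
have hS := duh_L1 mg gL' hB.
have hG := cnv_L1 (L1_gauss t0) hu0.
apply: etrans (esym (cnvD x (measurable_gauss h) (fun z => gauss_sup z h0) hG hS)).
congr (_ + _); apply: etrans (esym (heat_heat x h0 t0 hu0)).
by rewrite addrC.
Qed.

(** The bounds and the equation hold at every point, with constants uniform in t; the estimates
    below are then free of null sets. *)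
Definition regsol (p : R) (u0 : V -> R) (U : R -> V -> R) (K1 K : R) :=
  [/\ jmeas U, (forall t, 0 < t -> L1 mu (U t) K1), (forall t x, 0 < t -> `|U t x| <= K) &
   forall t x, 0 < t -> U t x = cnv (gauss t) u0 x + duh a (fun s y => fnl p (U s y)) t x].

Lemma regsol_restart p u0 U B0 K1 K t h x : 1 < p -> L1 mu u0 B0 -> regsol p u0 U K1 K -> 0 < t -> 0 < h ->
  U (t + h) x = cnv (gauss h) (U t) x + duh a (fun s y => fnl p (U (t + s) y)) h x.
Proof.
move=> p1 hu0 [mU UL UK UE] t0 h0.
have K0 : 0 <= K by apply: le_trans (UK 1 0 ltr01).
rewrite (UE _ _ (addr_gt0 t0 h0)).
have gL s : 0 < s -> L1 mu (fun y => fnl p (U s y)) (K `^ (p - 1) * K1).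
  by move=> s0; apply: L1_fnl => // [|y]; [exact: UL|exact: UK].
have gs s y : 0 < s -> `|fnl p (U s y)| <= K `^ (p - 1) * K.
  by move=> s0; apply: fnl_bound => //; exact: UK.
have -> : U t = fun y => cnv (gauss t) u0 y + duh a (fun s y => fnl p (U s y)) t y.
  by apply/funext => y; exact: UE.
exact: (mild_restart x t0 h0 hu0 (jmeas_fnl p mU) gL gs).
Qed.

(** With v the jointly measurable version of u, U is the right-hand side of the integral equation
    with source f(v). At each time U agrees with u almost everywhere, and convolution does not see
    the change from v to U in the source, so U solves the equation at every point. *)
Lemma regular_solution p u0 u B0 : 1 < p -> L1 mu u0 B0 -> global_solution p a u0 u ->
  exists U K1 K, regsol p u0 U K1 K /\ forall t, 0 < t -> rn_null [set x | u t x <> U t x].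
Proof.
move=> p1 hu0 [um [_ _ [C1 uC1]] [uinf uc [C2 uC2]] uE].
have mu_ t : 0 <= t -> measurable_fun setT (u t) by move=> t0; apply: (rn_measurableE (u t)).1; exact: um.
have uL t : 0 <= t -> L1 mu (u t) C1.
  by move=> t0; split; [exact: mu_|rewrite -Lq1E; [exact: uC1|exact: mu_]].
pose K := `|C2| + 1.
have K0 : 0 <= K by rewrite addr_ge0.
have uK t : 0 < t -> {ae mu, forall x : V, `|u t x| <= K}.
  move=> t0; have : (esssup (u t) < K%:E)%E.
    by apply: le_lt_trans (uC2 t t0) _; rewrite lte_fin /K; have := ler_norm C2; lra.
  by move/(esssup_lt_ae (mu_ t (ltW t0))); apply: filterS => x /ltW.
have uc' t : 0 < t -> forall e : R, 0 < e -> exists2 d : R, 0 < d &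
     forall s, 0 < s -> `|s - t| < d -> {ae mu, forall x : V, `|u s x - u t x| < e}.
  move=> t0 e e0; have [d d0 hd] := uc t t0 e e0; exists d => // s s0 st.
  have := esssup_lt_ae _ (hd s s0 st); apply.
  by apply: measurable_funB; apply: mu_; exact: ltW.
have [v [mv vK uv]] := joint_representative K0 (fun t (tp : 0 < t) => mu_ t (ltW tp)) uK uc'.
have vL s : 0 < s -> L1 mu (v s) C1.
  by move=> s0; apply: L1_ae (uv s s0) (uL s (ltW s0)); exact: jmeas_meas.
pose g s y := fnl p (v s y).
have mg : jmeas g by exact: jmeas_fnl.
have gL s : 0 < s -> L1 mu (g s) (K `^ (p - 1) * C1).
  by move=> s0; apply: L1_fnl => //; exact: vL.
have gs s y : `|g s y| <= K `^ (p - 1) * K by apply: fnl_bound.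
pose U t x := cnv (gauss t) u0 x + duh a g t x.
have mU : jmeas U by apply: measurable_funD; [exact: jmeas_heat hu0.1|exact: jmeas_S].
have nU t : 0 < t -> rn_null [set x | u t x <> U t x].
  move=> t0; have := uE t t0; congr (rn_null _); apply/seteqP.
  have E x : heat t u0 x + duhamel a (fun s y => fnl p (u s y)) t x = U t x.
    rewrite heatE//; last exact: L1_Itg hu0.
    rewrite /U; congr (_ + _); apply: duhamelE => // s s0 st; first by eexists; exact: gL.
    split; first exact: (measurableT_comp (measurable_fnl p) (mu_ s (ltW s0))).
    by have := uv s s0; apply: filterS => y h hy; rewrite /g h.
  by split=> x /=; rewrite E.
have Uu t : 0 < t -> ae_eq mu setT (u t) (U t).
  move=> t0; have := rn_null_negligible (nU t t0); apply: negligibleS => x /= h hx.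
  by apply: h => _.
have Uv t : 0 < t -> ae_eq mu setT (v t) (U t).
  by move=> t0; exact: ae_eq_trans (ae_eq_sym (uv t t0)) (Uu t t0).
have duhE t x : duh a (fun s y => fnl p (U s y)) t x = duh a g t x.
  congr RI; apply: eq_cut => s s0 st; apply: cnv_ae; first exact: measurable_K1.
  - exact: (measurableT_comp (measurable_fnl p) (jmeas_meas s mU)).
  - exact: (jmeas_meas s mg).
  - by have := Uv s s0; apply: filterS => y h hy; rewrite /g h.
exists U, C1, (K + 2 * cK a * (K `^ (p - 1) * K)); split; [split; first exact: mU|exact: nU].
- by move=> t t0; apply: L1_ae (Uu t t0) (uL t (ltW t0)); exact: jmeas_meas.
- move=> t x t0.
  (* The Duhamel bound on all of [0, t] grows like t^{1/2}; restarting the equation at t - h with h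
     <= 1 makes it uniform in t. *)
  have [h h0 [ht h1]] : exists2 h, 0 < h & h < t /\ h <= 1.
    exists (Num.min (t / 2) 1); first by rewrite lt_min ltr01 divr_gt0.
    by rewrite gt_min ge_min lexx orbT; split=> //; apply/orP; left; lra.
  have th : 0 < t - h by rewrite subr_gt0.
  have -> : U t x = U (t - h + h) x by rewrite subrK.
  rewrite /U (mild_restart x th h0 hu0 mg gL (fun s y _ => gs s y)).
  apply: le_trans (ler_normD _ _) _; apply: lerD.
    have -> : cnv (gauss h) (fun y => cnv (gauss (t - h)) u0 y + duh a g (t - h) y) x = cnv (gauss h) (v (t - h)) x.
      apply: cnv_ae; first exact: measurable_gauss.
      - exact: (jmeas_meas _ mU).
      - exact: jmeas_meas.
      - by have := Uv _ th; apply: filterS => y h' hy; rewrite h'.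
    rewrite -[K]mul1r; apply: cnv_sup (L1_gauss h0) _ _; first exact: jmeas_meas.
    exact: vK.
  have B0' : 0 <= K `^ (p - 1) * K by rewrite mulr_ge0 ?powR_ge0.
  have C10 := L1_ge0 (gL 1 ltr01).
  have [_ h2] := duh_local a h0 C10 B0' (jmeas_shift (t - h) mg)
    (fun s (sp : 0 < s) _ => gL (t - h + s) (addr_gt0 th sp)) (fun s y _ _ => gs (t - h + s) y).
  apply: le_trans (h2 x) _; rewrite -[leRHS]mulr1 ler_wpM2l//.
    by rewrite mulr_ge0// mulr_ge0 ?cK_ge0.
  by apply: powR_le1 => //; exact: ltW.
- by move=> t x t0; rewrite duhE.
Qed.

End regular.

(** * Smoothing estimates *)

Section diffs.
Context {R : realType} {n : nat}.
Notation V := 'rV[R]_n.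
Notation mu := (rvm n).
Variable (a : V).
Implicit Types (x : V) (s t r h : R) (k f g w : V -> R) (A B C : R).

Definition cG : R := 2 * (1 + n%:R / 2).

Lemma cG_ge0 : 0 <= cG.
Proof. by rewrite /cG mulr_ge0// addr_ge0// divr_ge0. Qed.

(** G_{s+r} >= th G_s with th = (1 + r/s)^{-n/2}, so that G_{s+r} - th G_s is nonnegative with
    integral 1 - th. The exponent 3/8 leaves s^{-1/2 - 3/8} integrable and exceeds the loss 1/8 of
    [adheat_mild_sup]. *)
Lemma gauss_diff s r : 0 < s -> 0 < r ->
  L1 mu (fun x => gauss (s + r) x - gauss s x) (cG * (r / s) `^ (3 / 8)).
Proof.
move=> s0 r0; set m : R := n%:R / 2; set z := r / s.
have z0 : 0 < z by rewrite divr_gt0.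
have m0 : 0 <= m by rewrite divr_ge0.
pose th : R := (1 + z) `^ (- m).
have th0 : 0 <= th by exact: powR_ge0.
have th1 : th <= 1.
  by rewrite /th -{2}(powRr0 (1 + z)) ler_powR//; lra.
have sr : s + r = s * (1 + z) by rewrite /z; field; rewrite gt_eqF.
have sr0 : 0 < s + r by rewrite addr_gt0.
have key x : th * gauss s x <= gauss (s + r) x.
  rewrite /gauss mulrA; apply: ler_pM; rewrite ?mulr_ge0 ?powR_ge0 ?expR_ge0//.
    rewrite sr mulrA [leRHS]powRM; first by rewrite mulrC.
      by rewrite !mulr_ge0 ?(ltW s0)// pi_ge0.
    by lra.
  rewrite ler_expR !mulNr lerN2; apply: ler_wpM2l; first exact: sqnorm_ge0.
  by rewrite lef_pV2 ?posrE ?mulr_gt0// ler_pM2l//; lra.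
have hd : L1 mu (fun x => gauss (s + r) x - th * gauss s x) (1 - th).
  have h1 := L1_gauss (n := n) sr0; have h2 := L1_scale th (L1_gauss (n := n) s0).
  have h := L1_intI (L1_Itg (L1_sub h1 h2)).
  have E : RI mu (fun x => `|gauss (s + r) x - th * gauss s x|) = 1 - th.
    transitivity (RI mu (fun x : V => gauss (s + r) x - th * gauss s x)).
      by apply: eq_I => x; rewrite ger0_norm// subr_ge0.
    by rewrite (I_sub h1 h2) (I_scale th (L1_gauss s0)) !RI_gauss// mulr1.
  by rewrite E in h.
(* 1 - th is at most both 1 and m z, while z^{3/8} dominates z below 1 and is at least 1 above. *)
have bnd : 1 - th <= (1 + m) * z `^ (3 / 8).
  have h1 : 1 - th <= m * z.
    have z1 : 0 < 1 + z by lra.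
    rewrite /th /powR gt_eqF//.
    have := expR_ge1Dx (- m * ln (1 + z)).
    have : ln (1 + z) <= z by apply: le_ln1Dx; lra.
    by move/(ler_wpM2l m0); rewrite mulNr; lra.
  have p0 := powR_ge0 z (3 / 8).
  have mz0 := mulr_ge0 m0 p0.
  have [zl|zl] := leP z 1.
    have : z <= z `^ (3 / 8).
      rewrite -{1}(powRr1 (ltW z0)); apply: ger_powR; first by rewrite z0.
      by lra.
    by move/(ler_wpM2l m0); lra.
  have : 1 <= z `^ (3 / 8).
    by rewrite -{1}(powRr0 z) ler_powR//; lra.
  by lra.
apply: (L1_weak (A := (1 - th) + `|1 - th| * 1)).
  by rewrite ger0_norm ?subr_ge0// /cG -/m; lra.
apply: (L1_le _ _ _ _ (L1_add hd (L1_scale (1 - th) (L1_gauss s0)))).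
  by apply: measurable_funB; exact: measurable_gauss.
move=> x; have := key x; have := gauss_ge0 s x; have e1 : 0 <= 1 - th by lra.
move=> g0; have := mulr_ge0 e1 g0.
by rewrite ler_norml => h1 h2; apply/andP; split; lra.
Qed.

(** Half of the time s goes to the gradient and half to the difference of kernels: s^{-1/2} s^{-3/8}
    = s^{-7/8}. *)
Lemma K1_diff s r : 0 < s -> 0 < r ->
  L1 mu (fun x => K1 a (s + r) x - K1 a s x) (4 * cK a * cG * (s `^ (- (7 / 8)) * r `^ (3 / 8))).
Proof.
move=> s0 r0; have h0 : 0 < s / 2 by rewrite divr_gt0.
have hr0 : 0 < s / 2 + r by rewrite addr_gt0.
have E x : cnv (K1 a (s / 2)) (fun y => gauss (s / 2 + r) y - gauss (s / 2) y) x = K1 a (s + r) x - K1 a s x.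
  rewrite (cnvB x (measurable_K1 a (s / 2)) (fun z => K1_sup a z h0) (L1_gauss hr0) (L1_gauss h0)).
  by rewrite !cnv_K1_gauss//; congr (K1 a _ x - K1 a _ x); lra.
apply: (eq_L1 E); apply: L1_weak (cnv_L1 (L1_K1 a h0) (gauss_diff h0 r0)).
have -> : s `^ (- (7 / 8)) = s `^ (- 2^-1) * s `^ (- (3 / 8)).
  by rewrite -powRD ?(gt_eqF s0) ?implybT//; congr (_ `^ _); lra.
rewrite (powR_half _ s0).
have -> : (r / (s / 2)) `^ (3 / 8) = 2 `^ (3 / 8) * (s `^ (- (3 / 8)) * r `^ (3 / 8)).
  rewrite (_ : r / (s / 2) = 2 * (s^-1 * r)); last by field; rewrite gt_eqF.
  rewrite !powRM ?invr_ge0 ?mulr_ge0 ?invr_ge0 ?(ltW s0) ?(ltW r0)//.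
  by rewrite -(powR_inv1 (ltW s0)) -powRrM mulN1r.
have two c : c <= 1 -> 2 `^ c <= 2 :> R.
  by move=> c1; rewrite -{2}(@powRr1 _ 2)// ler_powR//; lra.
have t1 : 2 `^ 2^-1 <= 2 :> R by apply: two; lra.
have t2 : 2 `^ (3 / 8) <= 2 :> R by apply: two; lra.
have t12 : 2 `^ 2^-1 * 2 `^ (3 / 8) <= 4 :> R.
  have -> : 4 = 2 * 2 :> R by lra.
  by apply: ler_pM; rewrite ?powR_ge0.
set X := s `^ (- 2^-1); set Y := s `^ (- (3 / 8)); set Z := r `^ (3 / 8).
rewrite (_ : cK a * _ * _ = (2 `^ 2^-1 * 2 `^ (3 / 8)) * (cK a * cG * (X * Y * Z))); last by ring.
rewrite (_ : 4 * _ * _ * _ = 4 * (cK a * cG * (X * Y * Z))); last by ring.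
apply: ler_wpM2r t12.
by rewrite (mulr_ge0 (mulr_ge0 (cK_ge0 a) cG_ge0))// (mulr_ge0 (mulr_ge0 (powR_ge0 _ _) (powR_ge0 _ _)) (powR_ge0 _ _)).
Qed.

(* The semigroup law moves half of the time [r] to the first factor, so that the bound stays
   integrable as [s] tends to [0]. *)
Lemma adheat_adheat_sup s r w B K x : 0 < s -> 0 < r -> L1 mu w B -> (forall y, `|w y| <= K) ->
  `|cnv (K1 a s) (cnv (K1 a r) w) x| <= (cK a * (s + r / 2) `^ (- 2^-1)) * ((cK a * (r / 2) `^ (- 2^-1)) * K).
Proof.
move=> s0 r0 hw wK; have h0 : 0 < r / 2 by rewrite divr_gt0.
have hL := cnv_L1 (L1_K1 a h0) hw.
have E : cnv (K1 a r) w = cnv (gauss (r / 2)) (cnv (K1 a (r / 2)) w).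
  apply/funext => y; apply/esym/(etrans (heat_adheat a y h0 h0 hw)).
  by congr (cnv (K1 a _) w y); lra.
rewrite E; have -> := adheat_heat a x s0 h0 hL.
apply: cnv_sup; first by apply: L1_K1; rewrite addr_gt0.
  exact: hL.1.
by move=> y; apply: cnv_sup wK; [exact: L1_K1|exact: hw.1].
Qed.

(* With [w'] = e^{t Delta} w, the integrand is a directional derivative of |w'|^{p+1} / (p+1); it is
   integrated by comparing |w'|^{p+1} with its translates. *)
Lemma adheat_fnl_orth p w B K t : 1 < p -> 0 < t -> L1 mu w B -> (forall y, `|w y| <= K) ->
  RI mu (fun x => cnv (K1 a t) w x * fnl p (cnv (gauss t) w x)) = 0.
Proof.
move=> p1 t0 hw wK.
have K0 : 0 <= K by apply: le_trans (wK 0).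
have B0 := L1_ge0 hw.
set W := cnv (gauss t) w; set Z := cnv (K1 a t) w.
have hW : L1 mu W (1 * B) by exact: cnv_L1 (L1_gauss t0) hw.
have WK x : `|W x| <= K.
  by rewrite -[K]mul1r; exact: (cnv_sup x (L1_gauss t0) hw.1 wK).
have hZ : L1 mu Z _ := cnv_L1 (L1_K1 a t0) hw.
have ZK x : `|Z x| <= _ := cnv_sup x (L1_K1 a t0) hw.1 wK.
set z1 := cK a * t `^ (- 2^-1) * B in hZ; set zi := cK a * t `^ (- 2^-1) * K in ZK.
have z10 : 0 <= z1 by exact: L1_ge0 hZ.
have zi0 : 0 <= zi by apply: le_trans (ZK 0).
have [M M0 HM] := cnv_taylor a t0.
pose D h x := W (x + h *: a) - W x.
have mF : measurable_fun setT (fun x => fnl p (W x)) by exact: (measurableT_comp (measurable_fnl p) hW.1).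
have FK x : `|fnl p (W x)| <= K `^ (p - 1) * K by exact: fnl_bound.
set F := K `^ (p - 1) * K in FK.
have F0 : 0 <= F by rewrite /F mulr_ge0 ?powR_ge0.
have hPhi : L1 mu (fun x => fnl p (W x) * W x) (1 * B * F).
  by apply: eq_L1 (L1_mulb hW mF FK) => x; rewrite mulrC.
have hFZ : L1 mu (fun x => Z x * fnl p (W x)) (z1 * F) by exact: (L1_mulb hZ mF FK).
(* A quantity linear in h and bounded by C h^2 for all small h vanishes. The bound collects the
   Taylor errors of W along a and of |W|^{p+1}. *)
have [Cst C0 key] : exists2 C, 0 <= C & forall h, 0 < h -> h <= 1 ->
    `|h * RI mu (fun x => Z x * fnl p (W x))| <= C * h ^+ 2.
  pose q := p + 1; have q0 : 0 < q by rewrite /q; lra.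
  pose L := q * (p * K `^ (p - 1)).
  have L0 : 0 <= L by rewrite /L !mulr_ge0 ?powR_ge0//; lra.
  exists (M * B * F + q^-1 * (L * ((zi + M * B) * (z1 + M * B)))).
    have MB0 := mulr_ge0 M0 B0; have qi0 : 0 <= q^-1 by rewrite invr_ge0 ltW.
    exact: (addr_ge0 (mulr_ge0 MB0 F0) (mulr_ge0 qi0 (mulr_ge0 L0 (mulr_ge0 (addr_ge0 zi0 MB0) (addr_ge0 z10 MB0))))).
  move=> h hp h1; have ha : `|h| <= 1 by rewrite gtr0_norm.
  have [He1 Hei] := HM w B hw h ha; rewrite -/W -/Z in He1 Hei.
  set E := fun x => W (x + h *: a) - W x - h * Z x in He1.
  have hhZ := L1_scale h hZ; rewrite gtr0_norm// in hhZ.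
  have DE x : D h x = h * Z x + E x by rewrite /D /E; move: (W _) (W x) (Z x) => u v z; rewrite [RHS]addrC subrK.
  have hD : L1 mu (D h) (h * z1 + M * h ^+ 2 * B).
    by apply: eq_L1 (L1_add hhZ He1) => x; rewrite DE.
  have Dsup x : `|D h x| <= h * (zi + M * B).
    rewrite DE; apply: le_trans (ler_normD _ _) _.
    rewrite mulrDr; apply: lerD.
      by rewrite normrM gtr0_norm// ler_wpM2l// ltW.
    apply: le_trans (Hei x) _; rewrite mulrAC expr2 [leRHS]mulrC.
    by apply: ler_wpM2l; [rewrite mulr_ge0|rewrite ler_piMr// ltW].
  have hD' : L1 mu (D h) (h * (z1 + M * B)).
    apply: L1_weak hD; rewrite mulrDr lerD2l mulrAC expr2 [leRHS]mulrC.
    by apply: ler_wpM2l; [rewrite mulr_ge0|rewrite ler_piMr// ltW].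
  have hDD : L1 mu (fun x => D h x * D h x) (h * (z1 + M * B) * (h * (zi + M * B))).
    exact: (L1_mulb hD' hD'.1 Dsup).
  have hFE : L1 mu (fun x => E x * fnl p (W x)) (M * h ^+ 2 * B * F) by exact: (L1_mulb He1 mF FK).
  have hFD : L1 mu (fun x => D h x * fnl p (W x)) (h * (z1 + M * B) * F) by exact: (L1_mulb hD' mF FK).
  pose Phi x := fnl p (W x) * W x.
  pose rho x := Phi (x + h *: a) - Phi x - q * (fnl p (W x) * D h x).
  have hPt := L1_trans (h *: a) hPhi.
  have rhoB x : `|rho x| <= L * (D h x * D h x).
    by have := fnl_prim p1 (WK x) (WK (x + h *: a)); rewrite /rho /Phi -expr2.
  have hqFD := L1_scale q hFD.
  have mrho : measurable_fun setT rho.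
    apply: measurable_funB; first exact: (L1_sub hPt hPhi).1.
    by apply: eq_measurable_fun hqFD.1 => x _; rewrite [D h x * _]mulrC.
  have hLDD := L1_scale L hDD; rewrite (ger0_norm L0) in hLDD.
  have hrho : L1 mu rho _ := L1_le _ _ mrho rhoB hLDD.
  (* Translation invariance of the integral takes the place of integration by parts. *)
  have I0 : RI mu (fun x => Phi (x + h *: a) - Phi x) = 0.
    apply: etrans (I_sub hPt hPhi) _; apply/eqP; rewrite subr_eq0; apply/eqP.
    exact: (RI_trans (h *: a) hPhi.1).
  have I1 : RI mu (fun x => Phi (x + h *: a) - Phi x) = RI mu rho + q * RI mu (fun x => D h x * fnl p (W x)).
    rewrite -(I_scale q hFD) -(I_add hrho hqFD); apply: eq_I => x.
    by rewrite /rho [fnl p _ * D h x]mulrC subrK.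
  have I2 : RI mu (fun x => D h x * fnl p (W x)) =
      h * RI mu (fun x => Z x * fnl p (W x)) + RI mu (fun x => E x * fnl p (W x)).
    rewrite -(I_scale h hFZ) -(I_add (L1_scale h hFZ) hFE); apply: eq_I => x.
    by rewrite DE mulrDl mulrA.
  have b1 := L1_I hrho; have b2 := L1_I hFE.
  set J := RI mu (fun x => Z x * _) in I2 *.
  have -> : h * J = - RI mu (fun x => E x * fnl p (W x)) - q^-1 * RI mu rho.
    have : RI mu rho = - (q * (h * J + RI mu (fun x => E x * fnl p (W x)))) by rewrite -I2; lra.
    by move=> ->; field; rewrite gt_eqF.
  apply: le_trans (ler_normB _ _) _; rewrite normrN normrM (gtr0_norm (x := q^-1)) ?invr_gt0//.
  rewrite mulrDl; apply: lerD.
    by apply: le_trans b2 _; rewrite expr2 le_eqVlt; apply/orP; left; apply/eqP; ring.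
  rewrite -[leRHS]mulrA ler_wpM2l ?invr_ge0 ?(ltW q0)//.
  by apply: le_trans b1 _; rewrite expr2 le_eqVlt; apply/orP; left; apply/eqP; ring.
apply/eqP; rewrite -normr_le0 leNgt; apply/negP => Jp.
set J := `|_| in Jp.
(* Small enough that C h < J, against J <= C h from [key]. *)
pose h := Num.min 1 (J / (2 * (Cst + 1))).
have c1 : 0 < 2 * (Cst + 1) by lra.
have hp : 0 < h by rewrite lt_min ltr01 divr_gt0.
have h1 : h <= 1 by rewrite ge_min lexx.
have := key h hp h1; rewrite normrM gtr0_norm// -/J expr2 mulrCA ler_pM2l//.
have : h <= J / (2 * (Cst + 1)) by rewrite ge_min lexx orbT.
rewrite ler_pdivlMr// => h2 h3.
have := mulr_ge0 C0 (ltW hp); nra.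
Qed.

End diffs.

Ltac nonneg := repeat first [assumption | exact: powR_ge0 | exact: cK_ge0 | exact: cG_ge0 | exact: ler01 | exact: ler0n | exact: normr_ge0 |
  apply: mulr_ge0 | apply: addr_ge0 | rewrite invr_ge0 | (apply: ltW; assumption)].

(** * Regularity gained after a unit of time *)

Section semigroup_regularity.
Context {R : realType} {n : nat}.
Notation V := 'rV[R]_n.
Notation mu := (rvm n).
Variable (a : V).
Implicit Types (x : V) (s t r h : R) (v w : V -> R) (g : R -> V -> R) (A B C : R).

Lemma cnvBl (k1 k2 w : V -> R) C1 C2 B x : measurable_fun setT k1 -> (forall y, `|k1 y| <= C1) ->
  measurable_fun setT k2 -> (forall y, `|k2 y| <= C2) -> L1 mu w B ->
  cnv (fun z : V => k1 z - k2 z) w x = cnv k1 w x - cnv k2 w x.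
Proof.
move=> m1 b1 m2 b2 hw.
apply: etrans (I_sub (cnv_intg2 x m1 b1 hw) (cnv_intg2 x m2 b2 hw)).
by apply: eq_I => y; rewrite mulrBl.
Qed.

Lemma L1_cut_78 : L1 leb (tcut 1 (fun s => (1 - s) `^ (- (7 / 8)))) (8 : R).
Proof.
apply: (@L1_cut_refl R 1 (fun s => s `^ (- (7 / 8)))).
have c0 : 0 < 8^-1 :> R by rewrite invr_gt0.
have := L1_cut_powR c0 ltr01.
by rewrite powR1 invrK mulr1 (_ : 8^-1 - 1 = - (7 / 8) :> R)//; lra.
Qed.

(** For a merely bounded function the loss would be r^{-1/2}; a unit of smoothing time improves it.
    In the Duhamel part the kernel has effective time r + q with q = (1 - s)/2, and (r + q)^{-1/2}
    <= r^{-1/8} q^{-3/8} leaves q^{-7/8} in all, which is integrable. *)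
Lemma adheat_mild_sup v w g N1 K B1 B2 r x : 0 < r -> r <= 1 -> L1 mu v N1 -> (forall y, `|v y| <= K) ->
  jmeas g -> (forall s, 0 < s -> L1 mu (g s) B1) -> (forall s y, 0 < s -> `|g s y| <= B2) ->
  (forall y, w y = cnv (gauss 1) v y + duh a g 1 y) ->
  `|cnv (K1 a r) w x| <= (cK a * K + cK a * cK a * B2 * 2 `^ (7 / 8) * 8) * r `^ (- 8^-1).
Proof.
move=> r0 r1 hv vK mg gL gs wE.
have K0 : 0 <= K by apply: le_trans (vK 0).
have B20 : 0 <= B2 by apply: le_trans (gs 1 0 ltr01).
have B10 := L1_ge0 (gL 1 ltr01).
have C1 : 0 <= cK a * B1 by rewrite mulr_ge0 ?cK_ge0.
have gL' s : 0 < s -> s < 1 -> L1 mu (g s) B1 by move=> s0 _; exact: gL.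
have hB : L1 leb (tcut 1 (fun s => cK a * (1 - s) `^ (- 2^-1) * B1)) (cK a * B1 * (2 * 1 `^ 2^-1)).
  by apply: eq_L1cut (L1_cut_scale (L1_cut_half ltr01) C1) => s _ _; ring.
have r18 : 1 <= r `^ (- 8^-1).
  by rewrite powRN invf_ge1 ?powR_gt0//; apply: powR_le1 => //; exact: ltW.
have -> : w = fun y => cnv (gauss 1) v y + duh a g 1 y by apply/funext.
have hG := cnv_L1 (L1_gauss ltr01) hv.
have hS := duh_L1 mg gL' hB.
have -> := cnvD x (measurable_K1 a r) (fun z => K1_sup a z r0) hG hS.
apply: le_trans (ler_normD _ _) _; rewrite mulrDl; apply: lerD.
  have -> := adheat_heat a x r0 ltr01 hv.
  have rp : 0 < r + 1 by rewrite addr_gt0.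
  apply: le_trans (cnv_sup x (L1_K1 a rp) hv.1 vK) _.
  rewrite mulrAC; apply: ler_wpM2l; first by rewrite mulr_ge0 ?cK_ge0.
  apply: le_trans r18; rewrite powRN invf_le1 ?powR_gt0//.
  by rewrite -{1}(powRr0 (r + 1)) ler_powR//; lra.
have [E LE] := duh_cnv mg gL' hB x (measurable_K1 a r) (fun z => K1_sup a z r0).
have C2 : 0 <= cK a * cK a * B2 * 2 `^ (7 / 8) * r `^ (- 8^-1).
  by nonneg.
have -> := E.
rewrite (_ : _ * 8 * _ = cK a * cK a * B2 * 2 `^ (7 / 8) * r `^ (- 8^-1) * 8); last by rewrite mulrAC.
apply: L1_I; apply: (L1_cut_le LE.1 _ (L1_cut_scale L1_cut_78 C2)) => s s0 s1.
have t0 : 0 < 1 - s by rewrite subr_gt0.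
have h0 : 0 < (1 - s) / 2 by rewrite divr_gt0.
apply: le_trans (adheat_adheat_sup a x r0 t0 (gL s s0) (fun y => gs s y s0)) _.
set q := (1 - s) / 2 in h0 *.
have p1 : (r + q) `^ (- 2^-1) <= r `^ (- 8^-1) * q `^ (- (3 / 8)).
  have rq : 0 < r + q by rewrite addr_gt0.
  have -> : - 2^-1 = - 8^-1 + - (3 / 8) :> R by lra.
  rewrite powRD ?(gt_eqF rq) ?implybT//; apply: ler_pM; rewrite ?powR_ge0//.
    by apply: ler_powRN => //; lra.
  by apply: ler_powRN => //; lra.
have p2 : q `^ (- (3 / 8)) * q `^ (- 2^-1) = 2 `^ (7 / 8) * (1 - s) `^ (- (7 / 8)).
  rewrite -powRD ?(gt_eqF h0) ?implybT// (_ : - (3 / 8) + - 2^-1 = - (7 / 8)); last by lra.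
  exact: powR_half.
rewrite (_ : cK a * cK a * B2 * _ * _ * _ = cK a * cK a * B2 * r `^ (- 8^-1) * (2 `^ (7 / 8) * (1 - s) `^ (- (7 / 8)))); last by ring.
rewrite -p2 (_ : _ * _ * (_ * _ * _) = cK a * cK a * B2 * q `^ (- 2^-1) * (r + q) `^ (- 2^-1)); last by ring.
rewrite (_ : _ * (q `^ _ * _) = cK a * cK a * B2 * q `^ (- 2^-1) * (r `^ (- 8^-1) * q `^ (- (3 / 8)))); last by ring.
by apply: ler_wpM2l => //; nonneg.
Qed.

(** e^{r Delta} shifts the kernels of both parts of w by the time r: [gauss_diff] handles the heat
    part, [K1_diff] the Duhamel part, where (1 - s)^{-7/8} is integrable. *)
Lemma mild_heat_diff v w g N1 B1 B2 r : 0 < r -> L1 mu v N1 ->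
  jmeas g -> (forall s, 0 < s -> L1 mu (g s) B1) -> (forall s y, 0 < s -> `|g s y| <= B2) -> (forall y, w y = cnv (gauss 1) v y + duh a g 1 y) ->
  L1 mu (fun x => w x - cnv (gauss r) w x) ((@cG R n * N1 + 4 * cK a * @cG R n * B1 * 8) * r `^ (3 / 8)).
Proof.
move=> r0 hv mg gL gs wE.
have B20 : 0 <= B2 by apply: le_trans (gs 1 0 ltr01).
have B10 := L1_ge0 (gL 1 ltr01).
have C1 : 0 <= cK a * B1 by rewrite mulr_ge0 ?cK_ge0.
have gL' s : 0 < s -> s < 1 -> L1 mu (g s) B1 by move=> s0 _; exact: gL.
have hB : L1 leb (tcut 1 (fun s => cK a * (1 - s) `^ (- 2^-1) * B1)) (cK a * B1 * (2 * 1 `^ 2^-1)).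
  by apply: eq_L1cut (L1_cut_scale (L1_cut_half ltr01) C1) => s _ _; ring.
have wE' : w = fun y => cnv (gauss 1) v y + duh a g 1 y by apply/funext.
have hG := cnv_L1 (L1_gauss ltr01) hv.
have hS := duh_L1 mg gL' hB.
have r1 : 0 < 1 + r by rewrite addr_gt0.
pose D x := cnv (fun z => gauss (1 + r) z - gauss 1 z) v x.
have DE x : D x = cnv (gauss (1 + r)) v x - cnv (gauss 1) v x.
  exact: (cnvBl x (measurable_gauss (1 + r)) (fun z => gauss_sup z r1) (measurable_gauss 1) (fun z => gauss_sup z ltr01) hv).
have hD : L1 mu D (@cG R n * (r / 1) `^ (3 / 8) * N1) by exact: cnv_L1 (gauss_diff ltr01 r0) hv.
pose H (z : R * V) := tcut 1 (fun s => cnv (K1 a (1 - s + r)) (g s) z.2 - cnv (K1 a (1 - s)) (g s) z.2) z.1.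
have mK c : measurable_fun setT (fun z : R * V => cnv (K1 a (c - z.1)) (g z.1) z.2).
  have p3 : measurable_fun setT (fun z : R * V => (c - z.1, z.1)).
    by apply: measurable_fun_pair => //; apply: measurable_funB => //; exact: measurable_fst.
  exact: (measurable_comp2 (measurable_cnvK a mg) p3 measurable_snd).
have mH : measurable_fun setT H.
  rewrite (_ : H = fun z : R * V => if (0 < z.1) && (z.1 < 1) then cnv (K1 a (1 + r - z.1)) (g z.1) z.2 - cnv (K1 a (1 - z.1)) (g z.1) z.2 else 0); last first.
    by apply/funext => z; rewrite /H /tcut [1 - z.1 + r]addrAC.
  apply: measurable_fun_ifT => //; last by apply: measurable_funB; exact: mK.
  by apply: measurable_and; apply: measurable_fun_ltr.
have C2 : 0 <= 4 * cK a * @cG R n * B1 * r `^ (3 / 8).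
  by nonneg.
have hb := L1_cut_scale L1_cut_78 C2.
have Hb s : (\int[mu]_x (`|H (s, x)|)%:E <= (tcut 1 (fun s => 4 * cK a * @cG R n * B1 * r `^ (3 / 8) * (1 - s) `^ (- (7 / 8))) s)%:E)%E.
  rewrite /H /tcut /=; case: ifPn => [/andP[s0 s1]|_]; last first.
    by under eq_integral do rewrite normr0; rewrite integral0.
  have t0 : 0 < 1 - s by rewrite subr_gt0.
  have tr : 0 < 1 - s + r by rewrite addr_gt0.
  have E x : cnv (fun z => K1 a (1 - s + r) z - K1 a (1 - s) z) (g s) x = cnv (K1 a (1 - s + r)) (g s) x - cnv (K1 a (1 - s)) (g s) x.
    exact: (cnvBl x (measurable_K1 a _) (fun z => K1_sup a z tr) (measurable_K1 a _) (fun z => K1_sup a z t0) (gL s s0)).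
  have := (eq_L1 E (cnv_L1 (K1_diff a t0 r0) (gL s s0))).2; move/le_trans; apply.
  by rewrite lee_fin le_eqVlt; apply/orP; left; apply/eqP; ring.
have hI := fub_L1 mH hb Hb.
have IE x : cnv (gauss r) (duh a g 1) x - duh a g 1 x = RI leb (fun s => H (s, x)).
  have [E LE] := duh_cnv mg gL' hB x (measurable_gauss r) (fun z => gauss_sup z r0).
  have F : tcut 1 (fun s => cnv (gauss r) (cnv (K1 a (1 - s)) (g s)) x) = tcut 1 (fun s => cnv (K1 a (1 - s + r)) (g s) x).
    apply: eq_cut => s s0 s1; apply: (etrans (heat_adheat a x r0 _ (gL s s0))); first by rewrite subr_gt0.
    by rewrite addrC.
  have C3 : 0 <= cK a * B2 by rewrite mulr_ge0 ?cK_ge0.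
  have gb s : 0 < s -> s < 1 -> `|cnv (K1 a (1 - s)) (g s) x| <= cK a * B2 * (1 - s) `^ (- 2^-1).
    move=> s0 s1; have t0 : 0 < 1 - s by rewrite subr_gt0.
    apply: le_trans (cnv_sup x (L1_K1 a t0) (jmeas_meas _ mg) (fun y => gs s y s0)) _.
    by rewrite mulrAC.
  have [_ LS] := duh_sup mg gb (L1_cut_scale (L1_cut_half ltr01) C3).
  rewrite F in LE; have -> : cnv (gauss r) (duh a g 1) x = _ := etrans E (congr1 (RI leb) F).
  apply: etrans (esym (I_sub LE LS)) _; apply: eq_I => s; rewrite /H /tcut.
  by case: ifP => // _; rewrite subr0.
have hw x : cnv (gauss r) w x = cnv (gauss (1 + r)) v x + cnv (gauss r) (duh a g 1) x.
  rewrite wE'; apply: etrans (cnvD x (measurable_gauss r) (fun z => gauss_sup z r0) hG hS) _.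
  congr (_ + _); apply: etrans (heat_heat x r0 ltr01 hv) _.
  by rewrite addrC.
have E x : - D x - RI leb (fun s => H (s, x)) = w x - cnv (gauss r) w x.
  rewrite -IE hw wE DE.
  move: (cnv _ v x) (cnv _ v x) (duh _ _ _ _) (cnv _ (duh a g 1) x) => A B C E; ring.
apply: (eq_L1 E); apply: L1_weak (L1_sub (L1_opp hD) hI).
by rewrite divr1 le_eqVlt; apply/orP; left; apply/eqP; ring.
Qed.

End semigroup_regularity.

Lemma cnvE (R : realType) (n : nat) (k g : 'rV[R]_n -> R) x : cnv k g x = RI (rvm n) (fun y => k (x - y) * g y).
Proof. by []. Qed.

Lemma duhE (R : realType) (n : nat) (a : 'rV[R]_n) g t x :
  duh a g t x = RI leb (tcut t (fun s => cnv (K1 a (t - s)) (g s) x)).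
Proof. by []. Qed.

Lemma gaussE (R : realType) (n : nat) t (x : 'rV[R]_n) :
  gauss t x = (4 * pi * t) `^ (- (n%:R / 2)) * expR (- (sqnorm x / (4 * t))).
Proof. by rewrite /gauss mulNr. Qed.

Lemma K1E (R : realType) (n : nat) (a : 'rV[R]_n) t z : K1 a t z = - dotv a z / (2 * t) * gauss t z.
Proof. by []. Qed.

Lemma duh_sub (R : realType) (n : nat) (a : 'rV[R]_n) g1 g2 (t : R) x B1 B2 :
  (forall s, 0 < s -> s < t -> exists b, L1 (rvm n) (g1 s) b) ->
  (forall s, 0 < s -> s < t -> exists b, L1 (rvm n) (g2 s) b) ->
  L1 leb (tcut t (fun s => cnv (K1 a (t - s)) (g1 s) x)) B1 ->
  L1 leb (tcut t (fun s => cnv (K1 a (t - s)) (g2 s) x)) B2 ->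
  duh a (fun s y => g1 s y - g2 s y) t x = duh a g1 t x - duh a g2 t x.
Proof.
move=> h1 h2 l1 l2; apply: etrans (I_sub l1 l2); apply: eq_I => s; rewrite /tcut.
case: ifPn => [/andP[s0 st]|_]; last by rewrite subr0.
have [b1 hb1] := h1 s s0 st; have [b2 hb2] := h2 s s0 st.
have ts : 0 < t - s by rewrite subr_gt0.
exact: (cnvB x (measurable_K1 a _) (fun z => K1_sup a z ts) hb1 hb2).
Qed.

Lemma duh_mull (R : realType) (n : nat) (a : 'rV[R]_n) g c (t : R) x B :
  (forall s, 0 < s -> s < t -> exists b, L1 (rvm n) (g s) b) ->
  L1 leb (tcut t (fun s => cnv (K1 a (t - s)) (g s) x)) B ->
  duh a (fun s y => c * g s y) t x = c * duh a g t x.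
Proof.
move=> h1 l1; apply: etrans (I_scale c l1); apply: eq_I => s; rewrite /tcut.
case: ifPn => [/andP[s0 st]|_]; last by rewrite mulr0.
have [b1 hb1] := h1 s s0 st; have ts : 0 < t - s by rewrite subr_gt0.
exact: (cnvZ c x (measurable_K1 a _) (fun z => K1_sup a z ts) hb1).
Qed.

(** * Dilations, null sets and norms *)

Section rescale.
Context {R : realType}.
Implicit Types (c : R).

(** If I or J is infinite, [fine] gives 0 on both sides, so the scaling formulas below hold for all
    measurable functions. *)
Lemma fine_scaleB c (I J : \bar R) : 0 < c -> fine (c%:E * I - c%:E * J) = c * fine (I - J).
Proof.
move=> c0; case: I => [i||]; case: J => [j||] //=;
  rewrite ?gt0_muley ?gt0_muleNy ?lte_fin//= ?mulr0//.
by rewrite mulrBr.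
Qed.

Lemma RI_leb_scale c (f : R -> R) : 0 < c -> measurable_fun setT f ->
  RI leb (fun s => f (c * s)) = c^-1 * RI leb f.
Proof.
move=> c0 mf; have cN : c != 0 by rewrite gt_eqF.
have h (g : R -> \bar R) : measurable_fun setT g -> (forall x, 0 <= g x)%E ->
    (\int[leb]_s g (c * s)%R = (c^-1)%:E * \int[leb]_s g s)%E.
  move=> mg g0; have := ge0_integral_leb_affine 0 cN mg g0.
  rewrite gtr0_norm// => <-; by apply: eq_integral => s _; rewrite addr0.
rewrite /RI /Rintegral integralE [in RHS]integralE -fine_scaleB ?invr_gt0//; congr (fine (_ - _)%E).
  transitivity (\int[leb]_s (EFin \o f)^\+%E (c * s)%R)%E.
    by apply: eq_integral => s _; rewrite !funeposE.
  by rewrite h//; apply: measurable_funepos; exact/measurable_EFinP.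
transitivity (\int[leb]_s (EFin \o f)^\-%E (c * s)%R)%E.
  by apply: eq_integral => s _; rewrite !funenegE.
by rewrite h//; apply: measurable_funeneg; exact/measurable_EFinP.
Qed.

Lemma RI_rvm_scale n c (f : 'rV[R]_n -> R) : 0 < c -> measurable_fun setT f ->
  RI (rvm n) (fun x => f (c *: x)) = (c ^+ n)^-1 * RI (rvm n) f.
Proof.
move=> c0 mf; have cN : c != 0 by rewrite gt_eqF.
have h (g : 'rV[R]_n -> \bar R) : measurable_fun setT g -> (forall x, 0 <= g x)%E ->
    (\int[rvm n]_s g (c *: s)%R = ((c ^+ n)^-1)%:E * \int[rvm n]_s g s)%E.
  move=> mg g0; have := ge0_integral_affine 0 cN mg g0.
  rewrite gtr0_norm// => <-; by apply: eq_integral => s _; rewrite addr0.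
rewrite /RI /Rintegral integralE [in RHS]integralE -fine_scaleB ?invr_gt0 ?exprn_gt0//; congr (fine (_ - _)%E).
  transitivity (\int[rvm n]_s (EFin \o f)^\+%E (c *: s)%R)%E.
    by apply: eq_integral => s _; rewrite !funeposE.
  by rewrite h//; apply: measurable_funepos; exact/measurable_EFinP.
transitivity (\int[rvm n]_s (EFin \o f)^\-%E (c *: s)%R)%E.
  by apply: eq_integral => s _; rewrite !funenegE.
by rewrite h//; apply: measurable_funeneg; exact/measurable_EFinP.
Qed.

Lemma L1_dilate n (f : 'rV[R]_n -> R) B c : 0 < c -> L1 (rvm n) f B -> L1 (rvm n) (fun x => f (c *: x)) ((c ^+ n)^-1 * B).
Proof.
move=> c0 [mf fB]; have cN : c != 0 by rewrite gt_eqF.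
have mc : measurable_fun setT (fun x : 'rV[R]_n => f (c *: x)).
  apply: (measurableT_comp mf); have := measurable_affine c (0 : 'rV[R]_n).
  by apply: eq_measurable_fun => x _; rewrite addr0.
split=> //.
have ma : measurable_fun setT (fun x : 'rV[R]_n => (`|f x|)%:E) by apply/measurable_EFinP; exact: measurableT_comp.
have := ge0_integral_affine 0 cN ma (fun x => _).
rewrite gtr0_norm// => h.
have -> : (\int[rvm n]_x (`|f (c *: x)|)%:E = \int[rvm n]_x (`|f (c *: x + 0)|)%:E)%E.
  by apply: eq_integral => x _; rewrite addr0.
by rewrite h// EFinM lee_wpmul2l// lee_fin invr_ge0 exprn_ge0// ltW.
Qed.

End rescale.

Lemma I_zero d (T : measurableType d) (R : realType) (m : {sigma_finite_measure set T -> \bar R}) :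
  RI m (fun=> 0) = 0.
Proof. by rewrite /RI Rintegral_cst// mul0r. Qed.

Lemma ae_interval_ex (R : realType) (t : R) (P : R -> Prop) : 0 < t -> {ae leb, forall s : R, P s} ->
  exists s, [/\ 0 < s, s < t & P s].
Proof.
move=> t0 [N [mN N0 sub]]; apply: contrapT => hn.
have sN : `]0, t[%classic `<=` N.
  move=> s /=; rewrite in_itv/= => /andP[s0 st]; apply: sub => /= Ps.
  by apply: hn; exists s.
have h : (leb `]0%R, t[%classic <= leb N)%E by apply: le_measure => //; rewrite inE.
move: h; rewrite N0 leNgt => /negP; apply.
rewrite (_ : leb _ = @lebesgue_measure R `]0, t[%classic)//.
by rewrite lebesgue_measure_itv/= lte_fin t0 oppr0 adde0 lte_fin.
Qed.

(** * Operations on coverings *)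

Section null.
Context {R : realType} {n : nat}.
Notation V := 'rV[R]_n.
Notation mu := (rvm n).
Implicit Types (A B : set V) (c : R).

(** [esssup] is defined through coverings, and [rn_null_negligible] leads only from coverings to
    measure; closure properties are therefore proved on the coverings themselves. *)
Lemma rn_null_sub A B : A `<=` B -> rn_null B -> rn_null A.
Proof.
move=> AB hB e e0; have [lo [hi [h1 h2]]] := hB e e0; exists lo, hi; split=> //.
exact: subset_trans AB h1.
Qed.

Lemma vol_ge0 (lo hi : V) : 0 <= \prod_(i < n) Num.max 0 (hi 0 i - lo 0 i).
Proof. by apply: prodr_ge0 => i _; rewrite le_max lexx. Qed.

Lemma rn_null_dilate A c : 0 < c -> rn_null A -> rn_null [set x | A (c *: x)].
Proof.
move=> c0 hA e e0; have cn : 0 < c ^+ n by exact: exprn_gt0.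
have [lo [hi [h1 h2]]] := hA (e * c ^+ n) (mulr_gt0 e0 cn).
exists (fun k => c^-1 *: lo k), (fun k => c^-1 *: hi k); split.
  move=> x /= /h1[k _ hk]; exists k => //= i; rewrite !mxE.
  have := hk i; rewrite mxE => /andP[a1 a2].
  by rewrite ler_pdivrMl// ler_pdivlMl// a1 a2.
have E k : (\prod_(i < n) Num.max 0 ((c^-1 *: hi k) 0 i - (c^-1 *: lo k) 0 i))%:E =
    ((c ^+ n)^-1%:E * (\prod_(i < n) Num.max 0 (hi k 0 i - lo k 0 i))%:E)%E.
  rewrite -EFinM; congr EFin; rewrite -exprVn -[X in X ^+ n]/(c^-1).
  have -> : c^-1 ^+ n = \prod_(i < n) c^-1 by rewrite prodr_const card_ord.
  rewrite -big_split; apply: eq_bigr => i _ /=.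
  by rewrite !mxE -mulrBr -[in LHS](mulr0 c^-1) -maxr_pMr// invr_ge0 ltW.
rewrite (eq_eseriesr (fun k _ => E k)) nneseriesZl; last by move=> k _; rewrite lee_fin vol_ge0.
by rewrite lte_pdivrMl// -EFinM mulrC.
Qed.

(** Two coverings are enumerated by parity. A partial sum of length m is at most the one of length
    2m, which splits exactly. *)
Lemma nneseries_interleave (f g : nat -> \bar R) (A B : \bar R) : (forall k, 0 <= f k)%E -> (forall k, 0 <= g k)%E ->
  (\sum_(0 <= k <oo) f k <= A)%E -> (\sum_(0 <= k <oo) g k <= B)%E ->
  (\sum_(0 <= k <oo) (if odd k then g k./2 else f k./2) <= A + B)%E.
Proof.
move=> f0 g0 fA gB; pose F k := if odd k then g k./2 else f k./2.
have F0 k : (0 <= F k)%E by rewrite /F; case: ifP.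
apply: lime_le; first by apply: is_cvg_nneseries => k _ _; exact: F0.
apply: nearW => m.
have E : (\sum_(0 <= k < m.*2) F k = \sum_(0 <= k < m) f k + \sum_(0 <= k < m) g k)%E.
  elim: m => [|m IH]; first by rewrite !big_geq// adde0.
  rewrite doubleS !big_nat_recr//= IH /F /= odd_double /= doubleK uphalf_double.
  by rewrite -!addeA; congr (_ + _)%E; rewrite addeCA.
apply: (@le_trans _ _ (\sum_(0 <= k < m.*2) F k)%E).
  rewrite (@big_cat_nat _ _ _ m 0 m.*2)//=; last by rewrite -addnn leq_addr.
  by apply: leeDl; apply: sume_ge0 => k _.
rewrite E; apply: leeD.
  by apply: le_trans fA; apply: nneseries_lim_ge => k _ _.
by apply: le_trans gB; apply: nneseries_lim_ge => k _ _.
Qed.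

Lemma rn_nullU A B : rn_null A -> rn_null B -> rn_null (A `|` B).
Proof.
move=> hA hB e e0; have e2 : 0 < e / 2 by rewrite divr_gt0.
have [lo [hi [h1 h2]]] := hA _ e2; have [lo' [hi' [h3 h4]]] := hB _ e2.
exists (fun k => if odd k then lo' k./2 else lo k./2), (fun k => if odd k then hi' k./2 else hi k./2); split.
  move=> x [/h1[k _ hk]|/h3[k _ hk]]; [exists k.*2|exists k.*2.+1] => //=.
    by rewrite odd_double doubleK.
  by rewrite odd_double /= uphalf_double.
pose v (lo hi : nat -> V) k := (\prod_(i < n) Num.max 0 (hi k 0 i - lo k 0 i))%:E.
have v0 l h k : (0 <= v l h k)%E by rewrite lee_fin vol_ge0.
have E k : (\prod_(i < n) Num.max 0 ((if odd k then hi' k./2 else hi k./2) 0 i - (if odd k then lo' k./2 else lo k./2) 0 i))%:E =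
   if odd k then v lo' hi' k./2 else v lo hi k./2 by case: ifP.
rewrite (eq_eseriesr (fun k _ => E k)).
apply: le_lt_trans (nneseries_interleave (v0 lo hi) (v0 lo' hi') (lexx _) (lexx _)) _.
rewrite (_ : e%:E = (e / 2)%:E + (e / 2)%:E)%E; last by rewrite -EFinD; congr EFin; field.
by apply: lteD.
Qed.

(** Degenerate boxes have volume 0 only for n > 0: in dimension 0 the empty product gives every box
    volume 1. *)
Lemma rn_null0 : (0 < n)%N -> rn_null (set0 : set V).
Proof.
move=> n0 e e0; exists (fun=> 0), (fun=> 0); split; first by [].
rewrite eseries0; first by rewrite lte_fin.
move=> k _ _; congr EFin; rewrite (bigD1 (Ordinal n0))//=.
by rewrite subrr maxxx mul0r.
Qed.

(** Otherwise the integral of G_1 would be 0 instead of 1. This excludes negative levels in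
    [esssup]. *)
Lemma not_rn_nullT : ~ rn_null [set: V].
Proof.
move/rn_null_negligible => h.
have E : ae_eq mu setT (gauss 1 : V -> R) (cst (0 : R)) by apply: negligibleS h.
have m0 : measurable_fun setT (cst (0 : R) : V -> R) by exact: measurable_cst.
have := ae_eq_I (measurable_gauss 1) m0 E.
by rewrite RI_gauss// /RI Rintegral_cst// mul0r => /eqP; rewrite oner_eq0.
Qed.

End null.

Section esssup.
Context {R : realType} {n : nat}.
Notation V := 'rV[R]_n.
Notation mu := (rvm n).
Implicit Types (f g w : V -> R) (c d K : R).
Hypothesis n0 : (0 < n)%N.

Lemma esssup_ub f M : rn_null [set x | (M < (`|f x|)%:E)%E] -> (esssup f <= M)%E.
Proof. by move=> h; apply: ereal_inf_lbound. Qed.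

Lemma esssup_lb f z : (forall M, rn_null [set x | (M < (`|f x|)%:E)%E] -> (z <= M)%E) -> (z <= esssup f)%E.
Proof. by move=> h; apply: le_ereal_inf_tmp => M /=; exact: h. Qed.

Lemma esssup_ge0 f : (0 <= esssup f)%E.
Proof.
apply: esssup_lb => M hM; rewrite leNgt; apply/negP => M0; apply: not_rn_nullT.
apply: rn_null_sub hM => x _ /=; apply: lt_le_trans M0 _.
by rewrite lee_fin.
Qed.

Lemma esssup_le f K : (forall x, `|f x| <= K) -> (esssup f <= K%:E)%E.
Proof.
move=> fK; apply: esssup_ub; apply: rn_null_sub (rn_null0 n0) => x /=.
by rewrite lte_fin ltNge fK.
Qed.

Lemma esssup_dist f g d : (forall x, `|f x - g x| <= d) -> (esssup f <= esssup g + d%:E)%E.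
Proof.
move=> fg; rewrite -leeBlDr//; apply: esssup_lb => M hM.
rewrite leeBlDr//; apply: esssup_ub; apply: rn_null_sub hM => x /=.
rewrite -lteBrDr// => h; apply: lt_le_trans h _; rewrite -EFinB lee_fin lerBlDr.
by have := ler_normD (f x - g x) (g x); rewrite subrK => h; apply: le_trans h _; rewrite addrC lerD2l.
Qed.

Lemma esssup_null f g : rn_null [set x | f x <> g x] -> esssup f = esssup g.
Proof.
have key (u v : V -> R) : rn_null [set x | u x <> v x] -> (esssup u <= esssup v)%E.
  move=> h; apply: esssup_lb => M hM; apply: esssup_ub.
  apply: rn_null_sub (rn_nullU hM h) => x /= hx.
  by have [E|E] := eqVneq (u x) (v x); [left; rewrite -E|right; apply/eqP].
move=> h; apply/eqP; rewrite eq_le !key//; apply: rn_null_sub h => x /= h1 h2; exact: h1.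
Qed.

(** One inequality, applied to the dilation and to its inverse. *)
Lemma esssup_scale f c d : 0 < c -> 0 < d -> (c%:E * esssup f = esssup (fun x => (c * f (d *: x))%R))%E.
Proof.
have key (u : V -> R) (c' d' : R) : 0 < c' -> 0 < d' -> (esssup (fun x => (c' * u (d' *: x))%R) <= c'%:E * esssup u)%E.
  move=> c0 d0; rewrite -lee_pdivrMl//; apply: esssup_lb => M hM.
  rewrite lee_pdivrMl//; apply: esssup_ub; apply: rn_null_sub (rn_null_dilate d0 hM) => x /=.
  by rewrite normrM gtr0_norm// EFinM lte_pmul2l.
move=> c0 d0; apply/eqP; rewrite eq_le key// andbT -lee_pdivlMl//.
have i1 : 0 < c^-1 by rewrite invr_gt0. have i2 : 0 < d^-1 by rewrite invr_gt0.
have := key (fun x => c * f (d *: x)) _ _ i1 i2.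
rewrite (_ : (fun x => _) = f)//; apply/funext => x.
by rewrite mulrA mulVf ?gt_eqF// mul1r scalerA mulfV ?gt_eqF// scale1r.
Qed.

End esssup.

(** * L^q norms and dilations *)

Section Lq.
Context {R : realType} {n : nat}.
Notation V := 'rV[R]_n.
Notation mu := (rvm n).
Implicit Types (f g w : V -> R) (c d r K A B C : R).
Hypothesis n0 : (0 < n)%N.

Lemma L1_pow r w A K : 1 <= r -> L1 mu w A -> (forall x, `|w x| <= K) ->
  L1 mu (fun x => `|w x| `^ r) (K `^ (r - 1) * A).
Proof.
move=> r1 hw wK; have K0 : 0 <= K by apply: le_trans (wK 0).
have h := L1_scale (K `^ (r - 1)) (L1_abs hw); rewrite (ger0_norm (powR_ge0 _ _)) in h.
apply: (L1_le _ _ _ _ h).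
  by apply: measurable_powR_comp; apply: measurableT_comp => //; exact: hw.1.
move=> x; rewrite ger0_norm ?powR_ge0// -mulr_powRB1//; last by apply: lt_le_trans r1.
by rewrite mulrC ler_wpM2r//; apply: ge0_ler_powR; rewrite ?nnegrE ?subr_ge0.
Qed.

Lemma Lq_EFin r w A K : 1 <= r -> L1 mu w A -> (forall x, `|w x| <= K) ->
  Lq r%:E w = ((RI mu (fun x => `|w x| `^ r)) `^ r^-1)%:E.
Proof.
move=> r1 hw wK; have h := L1_pow r1 hw wK.
rewrite /Lq iintE; last exact: L1_Itg h.
rewrite -poweR_EFin; congr (_ `^ _)%E.
rewrite /RI /Rintegral fineK//; apply: integrable_fin_num => //; exact: L1_Itg h.
Qed.

Lemma Lq_null (q : \bar R) f g : (1 <= q)%E -> measurable_fun setT f -> measurable_fun setT g ->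
  rn_null [set x | f x <> g x] -> Lq q f = Lq q g.
Proof.
case: q => [r||]// r1 mf mg h; last exact: esssup_null.
rewrite /Lq; congr (_ `^ _)%E.
have mp (u : V -> R) : measurable_fun setT u -> measurable_fun setT (fun x : V => (`|u x| `^ r)%:E).
  by move=> mu_; apply/measurable_EFinP; apply: measurable_powR_comp; exact: measurableT_comp.
rewrite !ge0_iintE//; try exact: mp; try (by move=> x; rewrite lee_fin powR_ge0).
apply: ae_eq_integral => //; try exact: mp.
have := rn_null_negligible h; apply: negligibleS => x /= hx E; apply: hx => _.
by rewrite E.
Qed.

(** The dilation by sqrt t has Jacobian factor t^{-n/2}, whose power 1/q is the q-dependent part of
    the weight: after rescaling, one function serves every q. *)
Lemma Lq_scale (q : \bar R) w A K t k : (1 <= q)%E -> 0 < t -> L1 mu w A -> (forall x, `|w x| <= K) ->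
  ((t `^ (n%:R / 2 * (1 - inv_exp q) + k))%:E * Lq q w =
   Lq q (fun x => (t `^ (n%:R / 2 + k) * w (Num.sqrt t *: x))%R))%E.
Proof.
move=> q1 t0 hw wK; have q0 : 0 < Num.sqrt t by rewrite sqrtr_gt0.
case: q q1 => [r||]// r1; last first.
  by rewrite /inv_exp subr0 mulr1; apply: esssup_scale => //; exact: powR_gt0.
rewrite lee_fin in r1; have r0 : 0 < r by exact: lt_le_trans r1.
set c := t `^ (n%:R / 2 + k).
have h2 := L1_scale c (L1_dilate q0 hw).
have b2 x : `|c * w (Num.sqrt t *: x)| <= c * K.
  by rewrite normrM (ger0_norm (powR_ge0 _ _)) ler_wpM2l// powR_ge0.
rewrite (Lq_EFin r1 hw wK) (Lq_EFin r1 h2 b2) -EFinM; congr EFin.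
have hp := L1_pow r1 hw wK.
pose F x := `|w x| `^ r.
have E x : `|c * w (Num.sqrt t *: x)| `^ r = c `^ r * F (Num.sqrt t *: x).
  by rewrite normrM (ger0_norm (powR_ge0 _ _)) powRM ?powR_ge0.
rewrite (eq_I mu E) (I_scale (c `^ r) (L1_dilate q0 hp)) (RI_rvm_scale q0 hp.1).
have I0 : 0 <= RI mu (fun x => `|w x| `^ r) by apply: I_ge0 => x; exact: powR_ge0.
have qn : (Num.sqrt t ^+ n)^-1 = t `^ (- (n%:R / 2)).
  by rewrite -powR12_sqrt ?(ltW t0)// -powR_mulrn ?powR_ge0// -powRrM powRN mulrC.
rewrite qn mulrA powRM ?mulr_ge0 ?powR_ge0//; congr (_ * _).
rewrite powRM ?powR_ge0// -!powRrM mulfV ?gt_eqF// mulr1 -powRD ?(gt_eqF t0) ?implybT//.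
by congr (_ `^ _); rewrite /inv_exp; ring.
Qed.

End Lq.

(* keeps conversion from unfolding the integrals below *)
Opaque cnv duh K1 gauss.

(** * Energy decay *)

Section heat_energy.
Context {R : realType} {n : nat}.
Notation V := 'rV[R]_n.
Notation mu := (rvm n).
Implicit Types (v : V -> R) (h T : R).

Lemma L1_sqr v B K : L1 mu v B -> (forall x, `|v x| <= K) -> L1 mu (fun x => v x ^+ 2) (B * K).
Proof. by move=> hv vK; apply: eq_L1 (L1_mulb hv hv.1 vK) => x; rewrite expr2. Qed.

Definition energy v := RI mu (fun x => v x ^+ 2).

Lemma heat_sup v K h x : 0 < h -> measurable_fun setT v -> (forall y, `|v y| <= K) -> `|cnv (gauss h) v x| <= K.
Proof. by move=> h0 mv vK; rewrite -[K]mul1r; exact: (cnv_sup x (L1_gauss h0) mv vK). Qed.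

Lemma heat_L1 v B h : 0 < h -> L1 mu v B -> L1 mu (cnv (gauss h) v) B.
Proof. by move=> h0 hv; rewrite -[B]mul1r; exact: (cnv_L1 (L1_gauss h0) hv). Qed.

(* midpoint convexity of the energy along the heat flow, by self-adjointness of the semigroup *)
Lemma energy_mid v B K h : 0 < h -> L1 mu v B -> (forall y, `|v y| <= K) ->
  energy (cnv (gauss (h / 2)) v) <= (energy v + energy (cnv (gauss h) v)) / 2.
Proof.
move=> h0 hv vK; have hh : 0 < h / 2 by rewrite divr_gt0.
set w := cnv (gauss (h / 2)) v; set z := cnv (gauss h) v.
have hw : L1 mu w B by exact: heat_L1.
have hz : L1 mu z B by exact: heat_L1.
have zK x : `|z x| <= K by exact: heat_sup h0 hv.1 vK.
have wK x : `|w x| <= K by exact: heat_sup hh hv.1 vK.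
have E : RI mu (fun x => v x * z x) = energy w.
  transitivity (RI mu (fun x => v x * cnv (gauss (h / 2)) w x)).
    apply: eq_I => x; congr (_ * _); apply/esym/(etrans (heat_heat x hh hh hv)).
    by congr (cnv (gauss _) v x); lra.
  apply: etrans (cnv_pair hv.1 vK (L1_gauss hh) (fun z => gauss_sup z hh) hw) _.
  have kE : (fun z : V => gauss (h / 2) (- z)) = gauss (h / 2) by apply/funext => y; rewrite gaussN.
  by rewrite kE; apply: eq_I => x; rewrite expr2.
have i1 := L1_sqr hv vK; have i2 := L1_sqr hz zK.
have i3 := L1_mulb hv hz.1 zK.
clearbody w z; rewrite -E ler_pdivlMr// mulrC -(I_scale 2 i3) -(I_add i1 i2).
apply: (I_le (L1_scale 2 i3) (L1_add i1 i2)) => x.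
by have := sqr_ge0 (v x - z x); move: (v x) (z x) => p q; rewrite sqrrB -mulr_natl; lra.
Qed.

Lemma energyE v : energy v = RI mu (fun x => v x ^+ 2). Proof. by []. Qed.

Opaque energy RI.

Lemma dyadic_arith (X Y Z W : R) : Y <= X - W * (X - Z) -> (X + Y) / 2 <= X - W * 2^-1 * (X - Z).
Proof. by move=> h; lra. Qed.

Lemma frac_arith (c e : R) : 0 <= c -> 0 <= e -> c * (e / (c + 1)) <= e.
Proof.
move=> c0 e0; have c1 : 0 < c + 1 by lra.
rewrite mulrCA ler_piMr// ler_pdivrMr// mul1r; lra.
Qed.

Lemma step_arith (A B C D e y z : R) : A <= B + y -> B <= C - z * (C - D) -> y <= z * e -> z * D <= z * e ->
  A - 2 * e <= (1 - z) * (C - 2 * e).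
Proof. by move=> h1 h2 h3 h4; lra. Qed.

(** Midpoint convexity iterated towards time 0: over the short time T / 2^k the heat flow dissipates
    at least the fraction 2^{-k} of what it dissipates over T. No gradient norm enters. *)
Lemma energy_dyadic v B K T (k : nat) : 0 < T -> L1 mu v B -> (forall y, `|v y| <= K) ->
  energy (cnv (gauss (T / 2 ^+ k)) v) <= energy v - (2 ^+ k)^-1 * (energy v - energy (cnv (gauss T) v)).
Proof.
move=> T0 hv vK; elim: k => [|k IH]; first by rewrite expr0 divr1 invr1 mul1r subKr.
have p0 : 0 < 2 ^+ k :> R by rewrite exprn_gt0.
have h0 : 0 < T / 2 ^+ k by rewrite divr_gt0.
have E : T / 2 ^+ k.+1 = T / 2 ^+ k / 2 by rewrite exprSr invfM mulrA.
rewrite E; apply: le_trans (energy_mid h0 hv vK) _.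
rewrite exprSr invfM; apply: (dyadic_arith IH).
Qed.

(** The squared L^2 norm is at most the L^1 norm times the sup norm, and the latter is controlled by
    the L^1 norm of v. *)
Lemma energy_heat_decay v B K T : 0 < T -> L1 mu v B -> (forall y, `|v y| <= K) ->
  energy (cnv (gauss T) v) <= B * (T `^ (- (n%:R / 2)) * B).
Proof.
move=> T0 hv vK; rewrite energyE; apply: le_trans (ler_norm _) _; apply: L1_I.
by apply: L1_sqr; [exact: heat_L1|move=> x; exact: (cnv_sup2 x (measurable_gauss T) (fun z => gauss_sup z T0) hv)].
Qed.

End heat_energy.

(** * Energy inequality for the nonlinear equation *)

Section energy_decrease.
Context {R : realType} {n : nat}.
Notation V := 'rV[R]_n.
Notation mu := (rvm n).
Variables (a : V) (p : R) (u0 : V -> R) (U : R -> V -> R) (B0 N1 K : R).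
Hypothesis p1 : 1 < p.
Hypothesis hu0 : L1 mu u0 B0.
Hypothesis reg : regsol a p u0 U N1 K.
Implicit Types (x : V) (s t r h : R).

Let mU : jmeas U. Proof. by case: reg. Qed.
Let UL t : 0 < t -> L1 mu (U t) N1. Proof. by case: reg => _ h _ _; exact: h. Qed.
Let UK t x : 0 < t -> `|U t x| <= K. Proof. by case: reg => _ _ h _; exact: h. Qed.
Let K0 : 0 <= K. Proof. exact: le_trans (UK 0 ltr01). Qed.
Let N10 : 0 <= N1. Proof. exact: L1_ge0 (UL ltr01). Qed.

Let g s x := fnl p (U s x).
Let mg : jmeas g. Proof. exact: jmeas_fnl. Qed.
Let B1 : R := K `^ (p - 1) * N1.
Let B2 : R := K `^ (p - 1) * K.
Let gL s : 0 < s -> L1 mu (g s) B1.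
Proof. by move=> s0; apply: L1_fnl => // [|y]; [exact: UL|exact: UK]. Qed.
Let gs s x : 0 < s -> `|g s x| <= B2. Proof. by move=> s0; apply: fnl_bound => //; exact: UK. Qed.
Let B10 : 0 <= B1. Proof. exact: L1_ge0 (gL ltr01). Qed.
Let B20 : 0 <= B2. Proof. exact: le_trans (gs 0 ltr01). Qed.

Let restart t h x : 0 < t -> 0 < h -> U (t + h) x = cnv (gauss h) (U t) x + duh a (fun s => g (t + s)) h x.
Proof. exact: (regsol_restart x p1 hu0 reg). Qed.

(** Constants of [adheat_mild_sup] and [mild_heat_diff], and the Lipschitz constant of [fnl p] on
    [-K, K]. They are uniform in t > 1 because the equation is restarted at t - 1. *)
Let CL : R := cK a * K + cK a * cK a * B2 * 2 `^ (7 / 8) * 8.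
Let CD : R := @cG R n * N1 + 4 * cK a * @cG R n * B1 * 8.
Let Lf : R := p * K `^ (p - 1).

Let CL0 : 0 <= CL. Proof. by rewrite /CL; nonneg. Qed.
Let CD0 : 0 <= CD. Proof. by rewrite /CD; nonneg. Qed.
Let Lf0 : 0 <= Lf. Proof. rewrite /Lf mulr_ge0 ?powR_ge0//; exact: (ltW (lt_trans ltr01 p1)). Qed.

Let LU_sup t r x : 1 < t -> 0 < r -> r <= 1 -> `|cnv (K1 a r) (U t) x| <= CL * r `^ (- 8^-1).
Proof.
move=> t1 r0 r1; have tp : 0 < t - 1 by rewrite subr_gt0.
apply: (adheat_mild_sup (g := fun s => g (t - 1 + s)) x r0 r1 (UL tp) (fun y => UK y tp) (jmeas_shift (t - 1) mg)).
- by move=> s s0; apply: gL; rewrite addr_gt0.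
- by move=> s y s0; apply: gs; rewrite addr_gt0.
- by move=> y; rewrite -restart// subrK.
Qed.

Let U_heat t r : 1 < t -> 0 < r -> L1 mu (fun x => U t x - cnv (gauss r) (U t) x) (CD * r `^ (3 / 8)).
Proof.
move=> t1 r0; have tp : 0 < t - 1 by rewrite subr_gt0.
apply: (mild_heat_diff (g := fun s => g (t - 1 + s)) r0 (UL tp) (jmeas_shift (t - 1) mg)).
- by move=> s s0; apply: gL; rewrite addr_gt0.
- by move=> s y s0; apply: gs; rewrite addr_gt0.
- by move=> y; rewrite -restart// subrK.
Qed.

Let U_incr t r : 0 < t -> 0 < r -> L1 mu (fun x => U (t + r) x - cnv (gauss r) (U t) x) (2 * cK a * B1 * r `^ 2^-1).
Proof.
move=> t0 r0; have [h _] := duh_local a r0 B10 B20 (jmeas_shift t mg)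
  (fun s (sp : 0 < s) _ => gL (addr_gt0 t0 sp)) (fun s y (sp : 0 < s) _ => gs y (addr_gt0 t0 sp)).
by apply: eq_L1 h => x; rewrite restart// addrAC subrr add0r.
Qed.

Let CE : R := CL * Lf * (2 * CD + 2 * cK a * B1).
Let CE0 : 0 <= CE. Proof. by rewrite /CE; nonneg. Qed.

(** By oddness the gradient kernel moves onto U at the later time, giving Z. As Z is orthogonal to
    f(W), with W the same function smoothed over r, only f(W) - f(U (t + s)) is left: O(r^{3/8}) in
    L^1 against Z = O(r^{-1/8}). *)
Let pair_bound t s r : 1 < t -> 0 <= s -> 0 < r -> r <= 1 ->
  `|RI mu (fun x => U (t + s + r) x * cnv (K1 a r) (g (t + s)) x)| <= CE * r `^ 4^-1.
Proof.
move=> t1 s0 r0 r1; have ts1 : 1 < t + s by lra.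
have ts0 : 0 < t + s by lra.
have tsr1 : 1 < t + s + r by lra.
have tsr0 : 0 < t + s + r by lra.
set U' := U (t + s + r); set W := cnv (gauss r) U'; set Z := cnv (K1 a r) U'.
have hU' : L1 mu U' N1 by exact: UL.
have U'K x : `|U' x| <= K by exact: UK.
have WK x : `|W x| <= K by exact: heat_sup r0 hU'.1 U'K.
have hW : L1 mu W N1 by exact: heat_L1.
have hZ := cnv_L1 (L1_K1 a r0) hU'; rewrite -/Z in hZ.
have ZK x : `|Z x| <= CL * r `^ (- 8^-1) by exact: LU_sup.
have E1 : RI mu (fun x => U' x * cnv (K1 a r) (g (t + s)) x) = RI mu (fun x => - (Z x * g (t + s) x)).
  apply: etrans (cnv_pair hU'.1 U'K (L1_K1 a r0) (fun z => K1_sup a z r0) (gL ts0)) _.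
  apply: eq_I => x; rewrite -mulNr; congr (_ * _).
  rewrite /Z !cnvE -mulN1r -(I_scale (-1) (cnv_intg x (L1_K1 a r0) hU'.1 U'K)).
  by apply: eq_I => y; rewrite K1N mulN1r mulNr.
have mfW : measurable_fun setT (fun x => fnl p (W x)) by exact: (measurableT_comp (measurable_fnl p) hW.1).
have iZg := L1_opp (L1_mulb hZ (gL ts0).1 (fun x => gs x ts0)).
have iZf := L1_mulb hZ mfW (fun x => fnl_bound p1 (WK x)).
(* The vanishing integral of [adheat_fnl_orth] is added. *)
have E2 : RI mu (fun x => - (Z x * g (t + s) x)) = RI mu (fun x => (fnl p (W x) - g (t + s) x) * Z x).
  rewrite -[LHS]addr0 -(adheat_fnl_orth a p1 r0 hU' U'K) -(I_add iZg iZf).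
  by apply: eq_I => x; rewrite mulrBl addrC mulrC [g _ _ * _]mulrC.
rewrite E1 E2.
pose D x := U (t + s) x - W x.
(* From U (t + s) to W through three increments: heat flow at t + s, evolution over r, heat flow at
   t + s + r. *)
have hD : L1 mu D (CD * r `^ (3 / 8) + 2 * cK a * B1 * r `^ 2^-1 + CD * r `^ (3 / 8)).
  apply: eq_L1 (L1_add (L1_sub (U_heat ts1 r0) (U_incr ts0 r0)) (U_heat tsr1 r0)) => x.
  rewrite /D /W /U'; move: (U (t + s) x) (cnv _ _ x) (U _ x) (cnv _ _ x) => A B C E; ring.
have hF : L1 mu (fun x => fnl p (W x) - g (t + s) x) (Lf * ((2 * CD + 2 * cK a * B1) * r `^ (3 / 8))).
  apply: (L1_weak (A := `|Lf| * (CD * r `^ (3 / 8) + 2 * cK a * B1 * r `^ 2^-1 + CD * r `^ (3 / 8)))).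
    rewrite ger0_norm// ler_wpM2l//.
    have h : r `^ 2^-1 <= r `^ (3 / 8) by apply: ger_powR; [rewrite r0|lra].
    have c0 : 0 <= 2 * cK a * B1 by nonneg.
    by have := ler_wpM2l c0 h; lra.
  apply: (L1_le _ _ _ _ (L1_scale Lf (L1_abs hD))).
    by apply: measurable_funB => //; exact: jmeas_meas.
  move=> x; have := fnl_lip p1 (UK x ts0) (WK x); rewrite -/(g (t + s) x) => h.
  by apply: le_trans h _; rewrite /D [`|W x - _|]distrC.
apply: le_trans (L1_I (L1_mulb hF hZ.1 ZK)) _.
have -> : r `^ 4^-1 = r `^ (3 / 8) * r `^ (- 8^-1).
  by rewrite -powRD ?(gt_eqF r0) ?implybT//; congr (_ `^ _); lra.
by rewrite /CE le_eqVlt; apply/orP; left; apply/eqP; ring.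
Qed.

(* The exponent 5/4 > 1 makes the error negligible when summed over steps of length [h]. *)
Lemma energy_step t h : 1 < t -> 0 < h -> h <= 1 ->
  energy (U (t + h)) <= energy (cnv (gauss h) (U t)) + 2 * (CE * h `^ 4^-1 * h).
Proof.
move=> t1 h0 h1; have t0 : 0 < t by lra.
have th0 : 0 < t + h by lra.
set w := cnv (gauss h) (U t); set rr := duh a (fun s => g (t + s)) h.
have hw : L1 mu w N1 by exact: heat_L1 h0 (UL t0).
have wK x : `|w x| <= K by exact: heat_sup h0 (UL t0).1 (fun y => UK y t0).
have [hr _] := duh_local a h0 B10 B20 (jmeas_shift t mg)
  (fun s (sp : 0 < s) _ => gL (addr_gt0 t0 sp)) (fun s y (sp : 0 < s) _ => gs y (addr_gt0 t0 sp)).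
have i1 := L1_sqr (UL th0) (fun x => UK x th0).
have i2 := L1_sqr hw wK.
have i3 := L1_mulb hr (UL th0).1 (fun x => UK x th0).
(* With U = w + rr one has U^2 = w^2 + 2 rr U - rr^2, and the last term has the favourable sign. *)
have step : energy (U (t + h)) <= energy w + 2 * RI mu (fun x => rr x * U (t + h) x).
  rewrite !energyE -(I_scale 2 i3) -(I_add i2 (L1_scale 2 i3)).
  apply: (I_le i1 (L1_add i2 (L1_scale 2 i3))) => x.
  rewrite restart// -/w -/rr; have := sqr_ge0 (rr x).
  by move: (w x) (rr x) => A B; rewrite !expr2; lra.
apply: le_trans step _; rewrite lerD2l ler_wpM2l//.
have C1 : 0 <= cK a * B1 by rewrite mulr_ge0 ?cK_ge0.
have gL' s : 0 < s -> s < h -> L1 mu (g (t + s)) B1 by move=> s0 _; apply: gL; rewrite addr_gt0.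
have hB : L1 leb (tcut h (fun s => cK a * (h - s) `^ (- 2^-1) * B1)) (cK a * B1 * (2 * h `^ 2^-1)).
  by apply: eq_L1cut (L1_cut_scale (L1_cut_half h0) C1) => s _ _; ring.
have [E LE] := duh_pair (jmeas_shift t mg) gL' hB (UL th0).1 (fun x => UK x th0).
have -> : RI mu (fun x => rr x * U (t + h) x) = RI mu (fun x => U (t + h) x * rr x).
  by apply: eq_I => x; rewrite mulrC.
have -> := E; apply: le_trans (ler_norm _) _.
have C2 : 0 <= CE * h `^ 4^-1 by nonneg.
(* The constant is written with s^{1 - 1} to fit [L1_cut_powR] with c = 1. *)
have hc : L1 leb (tcut h (fun s => CE * h `^ 4^-1 * s `^ (1 - 1))) (CE * h `^ 4^-1 * (1^-1 * h `^ 1)).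
  by apply: L1_cut_scale => //; exact: L1_cut_powR.
rewrite powRr1 ?(ltW h0)// invr1 mul1r in hc.
apply: L1_I; apply: (L1_cut_le LE.1 _ hc) => s s0 sh.
have r0 : 0 < h - s by rewrite subr_gt0.
have r1 : h - s <= 1 by lra.
have := pair_bound t1 (ltW s0) r0 r1.
rewrite (_ : t + s + (h - s) = t + h); last by ring.
move=> hb; apply: le_trans hb _; rewrite subrr powRr0 mulr1 ler_wpM2l//.
by apply: ge0_ler_powR; rewrite ?nnegrE ?(ltW r0) ?(ltW h0)//; lra.
Qed.

(** Over a step h = T / 2^k the heat flow dissipates at least 2^{-k} (E - e) and the nonlinear error
    is at most 2^{-k} e, so E - 2 e contracts by the factor 1 - 2^{-k}. With e = eps / 3 a fixed
    number of steps suffices, whatever the starting time. *)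
Lemma energy_decay eps : (0 < n)%N -> 0 < eps -> exists2 T0, 0 < T0 & forall t, T0 < t -> energy (U t) <= eps.
Proof.
move=> n0 e0; pose e := eps / 3; have ep : 0 < e by rewrite /e; lra.
have m0 : 0 < n%:R / 2 :> R by rewrite divr_gt0// ltr0n.
(* Time after which the heat flow alone has energy at most e, by the L^1 bound N1. *)
pose T : R := ((N1 * N1 + 1) / e) `^ (n%:R / 2)^-1.
have q0 : 0 < (N1 * N1 + 1) / e by rewrite divr_gt0// ltr_wpDl// mulr_ge0.
have T0 : 0 < T by rewrite powR_gt0.
have TE : T `^ (- (n%:R / 2)) = e / (N1 * N1 + 1).
  by rewrite /T -powRrM mulrN mulVf ?gt_eqF// powR_inv1 ?(ltW q0)// invf_div.
have NT : N1 * (T `^ (- (n%:R / 2)) * N1) <= e.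
  rewrite TE (_ : N1 * _ = e * (N1 * N1 / (N1 * N1 + 1))); last by ring.
  rewrite ler_piMr ?(ltW ep)// ler_pdivrMr ?mul1r; first by rewrite lerDl.
  by rewrite ltr_wpDl// mulr_ge0.
(* About T / h steps are made in time T, so the accumulated error is of order h^{1/4} T; the
   exponent 4 in d inverts the power 1/4. *)
have [k [hk1 hk2]] : exists k : nat, T / 2 ^+ k <= 1 /\ 2 * CE * (T / 2 ^+ k) `^ 4^-1 * T <= e.
  pose d := Num.min 1 ((e / (2 * CE * T + 1)) `^ 4).
  have c1 : 0 < 2 * CE * T + 1 by apply: ltr_wpDl => //; nonneg.
  have d0 : 0 < d by rewrite lt_min ltr01 powR_gt0// divr_gt0.
  exists (Num.truncn (T / d)).
  have hT : T / 2 ^+ Num.truncn (T / d) <= d.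
    rewrite ler_pdivrMr ?exprn_gt0// mulrC -ler_pdivrMr//.
    apply: ltW; apply: lt_le_trans (truncnS_gt _) _.
    by rewrite -natrX ler_nat; exact: ltn_expl.
  split; first by apply: le_trans hT _; rewrite ge_min lexx.
  have h4 : (T / 2 ^+ Num.truncn (T / d)) `^ 4^-1 <= e / (2 * CE * T + 1).
    have -> : e / (2 * CE * T + 1) = ((e / (2 * CE * T + 1)) `^ 4) `^ 4^-1.
      by rewrite -powRrM mulfV// powRr1// divr_ge0// ltW.
    apply: ge0_ler_powR; rewrite ?nnegrE ?powR_ge0//.
      by rewrite divr_ge0 ?exprn_ge0// ltW.
    by apply: le_trans hT _; rewrite ge_min lexx orbT.
  have c0 : 0 <= 2 * CE * T by nonneg.
  rewrite mulrAC.
  apply: le_trans (ler_wpM2l c0 h4) _.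
  exact: frac_arith c0 (ltW ep).
set h := T / 2 ^+ k in hk1 hk2.
have p20 : 0 < 2 ^+ k :> R by rewrite exprn_gt0.
have h0 : 0 < h by rewrite divr_gt0.
pose th : R := 1 - (2 ^+ k)^-1.
have th0 : 0 <= th by rewrite subr_ge0 invf_le1// exprn_ege1//; lra.
have th1 : th < 1 by rewrite ltrBlDr ltrDl invr_gt0.
have step t : 1 < t -> energy (U (t + h)) - 2 * e <= th * (energy (U t) - 2 * e).
  move=> t1; have t0 : 0 < t by lra.
  have s1 := energy_step t1 h0 hk1.
  have s2 := energy_dyadic k T0 (UL t0) (fun y => UK y t0); rewrite -/h in s2.
  have s3 := energy_heat_decay T0 (UL t0) (fun y => UK y t0).
  have s4 : 2 * (CE * h `^ 4^-1 * h) <= (2 ^+ k)^-1 * e.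
    have -> : 2 * (CE * h `^ 4^-1 * h) = (2 ^+ k)^-1 * (2 * CE * h `^ 4^-1 * T).
      by move: (h `^ 4^-1) CE => H c; rewrite /h; ring.
    by apply: ler_wpM2l => //; rewrite invr_ge0 ltW.
  have i0 : 0 <= (2 ^+ k)^-1 :> R by rewrite invr_ge0 ltW.
  have s5 := ler_wpM2l i0 (le_trans s3 NT).
  exact: (step_arith s1 s2 s4 s5).
have iter m t : 1 < t -> energy (U (t + m%:R * h)) - 2 * e <= th ^+ m * (N1 * K).
  elim: m t => [|m IH] t t1.
    have t0 : 0 < t by lra.
    have hh := L1_I (L1_sqr (UL t0) (fun y => UK y t0)); rewrite -energyE in hh.
    rewrite mul0r addr0 mul1r; apply: le_trans (le_trans (ler_norm _) hh).
    by rewrite gerBl mulr_ge0// ltW.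
  have t1' : 1 < t + m%:R * h by rewrite ltr_wpDr// mulr_ge0// ltW.
  rewrite -natr1 mulrDl mul1r addrA; apply: le_trans (step _ t1') _.
  by rewrite exprS -mulrA ler_wpM2l//; exact: IH.
have [m hm] : exists m, th ^+ m * (N1 * K) <= e.
  have NK : 0 <= N1 * K by exact: mulr_ge0.
  have cv : th ^+ m @[m --> \oo] --> 0 by apply: cvg_expr; rewrite ger0_norm.
  have d0 : 0 < e / (N1 * K + 1) by rewrite divr_gt0// ltr_wpDl.
  move/cvgrPdist_lt : cv => /(_ _ d0)[m _ /(_ m (leqnn m))].
  rewrite sub0r normrN ger0_norm ?exprn_ge0// => hm; exists m.
  apply: le_trans (ler_wpM2r NK (ltW hm)) _.
  by rewrite mulrC; exact: frac_arith NK (ltW ep).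
exists (1 + m%:R * h); first by rewrite ltr_wpDr// mulr_ge0// ltW.
move=> t ht; have t1 : 1 < t - m%:R * h by lra.
have := iter m _ t1; rewrite subrK => hh.
have -> : eps = e + 2 * e by rewrite /e; field.
by rewrite -lerBlDr; exact: le_trans hh hm.
Qed.

End energy_decrease.

(** * Pointwise decay *)

Section arith.
Context {R : realType}.
Implicit Types (x y z q c d e : R).

Lemma amgm_arith d x : 0 < d -> `|x| <= d^-1 * x ^+ 2 + d.
Proof.
move=> d0; rewrite -(ler_pM2l d0) mulrDr mulrA mulfV ?gt_eqF// mul1r -(real_normK (num_real x)).
by have := sqr_ge0 (`|x| - d); move: (`|x|) => y; rewrite !expr2; nra.
Qed.

Lemma powR_invN x c : 0 <= x -> x^-1 `^ (- c) = x `^ c.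
Proof. by move=> x0; rewrite -(powR_inv1 x0) -powRrM mulN1r opprK. Qed.

Lemma geometric_bracket q y : 1 < q -> 1 <= y -> exists k : nat, q ^+ k <= y /\ y < q ^+ k.+1.
Proof.
move=> q1 y1.
have bern m : 1 + m%:R * (q - 1) <= q ^+ m.
  elim: m => [|m IH]; first by rewrite mul0r addr0.
  have qm : 1 <= q ^+ m by apply: exprn_ege1; exact: ltW.
  have q0 : 0 <= q - 1 by rewrite subr_ge0 ltW.
  rewrite exprS -natr1; have := ler_wpM2l q0 qm; lra.
have ex : exists m, y < q ^+ m.
  exists (Num.truncn (y / (q - 1))).+1; apply: lt_le_trans (bern _).
  have q0 : 0 < q - 1 by rewrite subr_gt0.
  have := truncnS_gt (y / (q - 1)); rewrite ltr_pdivrMr//; lra.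
case: (ex_minnP ex) => -[|k] hk mink; first by rewrite expr0 ltNge y1 in hk.
exists k; split=> //; rewrite leNgt; apply/negP => /mink; by rewrite ltnn.
Qed.

(** Halving the level F takes the time A F^{-1/m}. Along F0 2^{-k} these times grow like q^k with q
    = 2^{1/m}, so their sum is comparable to the last one: the level F is reached at a time of order
    F^{-1/m}, which is decay like t^{-m}. *)
Lemma bootstrap (m A F0 T0 : R) (Q : R -> R -> Prop) : 0 < m -> 0 < A -> 0 < F0 -> 0 < T0 ->
  (forall s t F, s <= t -> Q s F -> Q t F) ->
  (forall t F, 0 < t -> 0 < F -> F <= F0 -> Q t F -> Q (t + A * F `^ (- m^-1)) (F / 2)) ->
  Q T0 F0 -> exists C D, [/\ 0 < C, 0 <= D & forall t, C < t -> exists s F, [/\ s < t, Q s F & F <= D * t `^ (- m)]].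
Proof.
move=> m0 A0 F00 T00 Qle halve Q0.
pose q : R := 2 `^ m^-1.
have q1 : 1 < q by rewrite /q /powR gt_eqF// expR_gt1 mulr_gt0 ?invr_gt0// ln_gt0// ltr1n.
have q0 : 0 < q by exact: lt_trans ltr01 q1.
have q10 : 0 < q - 1 by rewrite subr_gt0.
pose D := A * F0 `^ (- m^-1).
have D0 : 0 < D by rewrite mulr_gt0 ?powR_gt0.
(* The k-th halving takes the time D q^k; this C gives C q^k + D q^k <= C q^{k+1}. *)
pose C := T0 + D / (q - 1).
have C0 : 0 < C by rewrite addr_gt0// divr_gt0.
have qk (k : nat) : (2 ^+ k)^-1 `^ (- m^-1) = q ^+ k.
  have p2 : 0 <= 2 ^+ k :> R by exact: exprn_ge0.
  rewrite (powR_invN _ p2) -(powR_mulrn k (powR_ge0 _ _)) -powRrM mulrC powRrM.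
  by rewrite powR_mulrn.
have iter (k : nat) : Q (C * q ^+ k) (F0 * (2 ^+ k)^-1).
  elim: k => [|k IH].
    rewrite !expr0 invr1 !mulr1; apply: Qle Q0.
    by rewrite /C lerDl divr_ge0 ?(ltW D0)// ltW.
  have p2 : 0 < (2 ^+ k)^-1 :> R by rewrite invr_gt0 exprn_gt0.
  have p21 : (2 ^+ k)^-1 <= 1 :> R by rewrite invf_le1 ?exprn_gt0// exprn_ege1// ler1n.
  have Fk0 : 0 < F0 * (2 ^+ k)^-1 by rewrite mulr_gt0.
  have Ck0 : 0 < C * q ^+ k by rewrite mulr_gt0// exprn_gt0.
  have FkF : F0 * (2 ^+ k)^-1 <= F0 by rewrite ler_piMr// ltW.
  have := halve _ _ Ck0 Fk0 FkF IH.
  rewrite -mulrA -invfM -exprSr; apply: Qle.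
  rewrite powRM ?(ltW F00) ?(ltW p2)// qk mulrA -/D -mulrDl [q ^+ k.+1]exprS mulrA.
  rewrite ler_pM2r ?exprn_gt0// -lerBrDl -[X in _ - X]mulr1 -mulrBr -ler_pdivrMr//.
  by rewrite /C lerDr ltW.
exists C, (F0 * (C * q) `^ m); split=> //; first by rewrite mulr_ge0 ?powR_ge0// ltW.
move=> t tC; have t0 := lt_trans C0 tC.
have y1 : 1 < t / C by rewrite ltr_pdivlMr// mul1r.
have y0 : 0 < t / C by exact: lt_trans ltr01 y1.
(* Strict on the left, because the conclusion asks for s < t. *)
have [k [k1 k2]] : exists k : nat, q ^+ k < t / C /\ t / C <= q ^+ k.+1.
  have [k [k1 k2]] := geometric_bracket q1 (ltW y1).
  have [E|NE] := eqVneq (q ^+ k) (t / C); last by exists k; rewrite lt_def eq_sym NE k1 ltW.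
  case: k k1 k2 E => [|k] k1 k2 E; first by rewrite -E ltxx in y1.
  exists k; rewrite -E lexx; split=> //.
  by rewrite exprS ltr_pMl ?exprn_gt0.
exists (C * q ^+ k), (F0 * (2 ^+ k)^-1); split=> //; first by rewrite mulrC -ltr_pdivlMr.
rewrite -mulrA ler_wpM2l ?(ltW F00)//.
have -> : (2 ^+ k)^-1 = (q ^+ k) `^ (- m) :> R.
  rewrite /q -(powR_mulrn k (powR_ge0 2 m^-1)) -!powRrM (_ : m^-1 * (k%:R * - m) = - k%:R).
    by rewrite powRN powR_mulrn.
  by field; rewrite gt_eqF.
have qt : t / (C * q) <= q ^+ k by rewrite invfM mulrA ler_pdivrMr// -exprSr.
have Cq0 : 0 < C * q by rewrite mulr_gt0.
have tq0 : 0 < t / (C * q) by rewrite divr_gt0.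
apply: le_trans (ler_powRN (ltW m0) tq0 qt) _.
have iC : 0 <= (C * q)^-1 by rewrite invr_ge0 ltW.
by rewrite (powRM _ (ltW t0) iC) mulrC powR_invN// ltW.
Qed.

End arith.

Section decay.
Context {R : realType} {n : nat}.
Notation V := 'rV[R]_n.
Notation mu := (rvm n).
Implicit Types (x : V) (s t r h : R).

(** Pointwise |v| <= v^2/d + d. The first term is smoothed from L^1 to sup, its integral being the
    energy; the constant d passes through the kernel unchanged. *)
Lemma heat_energy_sup (v : V -> R) B K d h x : 0 < d -> 0 < h -> L1 mu v B -> (forall y, `|v y| <= K) ->
  `|cnv (gauss h) v x| <= h `^ (- (n%:R / 2)) * (d^-1 * energy v) + d.
Proof.
move=> d0 h0 hv vK; have hs := L1_sqr hv vK.
have hE : L1 mu (fun y => v y ^+ 2) (energy v).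
  suff E : RI mu (fun y => `|v y ^+ 2|) = energy v by rewrite -E; exact: (L1_intI (L1_Itg hs)).
  by rewrite energyE; apply: eq_I => y; rewrite ger0_norm ?sqr_ge0.
have hE' := L1_scale d^-1 hE; rewrite gtr0_norm ?invr_gt0// in hE'.
have i1 := cnv_intg2 x (measurable_gauss h) (fun z => gauss_sup z h0) hE'.
have i2 : L1 mu (fun y => gauss h (x - y) * d) (1 * d).
  apply: (cnv_intg (g := fun=> d) x (L1_gauss h0)) => // y; first by rewrite gtr0_norm.
have i3 := cnv_intg2 x (measurable_gauss h) (fun z => gauss_sup z h0) hv.
rewrite cnvE -[X in _ <= _ + X]mul1r; apply: L1_I.
apply: (L1_le _ _ i3.1 _ (L1_add i1 i2)) => y.
rewrite -mulrDr normrM (ger0_norm (gauss_ge0 _ _)); apply: ler_wpM2l; first exact: gauss_ge0.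
exact: amgm_arith.
Qed.

Variables (a : V) (p : R) (u0 : V -> R) (U : R -> V -> R) (B0 N1 K : R).
Hypothesis n0 : (0 < n)%N.
Hypothesis p1 : 1 + n%:R^-1 < p.
Hypothesis hu0 : L1 mu u0 B0.
Hypothesis reg : regsol a p u0 U N1 K.

Let p1' : 1 < p.
Proof. by apply: lt_trans p1; rewrite ltrDl invr_gt0 ltr0n. Qed.
Let mU : jmeas U. Proof. by case: reg. Qed.
Let UL t : 0 < t -> L1 mu (U t) N1. Proof. by case: reg => _ h _ _; exact: h. Qed.
Let UK t x : 0 < t -> `|U t x| <= K. Proof. by case: reg => _ _ h _; exact: h. Qed.
Let K0 : 0 <= K. Proof. exact: le_trans (UK 0 ltr01). Qed.
Let N10 : 0 <= N1. Proof. exact: L1_ge0 (UL ltr01). Qed.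
Let nR : 0 < n%:R :> R. Proof. by rewrite ltr0n. Qed.

(** The bound F enters at the power p; this superlinearity drives the bootstrap. *)
Let short t r F : 0 < t -> 0 < r -> (forall s x, t < s -> `|U s x| <= F) ->
  (forall x, `|U (t + r) x - cnv (gauss r) (U t) x| <= 2 * cK a * (F `^ (p - 1) * F) * r `^ 2^-1).
Proof.
move=> t0 r0 UF; have F0 : 0 <= F by apply: le_trans (UF (t + 1) 0 _); rewrite ?normr_ge0// ltrDl.
have B10 : 0 <= K `^ (p - 1) * N1 by nonneg.
have B20 : 0 <= F `^ (p - 1) * F by nonneg.
have gL s : 0 < s -> s < r -> L1 mu (fun y => fnl p (U (t + s) y)) (K `^ (p - 1) * N1).
  by move=> s0 _; have ts := addr_gt0 t0 s0; apply: L1_fnl => // [|y]; [exact: UL|exact: UK].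
have gs s y : 0 < s -> s < r -> `|fnl p (U (t + s) y)| <= F `^ (p - 1) * F.
  by move=> s0 _; apply: fnl_bound => //; apply: UF; rewrite ltrDl.
have [_ h] := duh_local a r0 B10 B20 (jmeas_shift t (jmeas_fnl p mU)) gL gs.
move=> x; rewrite (regsol_restart x p1' hu0 reg t0 r0) addrAC subrr add0r; exact: h.
Qed.

(** The window h is fixed by making the Duhamel part at most e. Once the energy is below e^2
    h^{n/2}, [heat_energy_sup] with d = e bounds the heat part by 2 e. *)
Lemma sup_decay d : 0 < d -> exists2 T0, 0 < T0 & forall t x, T0 < t -> `|U t x| <= d.
Proof.
move=> d0; pose e := d / 3; have e0 : 0 < e by rewrite divr_gt0.
pose c := 2 * cK a * (K `^ (p - 1) * K); have c0 : 0 <= c by rewrite /c; nonneg.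
have c1 : 0 < c + 1 by rewrite ltr_wpDl.
pose h := (e / (c + 1)) ^+ 2.
have ec0 : 0 < e / (c + 1) by rewrite divr_gt0.
have h0 : 0 < h by rewrite exprn_gt0.
have hs : h `^ 2^-1 = e / (c + 1) by rewrite powR12_sqrt ?(ltW h0)// sqrtr_sqr gtr0_norm.
have E0 : 0 < e * (e * h `^ (n%:R / 2)) by rewrite !mulr_gt0 ?powR_gt0.
have [T0 T00 HT] := energy_decay p1' hu0 reg n0 E0.
exists (T0 + h); first by rewrite addr_gt0.
move=> t x ht; have th : T0 < t - h by rewrite ltrBrDr.
have th0 := lt_trans T00 th.
have s1 := short th0 h0 (fun s y (hs : t - h < s) => UK y (lt_trans th0 hs)) x.
rewrite subrK in s1.
have s2 := heat_energy_sup x e0 h0 (UL th0) (fun y => UK y th0).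
have s3 := HT _ th.
have s4 : 2 * cK a * (K `^ (p - 1) * K) * h `^ 2^-1 <= e by rewrite hs; exact: frac_arith c0 (ltW e0).
have s5 : h `^ (- (n%:R / 2)) * (e^-1 * energy (U (t - h))) <= e.
  rewrite powRN mulrA mulrC -ler_pdivlMr; last by rewrite mulr_gt0 ?invr_gt0 ?powR_gt0.
  by apply: le_trans s3 _; rewrite invfM !invrK mulrCA [h `^ _ * e]mulrC.
rewrite -(subrK (cnv (gauss h) (U (t - h)) x) (U t x)).
apply: le_trans (ler_normD _ _) _; rewrite (_ : d = e + (e + e)); last by rewrite /e; field.
apply: lerD; first exact: le_trans s1 s4.
by apply: le_trans s2 _; rewrite lerD2r.
Qed.

Let Q t F := forall s x, t < s -> `|U s x| <= F.

(** Makes r = A F^{-2/n} satisfy r^{-n/2} (N1 + 1) = F / 4. *)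
Let A : R := (4 * (N1 + 1)) `^ (2 / n%:R).
Let N4 : 0 < 4 * (N1 + 1). Proof. by rewrite mulr_gt0// ltr_wpDl. Qed.
Let A0 : 0 < A. Proof. by rewrite powR_gt0. Qed.
(** With r of order F^{-2/n} the Duhamel term F^p r^{1/2} is of order F^{1 + gam}; gam > 0 is the
    hypothesis p > 1 + 1/n. *)
Let gam : R := p - 1 - n%:R^-1.
Let gam0 : 0 < gam. Proof. by rewrite /gam subr_gt0 ltrBrDl. Qed.

(* Restart the equation [A F^{-2/n}] before the current time: the L^1 bound makes the heat part at
   most [F / 4]. *)
Let halve t F : 0 < t -> 0 < F -> 2 * cK a * A `^ 2^-1 * F `^ gam <= 4^-1 -> Q t F -> Q (t + A * F `^ (- (2 / n%:R))) (F / 2).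
Proof.
move=> t0 F0 hF QF s x hs; set r := A * _ in hs.
have r0 : 0 < r by rewrite mulr_gt0// powR_gt0.
have sr : t < s - r by rewrite ltrBrDr.
have sr0 := lt_trans t0 sr.
have s1 := short sr0 r0 (fun s' y (h' : s - r < s') => QF s' y (lt_trans sr h')) x.
rewrite subrK in s1.
have s2 := cnv_sup2 x (measurable_gauss r) (fun z => gauss_sup z r0) (UL sr0).
have rn : r `^ (- (n%:R / 2)) = F / (4 * (N1 + 1)).
  rewrite /r powRM ?powR_ge0 ?(ltW A0)// -!powRrM.
  rewrite (_ : - (2 / n%:R) * - (n%:R / 2) = 1); last by field; rewrite gt_eqF.
  rewrite (_ : 2 / n%:R * - (n%:R / 2) = -1); last by field; rewrite gt_eqF.
  by rewrite powRr1 ?(ltW F0)// powR_inv1 ?(ltW N4)// mulrC.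
have rh : r `^ 2^-1 = A `^ 2^-1 * F `^ (- n%:R^-1).
  rewrite /r powRM ?powR_ge0 ?(ltW A0)// -[(F `^ _) `^ _]powRrM; congr (_ * _ `^ _).
  by field; rewrite gt_eqF.
have s3 : 2 * cK a * (F `^ (p - 1) * F) * r `^ 2^-1 <= F / 4.
  rewrite rh; have E : F `^ gam = F `^ (p - 1) * F `^ (- n%:R^-1).
    by rewrite -powRD ?(gt_eqF F0) ?implybT.
  have := ler_wpM2l (ltW F0) hF; rewrite E; apply: le_trans.
  by rewrite le_eqVlt; apply/orP; left; apply/eqP; ring.
have s4 : r `^ (- (n%:R / 2)) * N1 <= F / 4.
  rewrite rn invfM mulrC !mulrA; rewrite (_ : N1 * F / 4 / (N1 + 1) = N1 * (F / 4 / (N1 + 1))); last by ring.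
  by apply: frac_arith => //; rewrite divr_ge0// ltW.
rewrite -(subrK (cnv (gauss r) (U (s - r)) x) (U s x)).
apply: le_trans (ler_normD _ _) _; rewrite (_ : F / 2 = F / 4 + F / 4); last by field.
by apply: lerD; [exact: le_trans s1 s3|exact: le_trans s2 s4].
Qed.

Lemma pointwise_decay : exists2 C, 0 <= C & forall t x, 0 < t -> `|U t x| <= C * t `^ (- (n%:R / 2)).
Proof.
pose c := 2 * cK a * A `^ 2^-1; have c0 : 0 <= c by rewrite /c; nonneg.
(* Below this level the Duhamel term in [halve] is at most F / 4. *)
pose F0 := (4^-1 / (c + 1)) `^ gam^-1.
have z0 : 0 < 4^-1 / (c + 1) by rewrite divr_gt0 ?invr_gt0// ltr_wpDl.
have F00 : 0 < F0 by rewrite powR_gt0.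
have Fg : c * F0 `^ gam <= 4^-1.
  rewrite /F0 -powRrM mulVf ?gt_eqF// powRr1 ?(ltW z0)//.
  by apply: frac_arith => //; rewrite invr_ge0.
have [T0 T00 HT] := sup_decay F00.
have m0 : 0 < n%:R / 2 :> R by rewrite divr_gt0.
have [] := @bootstrap R (n%:R / 2) A F0 T0 Q m0 A0 F00 T00 _ _ (fun s x => HT s x).
- by move=> s t F st h r x tr; apply: h; exact: le_lt_trans tr.
- move=> t F t0 F0' FF; rewrite invf_div; apply: halve => //.
  apply: le_trans Fg; apply: ler_wpM2l; first exact: c0.
  by apply: ge0_ler_powR; rewrite ?nnegrE ?(ltW gam0) ?(ltW F0') ?(ltW F00).
move=> C [D [C0 D0 HC]].
exists (D + K * C `^ (n%:R / 2)).
  by rewrite addr_ge0// mulr_ge0 ?powR_ge0.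
move=> t x t0; rewrite mulrDl.
have [tC|tC] := leP t C.
  apply: ler_wpDl; first by rewrite mulr_ge0 ?powR_ge0.
  apply: le_trans (UK x t0) _; rewrite -mulrA ler_peMr// powRN.
  by rewrite ler_pdivlMr ?powR_gt0// mul1r; apply: ge0_ler_powR; rewrite ?nnegrE ?(ltW t0) ?(ltW C0) ?(ltW m0).
apply: ler_wpDr; first by rewrite !mulr_ge0 ?powR_ge0.
have [s [F [st QF FD]]] := HC t tC.
by apply: le_trans FD; exact: QF.
Qed.

End decay.

(** * Asymptotic expansion *)

Section scaled_bounds.
Context {R : realType} {n : nat}.
Notation V := 'rV[R]_n.
Notation mu := (rvm n).
Variable p : R.
Implicit Types (x : V) (t r A B C : R) (v w : V -> R).

(* The size of [G_t]; by interpolation it bounds [|w|_q] by [r t^{-(n/2)(1-1/q)}] for all [q]. *)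
Definition scaled t r w := L1 mu w r /\ forall x, `|w x| <= r * t `^ (- (n%:R / 2)).

Lemma scaled_meas t r w : scaled t r w -> measurable_fun setT w.
Proof. by case=> -[]. Qed.

Lemma scaled_ge0 t r w : scaled t r w -> 0 <= r.
Proof. by case=> h _; exact: L1_ge0 h. Qed.

Lemma scaled_le t r r' w : r <= r' -> scaled t r w -> scaled t r' w.
Proof.
move=> rr [h1 h2]; split; first exact: L1_weak h1.
by move=> x; apply: le_trans (h2 x) _; rewrite ler_wpM2r ?powR_ge0.
Qed.

Lemma eq_sb t r v w : v =1 w -> scaled t r v -> scaled t r w.
Proof. by move=> /funext ->. Qed.

Lemma scaled_add t r r' v w : scaled t r v -> scaled t r' w -> scaled t (r + r') (fun x => v x + w x).
Proof.
move=> [h1 h2] [h3 h4]; split; first exact: L1_add.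
by move=> x; apply: le_trans (ler_normD _ _) _; rewrite mulrDl lerD.
Qed.

Lemma scaled_sub t r r' v w : scaled t r v -> scaled t r' w -> scaled t (r + r') (fun x => v x - w x).
Proof.
move=> [h1 h2] [h3 h4]; split; first exact: L1_sub.
by move=> x; apply: le_trans (ler_normB _ _) _; rewrite mulrDl lerD.
Qed.

Lemma scaled_scale t r c w : scaled t r w -> scaled t (`|c| * r) (fun x => c * w x).
Proof.
move=> [h1 h2]; split; first exact: L1_scale.
by move=> x; rewrite normrM -mulrA ler_wpM2l.
Qed.

Lemma scaled_dom t r v w C : measurable_fun setT v -> (forall x, `|v x| <= C * `|w x|) -> 0 <= C ->
  scaled t r w -> scaled t (C * r) v.
Proof.
move=> mv vw C0 [h1 h2]; split.
  have := L1_scale C (L1_abs h1); rewrite (ger0_norm C0).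
  exact: (L1_le _ _ mv vw).
move=> x; apply: le_trans (vw x) _; rewrite -mulrA; apply: ler_wpM2l => //; exact: h2.
Qed.

Lemma powR_interp t al be ga : 0 < t -> al <= ga -> ga <= be ->
  t `^ (- al) <= t `^ (- ga) \/ t `^ (- be) <= t `^ (- ga).
Proof.
move=> t0 h1 h2; have [t1|t1] := leP 1 t.
  by right; rewrite ler_powR// lerN2.
by left; apply: ger_powR; rewrite ?lerN2// t0 ltW.
Qed.

(** The exponent be is used for t >= 1 and al for t < 1. An intermediate exponent is thus available
    at all times, small enough for integrability at 0 and large enough for decay. *)
Lemma scaled_interp t C al be ga w : 0 < t -> 0 <= C -> al <= ga -> ga <= be ->
  scaled t (C * t `^ (- al)) w -> scaled t (C * t `^ (- be)) w -> scaled t (C * t `^ (- ga)) w.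
Proof.
move=> t0 C0 h1 h2 s1 s2; have [h|h] := powR_interp t0 h1 h2.
  by apply: scaled_le s1; rewrite ler_wpM2l.
by apply: scaled_le s2; rewrite ler_wpM2l.
Qed.

Lemma scaled_gauss t : 0 < t -> scaled t 1 (gauss t).
Proof.
move=> t0; split; first exact: L1_gauss.
by move=> x; rewrite mul1r; exact: gauss_sup.
Qed.

Let g0 : R := n%:R / 2 * (p - 1).
Let kap : R := (p - 1) / 2.
Hypothesis p1 : 1 < p.

Let pow_sup t B c : 0 < t -> 0 <= B -> (B * t `^ (- (n%:R / 2))) `^ c = B `^ c * t `^ (- (n%:R / 2 * c)).
Proof. by move=> t0 B0; rewrite powRM ?powR_ge0// -powRrM mulNr. Qed.

(** In |f(w)| = |w|^{p-1} |w| the pointwise bound on the first factor contributes t^{-g0}. *)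
Lemma scaled_fnl t B w : 0 < t -> scaled t B w -> scaled t (B `^ (p - 1) * B * t `^ (- g0)) (fun x => fnl p (w x)).
Proof.
move=> t0 hw; have B0 := scaled_ge0 hw.
have E : B `^ (p - 1) * B * t `^ (- g0) = (B * t `^ (- (n%:R / 2))) `^ (p - 1) * B.
  by rewrite pow_sup// mulrAC.
rewrite E; apply: (scaled_dom _ _ (powR_ge0 _ _) hw).
  by apply: (measurableT_comp (measurable_fnl p)); exact: scaled_meas hw.
move=> x; rewrite norm_fnl; apply: ler_wpM2r => //.
have := hw.2 x; apply: ge0_ler_powR; rewrite ?nnegrE ?subr_ge0 ?mulr_ge0 ?powR_ge0//.
by exact: ltW.
Qed.

Lemma scaled_fnl_diff t B r v w : 0 < t -> scaled t B v -> scaled t B w -> scaled t r (fun x => v x - w x) ->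
  scaled t (p * B `^ (p - 1) * t `^ (- g0) * r) (fun x => fnl p (v x) - fnl p (w x)).
Proof.
move=> t0 hv hw hr; have B0 := scaled_ge0 hw.
have p0 : 0 <= p by exact: (ltW (lt_trans ltr01 p1)).
rewrite -(mulrA p) -pow_sup//; apply: (scaled_dom _ _ (mulr_ge0 p0 (powR_ge0 _ _)) hr).
  by apply: measurable_funB; apply: (measurableT_comp (measurable_fnl p)); [exact: scaled_meas hv|exact: scaled_meas hw].
by move=> x; apply: fnl_lip => //; [exact: hw.2|exact: hv.2].
Qed.

Lemma measurable_dfnl : measurable_fun setT (fun z : R => derive1 (fnl p) z).
Proof.
rewrite (_ : (fun z => _) = fun z : R => p * `|z| `^ (p - 1)).
  apply: measurable_funM => //.
  exact: (measurableT_comp (measurable_powR (p - 1)) (@normr_measurable R setT)).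
by apply/funext => z; rewrite derive1_fnl.
Qed.

Lemma dfnl_bound K (z : R) : `|z| <= K -> `|derive1 (fnl p) z| <= p * K `^ (p - 1).
Proof.
move=> zK; have p0 : 0 <= p by exact: (ltW (lt_trans ltr01 p1)).
rewrite derive1_fnl// ger0_norm ?mulr_ge0 ?powR_ge0//; apply: ler_wpM2l => //.
by apply: ge0_ler_powR; rewrite ?nnegrE ?subr_ge0 ?(ltW p1)// (le_trans _ zK).
Qed.

Lemma scaled_dfnl t B r v w : 0 < t -> scaled t B v -> scaled t r w ->
  scaled t (p * B `^ (p - 1) * t `^ (- g0) * r) (fun x => w x * derive1 (fnl p) (v x)).
Proof.
move=> t0 hv hr; have B0 := scaled_ge0 hv.
have p0 : 0 <= p by exact: (ltW (lt_trans ltr01 p1)).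
rewrite -(mulrA p) -pow_sup//; apply: (scaled_dom _ _ (mulr_ge0 p0 (powR_ge0 _ _)) hr).
  apply: measurable_funM; first exact: scaled_meas hr.
  by apply: (measurableT_comp measurable_dfnl); exact: scaled_meas hv.
by move=> x; rewrite normrM mulrC ler_wpM2r// dfnl_bound//; exact: hv.2.
Qed.

(** Half of the decay t^{-g0} comes from the size of the functions and half from their difference,
    each at the power kap. *)
Lemma scaled_taylor t B r v w : p <= 3 -> 0 < t -> scaled t B v -> scaled t B w -> scaled t r (fun x => v x - w x) ->
  scaled t (2 * p * B `^ kap * r `^ kap * t `^ (- g0) * r)
    (fun x => fnl p (v x) - fnl p (w x) - derive1 (fnl p) (w x) * (v x - w x)).
Proof.
move=> p3 t0 hv hw hr; have B0 := scaled_ge0 hw; have r0 := scaled_ge0 hr.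
have p0 : 0 <= p by exact: (ltW (lt_trans ltr01 p1)).
have k0 : 0 <= kap by rewrite divr_ge0// subr_ge0 ltW.
have E : 2 * p * B `^ kap * r `^ kap * t `^ (- g0) =
    2 * p * ((B * t `^ (- (n%:R / 2))) `^ kap * (r * t `^ (- (n%:R / 2))) `^ kap).
  rewrite !pow_sup// [X in _ = _ * X]mulrACA -powRD ?(gt_eqF t0) ?implybT// (_ : - (n%:R / 2 * kap) + - (n%:R / 2 * kap) = - g0).
    by rewrite !mulrA.
  by rewrite /g0 /kap; field.
rewrite E; apply: (scaled_dom _ _ _ hr).
- apply: measurable_funB.
    by apply: measurable_funB; apply: (measurableT_comp (measurable_fnl p)); [exact: scaled_meas hv|exact: scaled_meas hw].
  apply: measurable_funM; last exact: scaled_meas hr.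
  by apply: (measurableT_comp measurable_dfnl); exact: scaled_meas hw.
- move=> x; apply: le_trans (fnl_taylor p1 p3 (hw.2 x) (hv.2 x)) _.
  rewrite -/kap -!mulrA; do 3 (apply: ler_wpM2l; rewrite ?powR_ge0//).
  apply: ler_wpM2r => //; have := hr.2 x; apply: ge0_ler_powR; rewrite ?nnegrE//.
  by rewrite mulr_ge0 ?powR_ge0.
- by rewrite mulr_ge0 ?mulr_ge0 ?powR_ge0.
Qed.

Lemma scaled_S (a : V) c C (g : R -> V -> R) t : 0 <= c -> c < 1 -> 0 <= C -> 0 < t -> jmeas g ->
  (forall s, 0 < s -> s < t -> scaled s (C * s `^ (- c)) (g s)) ->
  scaled t (cS a c * C * t `^ (2^-1 - c)) (duh a g t).
Proof.
move=> c0 c1 C0 t0 mg hg.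
apply: (duh_scaled a c0 c1 C0 t0 mg) => [s s0 st|s x s0 st]; first exact: (hg s s0 st).1.
exact: (hg s s0 st).2.
Qed.

Lemma scaled_tcut (a : V) c C (g : R -> V -> R) t x : 0 <= c -> c < 1 -> 0 <= C -> 0 < t -> jmeas g ->
  (forall s, 0 < s -> s < t -> scaled s (C * s `^ (- c)) (g s)) ->
  L1 leb (tcut t (fun s => cnv (K1 a (t - s)) (g s) x)) (cS a c * C * t `^ (2^-1 - c) * t `^ (- (n%:R / 2))).
Proof.
move=> c0 c1 C0 t0 mg hg.
have [||_ h] := duh_scaled_sup a x c0 c1 C0 t0 mg.
- by move=> s s0 st; exact: (hg s s0 st).1.
- by move=> s y s0 st; exact: (hg s s0 st).2.
- exact: h.
Qed.

End scaled_bounds.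

(** * First moments and the heat flow *)

Section moment.
Context {R : realType} {n : nat}.
Notation V := 'rV[R]_n.
Notation mu := (rvm n).
Implicit Types (x y z : V) (t r A B C : R) (v w : V -> R).

Lemma sh_arith1 (c nu : R) : 1 <= c -> 1 <= nu -> 1 + 1 <= (4 * c + 1) * nu.
Proof. by move=> h1 h2; nra. Qed.

Lemma sh_arith2 (c nu : R) : 1 <= c -> 0 <= nu -> nu <= 1 ->
  2 * c * nu + nu ^+ 2 / 4 + (2 * c * nu + nu ^+ 2 / 4) <= (4 * c + 1) * nu.
Proof. by move=> h1 h2 h3; rewrite expr2; have := ler_wpM2l h2 h3; lra. Qed.

Lemma expRN_dist (s r : R) : `|expR (- s) - expR (- r)| <= `|s - r| * (expR (- s) + expR (- r)).
Proof.
have key (u v : R) : u <= v -> 0 <= expR (- u) - expR (- v) <= (v - u) * expR (- u).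
  move=> uv; rewrite subr_ge0 ler_expR lerN2 uv /=.
  have -> : expR (- v) = expR (- u) * expR (- (v - u)) by rewrite -expRD; congr expR; ring.
  have := expR_ge1Dx (- (v - u)); have := expR_ge0 (- u); move: (expR (- u)) (expR _) => e f e0 h.
  by have := ler_wpM2l e0 h; lra.
have [sr|/ltW rs] := leP s r.
  have /andP[h1 h2] := key s r sr.
  rewrite ger0_norm// ler0_norm ?subr_le0// opprB mulrDr; apply: ler_wpDr => //.
  by rewrite mulr_ge0 ?subr_ge0 ?expR_ge0.
have /andP[h1 h2] := key r s rs.
rewrite -opprB normrN ger0_norm// ger0_norm ?subr_ge0// mulrDr; apply: ler_wpDl => //.
by rewrite mulr_ge0 ?subr_ge0 ?expR_ge0.
Qed.

Lemma sqnorm_nrm1 y : sqnorm y <= l1norm y ^+ 2.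
Proof.
have h := dotv_le y y; rewrite dotvv ger0_norm ?sqnorm_ge0// in h.
have := sqrtr_ge0 (sqnorm y); move: (sqr_sqrtr (sqnorm_ge0 y)) h.
move: (Num.sqrt _) => s E; rewrite -E => h s0.
have [->|sn] := eqVneq s 0; first by rewrite expr2 mul0r sqr_ge0.
move: h; rewrite expr2 ler_pM2r; last by rewrite lt_def sn.
by move=> h; rewrite expr2; apply: ler_pM.
Qed.

Lemma K1_norm y t z : 0 < t -> `|K1 y t z| = `|dotv y z| / (2 * t) * gauss t z.
Proof.
move=> t0.
have i0 : 0 <= (2 * t)^-1 by rewrite invr_ge0 mulr_ge0// ltW.
by rewrite K1E normrM (ger0_norm (gauss_ge0 _ _)) normrM normrN (ger0_norm i0).
Qed.

(** The difference of the exponents is expanded around x - y and around x, so that each of the two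
    exponentials meets its own linear factor and forms |K1 y t| at its point. *)
Lemma gauss_shift t y x : 0 < t -> `|gauss t (x - y) - gauss t x| <=
  `|K1 y t (x - y)| + sqnorm y / (4 * t) * gauss t (x - y) + (`|K1 y t x| + sqnorm y / (4 * t) * gauss t x).
Proof.
move=> t0; have t4 : 0 < 4 * t by rewrite mulr_gt0.
rewrite !K1_norm// -!mulrDl !gaussE.
set A := sqnorm (x - y) / (4 * t); set B := sqnorm x / (4 * t); set c := _ `^ _.
have c0 : 0 <= c by exact: powR_ge0.
have e1 : sqnorm (x - y) = sqnorm x - 2 * dotv y x + sqnorm y.
  by have := sqnormD y x (-1); rewrite scaleN1r => ->; ring.
have e2 : sqnorm (x - y) = sqnorm x - 2 * dotv y (x - y) - sqnorm y.
  by rewrite dotvD dotvN dotvv e1; ring.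
have y0 := sqnorm_ge0 y.
have b1 : `|A - B| <= `|dotv y x| / (2 * t) + sqnorm y / (4 * t).
  rewrite -mulrBl normrM (ger0_norm (_ : 0 <= (4 * t)^-1)) ?invr_ge0 ?(ltW t4)//.
  rewrite (_ : `|dotv y x| / (2 * t) = 2 * `|dotv y x| / (4 * t)); last by field; rewrite gt_eqF.
  rewrite -mulrDl ler_wpM2r ?invr_ge0 ?(ltW t4)// e1.
  rewrite (_ : _ - sqnorm x = sqnorm y - 2 * dotv y x); last by ring.
  apply: le_trans (ler_normB _ _) _.
  by rewrite (ger0_norm y0) normrM ger0_norm// addrC.
have b2 : `|A - B| <= `|dotv y (x - y)| / (2 * t) + sqnorm y / (4 * t).
  rewrite -mulrBl normrM (ger0_norm (_ : 0 <= (4 * t)^-1)) ?invr_ge0 ?(ltW t4)//.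
  rewrite (_ : `|dotv y (x - y)| / (2 * t) = 2 * `|dotv y (x - y)| / (4 * t)); last by field; rewrite gt_eqF.
  rewrite -mulrDl ler_wpM2r ?invr_ge0 ?(ltW t4)//.
  have -> : sqnorm (x - y) - sqnorm x = - (sqnorm y + 2 * (dotv y x - sqnorm y)) by rewrite e1; ring.
  rewrite normrN (_ : dotv y x - sqnorm y = dotv y (x - y)); last by rewrite dotvD dotvN dotvv.
  apply: le_trans (ler_normD _ _) _.
  by rewrite (ger0_norm y0) normrM ger0_norm// addrC.
rewrite -mulrBr normrM (ger0_norm c0).
apply: le_trans (ler_wpM2l c0 (expRN_dist A B)) _.
rewrite mulrDr mulrDr; apply: lerD.
  rewrite mulrCA; apply: ler_wpM2r b2; exact: mulr_ge0 c0 (expR_ge0 _).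
rewrite mulrCA; apply: ler_wpM2r b1; exact: mulr_ge0 c0 (expR_ge0 _).
Qed.

Definition cM : R := 4 * 2 `^ (n%:R / 2) + 1.

(** When |y| t^{-1/2} is at least 1 the trivial bound 2 suffices; otherwise the quadratic terms of
    [gauss_shift] are dominated by the linear ones. *)
Lemma gauss_shift_L1 t y : 0 < t -> L1 mu (fun x => gauss t (x - y) - gauss t x) (cM * (l1norm y * t `^ (- 2^-1))).
Proof.
move=> t0; have two0 : 1 <= 2 `^ (n%:R / 2) :> R.
  by rewrite -{1}(powRr0 2) ler_powR ?ler1n// divr_ge0.
have n0 := l1norm_ge0 y; have p0 := powR_ge0 t (- 2^-1).
have mD : measurable_fun setT (fun x : V => gauss t (x - y) - gauss t x).
  exact: (L1_sub (L1_trans (- y) (L1_gauss t0)) (L1_gauss t0)).1.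
have sh := L1_trans (- y) (L1_gauss t0).
have nu0 := mulr_ge0 n0 p0.
have [h|h] := leP 1 (l1norm y * t `^ (- 2^-1)).
  apply: L1_weak (L1_sub sh (L1_gauss t0)).
  by apply: (sh_arith1 two0 h).
have q0 : 0 <= sqnorm y / (4 * t) by rewrite divr_ge0 ?sqnorm_ge0// mulr_ge0// ltW.
have B1 := L1_add (L1_abs (L1_trans (- y) (L1_K1 y t0))) (L1_scale (sqnorm y / (4 * t)) sh).
have B2 := L1_add (L1_abs (L1_K1 y t0)) (L1_scale (sqnorm y / (4 * t)) (L1_gauss t0)).
apply: (L1_weak _ (L1_le _ _ mD _ (L1_add B1 B2))); last by move=> x; exact: gauss_shift.
rewrite (ger0_norm q0) mulr1.
have q1 : sqnorm y / (4 * t) <= (l1norm y * t `^ (- 2^-1)) ^+ 2 / 4.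
  rewrite exprMn -(powR_mulrn 2 (powR_ge0 t (- 2^-1))) -powRrM (_ : - 2^-1 * 2%:R = -1); last by field.
  rewrite powR_inv1 ?(ltW t0)// invfM mulrA mulrAC ler_wpM2r ?invr_ge0//.
  by rewrite ler_wpM2r ?invr_ge0 ?(ltW t0)//; exact: sqnorm_nrm1.
apply: le_trans (_ : cK y * t `^ (- 2^-1) + (l1norm y * t `^ (- 2^-1)) ^+ 2 / 4 +
  (cK y * t `^ (- 2^-1) + (l1norm y * t `^ (- 2^-1)) ^+ 2 / 4) <= _); first by apply: lerD; rewrite lerD2l.
have -> : cK y * t `^ (- 2^-1) = 2 * 2 `^ (n%:R / 2) * (l1norm y * t `^ (- 2^-1)) by rewrite /cK; ring.
exact: (sh_arith2 two0 nu0 (ltW h)).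
Qed.

Lemma L1_sum (I : Type) (s : seq I) (f : I -> V -> R) (m : I -> R) :
  (forall j, L1 mu (f j) (m j)) -> L1 mu (fun x => \sum_(j <- s) f j x) (\sum_(j <- s) m j).
Proof.
move=> hf; elim: s => [|j s IH].
  rewrite big_nil; apply: (eq_L1 (f := fun=> 0)) => [x|]; first by rewrite big_nil.
  split=> //; under eq_integral do rewrite normr0; by rewrite integral0.
rewrite big_cons; apply: eq_L1 (L1_add (hf j) IH) => x.
by rewrite big_cons.
Qed.

(** The difference is the integral of (G_t(x - y) - G_t(x)) u_0(y) in y, so the first moment pays
    for t^{-1/2} in L^1. Applying e^{(t/2) Delta} to the L^1 bound at time t/2 gives the pointwise
    one. *)
Lemma heat_moment u0 B0 (m : 'I_n -> R) : L1 mu u0 B0 -> (forall j, L1 mu (fun x => x 0 j * u0 x) (m j)) ->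
  exists2 C, 0 <= C & forall t, 0 < t -> scaled t (C * t `^ (- 2^-1)) (fun x => cnv (gauss t) u0 x - RI mu u0 * gauss t x).
Proof.
move=> hu0 hm; pose M := \sum_j m j.
have hM : L1 mu (fun y => l1norm y * `|u0 y|) M.
  apply: eq_L1 (L1_sum (index_enum _) (fun j => L1_abs (hm j))) => y.
  by rewrite /l1norm mulr_suml; apply: eq_bigr => j _; rewrite normrM.
have M0 := L1_ge0 hM.
have cM0 : 0 <= cM by rewrite /cM addr_ge0// mulr_ge0// powR_ge0.
pose D t x := cnv (gauss t) u0 x - RI mu u0 * gauss t x.
have DL t : 0 < t -> L1 mu (D t) (cM * M * t `^ (- 2^-1)).
  move=> t0; pose H (z : V * V) := (gauss t (z.2 - z.1) - gauss t z.2) * u0 z.1.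
  have mH : measurable_fun setT H.
    apply: measurable_funM; last exact: (measurableT_comp hu0.1 measurable_fst).
    apply: measurable_funB; last exact: (measurableT_comp (measurable_gauss t) measurable_snd).
    have p2 : measurable_fun setT (fun w : V * V => w.2 - w.1).
      exact: (measurable_comp2 (F := fun z : V * V => z.1 - z.2) measurable_subV measurable_snd measurable_fst).
    exact: (measurableT_comp (measurable_gauss t) p2).
  have c0 : 0 <= cM * t `^ (- 2^-1) by rewrite mulr_ge0 ?powR_ge0.
  have hb := L1_scale (cM * t `^ (- 2^-1)) hM; rewrite (ger0_norm c0) in hb.
  have Hb y : (\int[mu]_x (`|H (y, x)|)%:E <= (cM * t `^ (- 2^-1) * (l1norm y * `|u0 y|))%:E)%E.
    have := (L1_scale (u0 y) (gauss_shift_L1 y t0)).2.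
    rewrite (_ : `|u0 y| * _ = cM * t `^ (- 2^-1) * (l1norm y * `|u0 y|)); last by ring.
    apply: le_trans; rewrite le_eqVlt; apply/orP; left; apply/eqP.
    by apply: eq_integral => x _; rewrite /H /= mulrC.
  have h := fub_L1 mH hb Hb.
  rewrite mulrAC; apply: eq_L1 h => x; rewrite /D cnvE mulrC -(I_scale (gauss t x) hu0).
  apply: etrans (I_sub (cnv_intg2 x (measurable_gauss t) (fun z => gauss_sup z t0) hu0) (L1_scale (gauss t x) hu0)).
  by apply: eq_I => y; rewrite /H /= mulrBl.
(* Halving the time in t^{-n/2} and in t^{-1/2} costs this factor. *)
have cc : 1 <= 2 `^ (n%:R / 2 + 2^-1) :> R.
  by rewrite -{1}(powRr0 2) ler_powR ?ler1n// addr_ge0// divr_ge0.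
exists (cM * M * 2 `^ (n%:R / 2 + 2^-1)); first by rewrite !mulr_ge0 ?powR_ge0.
move=> t t0; split.
  apply: L1_weak (DL t t0); apply: ler_wpM2r; first exact: powR_ge0.
  by rewrite ler_peMr ?mulr_ge0.
move=> x; have h0 : 0 < t / 2 by rewrite divr_gt0.
have -> : cnv (gauss t) u0 x - RI mu u0 * gauss t x = cnv (gauss (t / 2)) (D (t / 2)) x.
  have E : D (t / 2) = fun x => cnv (gauss (t / 2)) u0 x - RI mu u0 * gauss (t / 2) x by [].
  rewrite E (cnvB x (measurable_gauss _) (fun z => gauss_sup z h0) (cnv_L1 (L1_gauss h0) hu0) (L1_scale (RI mu u0) (L1_gauss h0))).
  rewrite (cnvZ _ x (measurable_gauss _) (fun z => gauss_sup z h0) (L1_gauss h0)).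
  rewrite (heat_heat x h0 h0 hu0) (cnv_gauss_gauss h0 h0) (_ : t / 2 + t / 2 = t)//.
  by field.
apply: le_trans (cnv_sup2 x (measurable_gauss _) (fun z => gauss_sup z h0) (DL _ h0)) _.
rewrite !powR_half// powRD ?pnatr_eq0 ?implybT//.
by rewrite le_eqVlt; apply/orP; left; apply/eqP; ring.
Qed.

End moment.

(** * Second-order expansion of the solution *)

Section expansion.
Context {R : realType} {n : nat}.
Notation V := 'rV[R]_n.
Notation mu := (rvm n).
Implicit Types (x : V) (t s : R).
Variables (a : V) (p : R).
Hypothesis n0 : (0 < n)%N.
Hypothesis pl : 1 + n%:R^-1 < p.
Hypothesis pu : p < 1 + 3 / (2 * n%:R).

Let sg : R := sigma n p.
Let g0 : R := n%:R / 2 * (p - 1).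
Let kap : R := (p - 1) / 2.

Let nR : 0 < n%:R :> R. Proof. by rewrite ltr0n. Qed.

Lemma sigma_gt0 : 0 < sigma n p.
Proof.
rewrite /sigma subr_gt0.
have : n%:R^-1 < p - 1 by rewrite ltrBrDl.
rewrite -(ltr_pM2l nR) mulfV ?gt_eqF// => h.
by rewrite mulrAC ltr_pdivlMr// mulVf// mulrC.
Qed.

(** This gives 2 sigma < 1/2, so the heat error t^{-1/2} is of lower order, and 2 sigma + 1/2 < 1,
    so the source of [prR] is integrable at 0. *)
Lemma sigma_lt4 : sigma n p < 4^-1.
Proof.
rewrite /sigma ltrBlDr.
have e : n%:R * (3 / (2 * n%:R)) = 3 / 2 :> R by field; rewrite gt_eqF.
have h : n%:R * (p - 1) < 3 / 2 by rewrite -e ltr_pM2l// ltrBlDl.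
by rewrite mulrAC ltr_pdivrMr//; apply: lt_le_trans h _; lra.
Qed.

Lemma p_gt1 : 1 < p.
Proof. by apply: lt_trans pl; rewrite ltrDl invr_gt0. Qed.

Lemma p_lt3 : p <= 3.
Proof.
apply: le_trans (ltW pu) _.
have n1 : 1 <= n%:R :> R by rewrite ler1n.
have : 3 / (2 * n%:R) <= 2 :> R.
  rewrite ler_pdivrMr ?mulr_gt0//; have := n1; move: (n%:R : R) => m; lra.
move: (3 / _) => z; lra.
Qed.

Let g0E : g0 = sg + 2^-1. Proof. by rewrite /g0 /sg /sigma subrK. Qed.
Let sg0 : 0 < sg. Proof. exact: sigma_gt0. Qed.
Let sg4 : sg < 4^-1. Proof. exact: sigma_lt4. Qed.
Let p1 := p_gt1.
Let g00 : 0 <= g0. Proof. by rewrite g0E addr_ge0// ltW. Qed.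
Let g01 : g0 < 1. Proof. by rewrite g0E; have := sg4; lra. Qed.

Lemma scaled_duhamel_fnl B g t : 0 < t -> 0 <= B -> jmeas g -> (forall s, 0 < s -> s < t -> scaled s B (g s)) ->
  scaled t (cS a g0 * (B `^ (p - 1) * B) * t `^ (- sg)) (duh a (fun s y => fnl p (g s y)) t).
Proof.
move=> t0 B0 mg hg; have -> : - sg = 2^-1 - g0 by rewrite g0E; ring.
apply: scaled_S => //; first by rewrite mulr_ge0 ?powR_ge0.
  exact: jmeas_fnl.
by move=> s s0 st; apply: (scaled_fnl p1 s0); exact: hg.
Qed.

Lemma jmeas_gauss (M : R) : jmeas (fun s (y : V) => M * gauss s y).
Proof. by apply: measurable_funM => //; exact: measurable_gauss2. Qed.

Lemma scaled_A (M : R) s : 0 < s -> scaled s `|M| (fun y : V => M * gauss s y).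
Proof. by move=> s0; have := scaled_scale M (scaled_gauss (n := n) s0); rewrite mulr1. Qed.

(** With f1 = f(U), f2 = f(A_0), u = U, v = A_0, w = A_{0,1} and d = f'(A_0): the error in the
    source is the Taylor remainder plus (U - A_{0,1}) f'(A_0). *)
Let taylor_split (f1 f2 d u v w : R) : f1 - f2 - d * (u - v) + (u - w) * d = f1 - f2 - (w - v) * d.
Proof. by ring. Qed.

Section profile.
Variable M : R.
(* [prA], [prA1] are A_0 and A_{0,1} for mass [M], and [prR 1] is R*_{0,2}. *)
Definition prA s (y : V) := M * gauss s y.
Definition prA1 s y := prA s y + duh a (fun s y => fnl p (prA s y)) s y.
Definition prR := duh a (fun s y => (prA1 s y - prA s y) * derive1 (fnl p) (prA s y)).

Lemma jmeas_prA : jmeas prA. Proof. exact: jmeas_gauss. Qed.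

Lemma jmeas_prA1 : jmeas prA1.
Proof. by apply: measurable_funD; [exact: jmeas_prA|apply: jmeas_S; apply: jmeas_fnl; exact: jmeas_prA]. Qed.

Lemma jmeas_gR : jmeas (fun s y => (prA1 s y - prA s y) * derive1 (fnl p) (prA s y)).
Proof.
apply: measurable_funM; first by apply: measurable_funB; [exact: jmeas_prA1|exact: jmeas_prA].
exact: (measurableT_comp (measurable_dfnl p1) jmeas_prA).
Qed.

Lemma prA1B s : (fun y => prA1 s y - prA s y) = duh a (fun s y => fnl p (prA s y)) s.
Proof. by apply/funext => y; rewrite /prA1 addrAC subrr add0r. Qed.

Let Cf : R := cS a g0 * (`|M| `^ (p - 1) * `|M|).
Let Cf0 : 0 <= Cf. Proof. by apply: mulr_ge0; [exact: cS_ge0|rewrite mulr_ge0 ?powR_ge0]. Qed.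

Lemma scaled_prA1B : exists2 C, 0 <= C & forall s, 0 < s -> scaled s (C * s `^ (- sg)) (fun y => prA1 s y - prA s y).
Proof.
exists Cf => // s s0; rewrite prA1B.
by apply: scaled_duhamel_fnl => //; [exact: jmeas_prA|move=> r r0 _; exact: scaled_A].
Qed.

(** The exponents add up: sigma + 1/2 from f'(A_0) and sigma from A_{0,1} - A_0. *)
Lemma scaled_gR : exists2 C, 0 <= C & forall s, 0 < s ->
  scaled s (C * s `^ (- (2 * sg + 2^-1))) (fun y => (prA1 s y - prA s y) * derive1 (fnl p) (prA s y)).
Proof.
have [C C0 HC] := scaled_prA1B.
exists (p * `|M| `^ (p - 1) * C); first by rewrite !mulr_ge0 ?powR_ge0// ltW// (lt_trans ltr01 p1).
move=> s s0; have := scaled_dfnl p1 s0 (scaled_A M s0) (HC s s0); rewrite -/(prA s) -/g0.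
rewrite (_ : p * _ * _ * (C * _) = p * `|M| `^ (p - 1) * C * (s `^ (- g0) * s `^ (- sg))); last by ring.
by rewrite -powRD ?(gt_eqF s0) ?implybT// (_ : - g0 - sg = - (2 * sg + 2^-1))// g0E; ring.
Qed.

Section solution.
Variables (u0 : V -> R) (U : R -> V -> R) (B0 N1 K : R) (m : 'I_n -> R).
Hypothesis hu0 : L1 mu u0 B0.
Hypothesis hm : forall j, L1 mu (fun x => x 0 j * u0 x) (m j).
Hypothesis ME : M = RI mu u0.
Hypothesis reg : regsol a p u0 U N1 K.

Let mU : jmeas U. Proof. by case: reg. Qed.
Let UE t x : 0 < t -> U t x = cnv (gauss t) u0 x + duh a (fun s y => fnl p (U s y)) t x.
Proof. by case: reg => _ _ _ h; exact: h. Qed.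

(** B also dominates |M|, so that one constant serves U and A_0 in the difference estimates. *)
Let boundU : exists2 B, `|M| <= B & forall t, 0 < t -> scaled t B (U t).
Proof.
have [C C0 HC] := pointwise_decay n0 pl hu0 reg.
case: reg => _ UL _ _; have N10 := L1_ge0 (UL 1 ltr01).
exists (`|M| + (N1 + C)); first by rewrite lerDl addr_ge0.
move=> t t0; have h1 : N1 <= `|M| + (N1 + C) by rewrite addrCA lerDl addr_ge0.
have h2 : C <= `|M| + (N1 + C) by rewrite addrA lerDr addr_ge0.
split; first exact: L1_weak (UL t t0).
by move=> x; apply: le_trans (HC t x t0) _; rewrite ler_wpM2r ?powR_ge0.
Qed.

Let H t x := cnv (gauss t) u0 x - prA t x.

(** Moment bound for large t, L^1 bound of u_0 for small t: every rate between 0 and 1/2 is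
    available at all times. *)
Let boundH : exists2 C, 0 <= C & forall t ga, 0 < t -> 0 <= ga -> ga <= 2^-1 -> scaled t (C * t `^ (- ga)) (H t).
Proof.
have [C C0 HC] := heat_moment hu0 hm.
have B00 := L1_ge0 hu0.
exists (C + (B0 + `|M|)); first by rewrite !addr_ge0.
move=> t ga t0 ga0 ga1; apply: (scaled_interp t0 _ ga0 ga1); first by rewrite !addr_ge0.
  rewrite oppr0 powRr0 mulr1; apply: scaled_le (_ : scaled t (B0 + `|M|) (H t)); first by rewrite lerDr.
  apply: scaled_sub; last exact: scaled_A.
  split; first exact: heat_L1.
  by move=> x; rewrite mulrC; exact: (cnv_sup2 x (measurable_gauss t) (fun z => gauss_sup z t0) hu0).
have := HC t t0; rewrite -ME; apply: scaled_le.
by apply: ler_wpM2r; rewrite ?powR_ge0// lerDl addr_ge0.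
Qed.

Let gU s y := fnl p (U s y).
Let gA s y := fnl p (prA s y).
Let gR s y := (prA1 s y - prA s y) * derive1 (fnl p) (prA s y).

Let sg2 : sg <= 2^-1. Proof. by have := sg4; lra. Qed.

Let boundUA : exists2 C, 0 <= C & forall t, 0 < t -> scaled t (C * t `^ (- sg)) (fun x => U t x - prA t x).
Proof.
have [B MB HB] := boundU; have [C C0 HC] := boundH.
have B00 : 0 <= B by exact: le_trans MB.
have c0 : 0 <= cS a g0 * (B `^ (p - 1) * B) by apply: mulr_ge0; [exact: cS_ge0|rewrite mulr_ge0 ?powR_ge0].
exists (C + cS a g0 * (B `^ (p - 1) * B)); first exact: addr_ge0.
move=> t t0.
have h1 := HC t sg t0 (ltW sg0) sg2.
have h2 := scaled_duhamel_fnl t0 B00 mU (fun s (sp : 0 < s) _ => HB s sp).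
rewrite mulrDl; apply: eq_sb (scaled_add h1 h2) => x.
by rewrite UE// /H addrAC.
Qed.

Let cut_gU t x : 0 < t -> exists B, L1 leb (tcut t (fun s => cnv (K1 a (t - s)) (gU s) x)) B.
Proof.
move=> t0; have [B MB HB] := boundU; have B00 : 0 <= B by exact: le_trans MB.
have c0 : 0 <= B `^ (p - 1) * B by rewrite mulr_ge0 ?powR_ge0.
eexists; apply: (scaled_tcut (c := g0) (C := B `^ (p - 1) * B) a x g00 g01 c0 t0 (jmeas_fnl p mU)).
by move=> s s0 _; apply: (scaled_fnl p1 s0); exact: HB.
Qed.

Let cut_gA t x : 0 < t -> exists B, L1 leb (tcut t (fun s => cnv (K1 a (t - s)) (gA s) x)) B.
Proof.
move=> t0; have c0 : 0 <= `|M| `^ (p - 1) * `|M| by rewrite mulr_ge0 ?powR_ge0.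
eexists; apply: (scaled_tcut (c := g0) (C := `|M| `^ (p - 1) * `|M|) a x g00 g01 c0 t0 (jmeas_fnl p jmeas_prA)).
by move=> s s0 _; apply: (scaled_fnl p1 s0); exact: scaled_A.
Qed.

Let c2 : 0 <= 2 * sg + 2^-1. Proof. by have := sg0; lra. Qed.
Let c21 : 2 * sg + 2^-1 < 1. Proof. by have := sg4; lra. Qed.

Let cut_gR t x : 0 < t -> exists B, L1 leb (tcut t (fun s => cnv (K1 a (t - s)) (gR s) x)) B.
Proof.
move=> t0; have [C C0 HC] := scaled_gR.
eexists; apply: (scaled_tcut (c := 2 * sg + 2^-1) (C := C) a x c2 c21 C0 t0 jmeas_gR).
by move=> s s0 _; exact: HC.
Qed.

Let L1gU s : 0 < s -> exists b, L1 mu (gU s) b.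
Proof. by move=> s0; have [B _ HB] := boundU; eexists; exact: (scaled_fnl p1 s0 (HB s s0)).1. Qed.

Let L1gA s : 0 < s -> exists b, L1 mu (gA s) b.
Proof. by move=> s0; eexists; exact: (scaled_fnl p1 s0 (scaled_A M s0)).1. Qed.

Let L1gR s : 0 < s -> exists b, L1 mu (gR s) b.
Proof. by move=> s0; have [C _ HC] := scaled_gR; eexists; exact: (HC s s0).1. Qed.

Let SUA t x : 0 < t -> duh a (fun s y => gU s y - gA s y) t x = duh a gU t x - duh a gA t x.
Proof.
move=> t0; have [B hB] := cut_gU x t0; have [B' hB'] := cut_gA x t0.
by apply: (duh_sub _ _ hB hB') => s s0 _; [exact: L1gU|exact: L1gA].
Qed.

Let SUAR t x : 0 < t -> duh a (fun s y => gU s y - gA s y - gR s y) t x = duh a gU t x - duh a gA t x - duh a gR t x.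
Proof.
move=> t0; have [B hB] := cut_gU x t0; have [B' hB'] := cut_gA x t0; have [B'' hB''] := cut_gR x t0.
have l : L1 leb (tcut t (fun s => cnv (K1 a (t - s)) (fun y => gU s y - gA s y) x)) (B + B').
  apply: eq_L1 (L1_sub hB hB') => s; rewrite /tcut; case: ifPn => [/andP[s0 st]|_]; last by rewrite subr0.
  have [b1 hb1] := L1gU s0; have [b2 hb2] := L1gA s0; have ts : 0 < t - s by rewrite subr_gt0.
  exact: esym (cnvB x (measurable_K1 a _) (fun z => K1_sup a z ts) hb1 hb2).
rewrite -SUA//; apply: (duh_sub _ _ l hB'') => s s0 _; last exact: L1gR.
by have [b1 hb1] := L1gU s0; have [b2 hb2] := L1gA s0; eexists; exact: L1_sub hb1 hb2.
Qed.

Let jmeas_dUA : jmeas (fun s y => gU s y - gA s y).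
Proof. by apply: measurable_funB; apply: jmeas_fnl; [exact: mU|exact: jmeas_prA]. Qed.

Let pp0 : 0 <= p. Proof. exact: ltW (lt_trans ltr01 p1). Qed.

Let bound_dUA : exists2 C, 0 <= C & forall s, 0 < s -> scaled s (C * s `^ (- (2 * sg + 2^-1))) (fun y => gU s y - gA s y).
Proof.
have [B MB HB] := boundU; have [C C0 HC] := boundUA.
have B00 : 0 <= B by exact: le_trans MB.
exists (p * B `^ (p - 1) * C); first by rewrite !mulr_ge0 ?powR_ge0.
move=> s s0; have := scaled_fnl_diff p1 s0 (HB s s0) (scaled_le MB (scaled_A M s0)) (HC s s0).
rewrite (_ : p * _ * _ * (C * _) = p * B `^ (p - 1) * C * (s `^ (- g0) * s `^ (- sg))); last by rewrite -/g0; ring.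
by rewrite -powRD ?(gt_eqF s0) ?implybT// (_ : - g0 - sg = - (2 * sg + 2^-1))// g0E; ring.
Qed.

Let U_A1 t x : 0 < t -> U t x - prA1 t x = H t x + duh a (fun s y => gU s y - gA s y) t x.
Proof.
move=> t0; rewrite SUA// UE// /prA1 /H -/gU -/gA.
by rewrite opprD addrACA.
Qed.

(** Both rates are kept because [bound_br] interpolates between them. *)
Let boundUA1 : exists2 C, 0 <= C & forall t, 0 < t -> scaled t (C * t `^ (- sg)) (fun x => U t x - prA1 t x) /\
  scaled t (C * t `^ (- (2 * sg))) (fun x => U t x - prA1 t x).
Proof.
have [C C0 HC] := boundUA; have [C' C'0 HC'] := scaled_prA1B; have [C'' C''0 HC''] := boundH.
have [D D0 HD] := bound_dUA.
have E0 : 0 <= cS a (2 * sg + 2^-1) * D by apply: mulr_ge0 => //; exact: cS_ge0.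
exists (C + C' + (C'' + cS a (2 * sg + 2^-1) * D)); first by rewrite !addr_ge0.
move=> t t0; split.
  apply: (scaled_le (r := C * t `^ (- sg) + C' * t `^ (- sg))).
    by rewrite -mulrDl ler_wpM2r ?powR_ge0// lerDl addr_ge0.
  apply: eq_sb (scaled_sub (HC t t0) (HC' t t0)) => x.
  by rewrite opprB addrA subrK.
apply: (scaled_le (r := C'' * t `^ (- (2 * sg)) + cS a (2 * sg + 2^-1) * D * t `^ (2^-1 - (2 * sg + 2^-1)))).
  rewrite (_ : 2^-1 - (2 * sg + 2^-1) = - (2 * sg)); last by ring.
  by rewrite -mulrDl ler_wpM2r ?powR_ge0// lerDr addr_ge0.
have h1 : scaled t (C'' * t `^ (- (2 * sg))) (H t).
  by apply: HC'' => //; have := sg0; have := sg4; lra.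
have h2 := scaled_S a c2 c21 D0 t0 jmeas_dUA (fun s (sp : 0 < s) _ => HD s sp).
by apply: eq_sb (scaled_add h1 h2) => x; rewrite U_A1.
Qed.

Let kap0 : 0 < kap. Proof. by rewrite divr_gt0// subr_gt0. Qed.
Let kap1 : kap <= 1. Proof. by rewrite /kap ler_pdivrMr// mul1r lerBlDr; have := p_lt3; lra. Qed.

Let br s y := gU s y - gA s y - gR s y.

(** The improved exponent 2 sg + 1/2 + kap sg may exceed 1, where integrability at s = 0 is lost;
    the unimproved one, below 1, is kept for interpolation. *)
Let bound_br : exists2 C, 0 <= C & forall s, 0 < s -> scaled s (C * s `^ (- (2 * sg + 2^-1))) (br s) /\
  scaled s (C * s `^ (- (2 * sg + 2^-1 + kap * sg))) (br s).
Proof.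
have [B MB HB] := boundU; have [C C0 HC] := boundUA; have [D D0 HD] := boundUA1.
have [E E0 HE] := bound_dUA; have [F F0 HF] := scaled_gR.
have B00 : 0 <= B by exact: le_trans MB.
pose P : R := 2 * p * B `^ kap * C `^ kap * C.
pose Q : R := p * B `^ (p - 1) * D.
have P0 : 0 <= P by rewrite /P; nonneg.
have Q0 : 0 <= Q by rewrite /Q; nonneg.
exists (E + F + (P + Q)); first by rewrite !addr_ge0.
move=> s s0; split.
  apply: scaled_le (scaled_sub (HE s s0) (HF s s0)).
  by rewrite -mulrDl ler_wpM2r ?powR_ge0// lerDl addr_ge0.
have hA := scaled_le MB (scaled_A M s0).
have t1 := scaled_taylor p1 p_lt3 s0 (HB s s0) hA (HC s s0).
have [d1 d2] := HD s s0.
have ks : 0 <= kap * sg by exact: mulr_ge0 (ltW kap0) (ltW sg0).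
have ks1 : kap * sg <= sg by rewrite ler_piMl// ltW.
have d3 : scaled s (D * s `^ (- (sg + kap * sg))) (fun x => U s x - prA1 s x).
  apply: (scaled_interp s0 D0 _ _ d1 d2); first by rewrite lerDl.
  by rewrite (_ : 2 * sg = sg + sg) ?lerD2l//; ring.
have t2 := scaled_dfnl p1 s0 hA d3.
apply: (scaled_le (r := P * s `^ (- (2 * sg + 2^-1 + kap * sg)) + Q * s `^ (- (2 * sg + 2^-1 + kap * sg)))).
  by rewrite -mulrDl ler_wpM2r ?powR_ge0// lerDr addr_ge0.
have e1 : P * s `^ (- (2 * sg + 2^-1 + kap * sg)) = 2 * p * B `^ kap * (C * s `^ (- sg)) `^ kap * s `^ (- g0) * (C * s `^ (- sg)).
  rewrite powRM ?powR_ge0// -powRrM /P.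
  rewrite (_ : - (2 * sg + 2^-1 + kap * sg) = - sg * kap + (- g0 + - sg)); last by rewrite g0E; ring.
  by rewrite !powRD ?(gt_eqF s0) ?implybT//; ring.
have e2 : Q * s `^ (- (2 * sg + 2^-1 + kap * sg)) = p * B `^ (p - 1) * s `^ (- g0) * (D * s `^ (- (sg + kap * sg))).
  rewrite (_ : - (2 * sg + 2^-1 + kap * sg) = - g0 + - (sg + kap * sg)); last by rewrite g0E; ring.
  by rewrite [in LHS]powRD ?(gt_eqF s0) ?implybT// /Q; ring.
rewrite e1 e2; apply: eq_sb (scaled_add t1 t2) => y.
exact: taylor_split.
Qed.

(** The first entry is the Taylor gain; the second keeps 2 sg + 1/2 + del below 1 and 2 sg + del
    below 1/2, the best rate of the heat error. *)
Let del : R := Num.min (kap * sg) ((2^-1 - 2 * sg) / 2).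

(** By linearity of the Duhamel integral, U - A_{0,1} - R is the heat error H plus the Duhamel
    integral of [br]. *)
Theorem expansion : exists C del', [/\ 0 <= C, 0 < del' & forall t, 0 < t ->
  scaled t (C * t `^ (- (2 * sg + del'))) (fun x => U t x - prA1 t x - prR t x)].
Proof.
have [C C0 HC] := boundH; have [D D0 HD] := bound_br.
have h4 : 0 < (2^-1 - 2 * sg) / 2 by rewrite divr_gt0//; have := sg4; lra.
have ks : 0 < kap * sg by exact: mulr_gt0.
have d0 : 0 < del by rewrite lt_min ks h4.
have d1 : del <= kap * sg by rewrite ge_min lexx.
have d2 : del <= (2^-1 - 2 * sg) / 2 by rewrite ge_min lexx orbT.
have d3 : 2 * sg + del <= 2^-1 by have := sg4; lra.
have d4 : 2 * sg + 2^-1 + del < 1 by have := sg4; lra.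
have d5 : 0 <= 2 * sg + 2^-1 + del by have := sg0; lra.
have d6 : 0 <= 2 * sg + del by have := sg0; lra.
have jb : jmeas br by apply: measurable_funB; [exact: jmeas_dUA|exact: jmeas_gR].
have hb s : 0 < s -> scaled s (D * s `^ (- (2 * sg + 2^-1 + del))) (br s).
  move=> s0; have [b1 b2] := HD s s0; apply: (scaled_interp s0 D0 _ _ b1 b2).
    by rewrite lerDl ltW.
  by rewrite lerD2l.
exists (C + cS a (2 * sg + 2^-1 + del) * D), del; split=> //.
  by rewrite addr_ge0// mulr_ge0//; exact: cS_ge0.
move=> t t0; have h1 := HC t _ t0 d6 d3.
have h2 := scaled_S a d5 d4 D0 t0 jb (fun s (sp : 0 < s) _ => hb s sp).
rewrite (_ : 2^-1 - (2 * sg + 2^-1 + del) = - (2 * sg + del)) in h2; last by ring.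
rewrite mulrDl; apply: eq_sb (scaled_add h1 h2) => x.
rewrite U_A1// SUA//; apply: etrans (congr1 (fun z => H t x + z) (SUAR x t0)) _.
exact: (addrA (H t x) (duh a gU t x - duh a gA t x) (- prR t x)).
Qed.

End solution.
End profile.
End expansion.

(** * Self-similarity *)

Section selfsim.
Context {R : realType} {n : nat}.
Notation V := 'rV[R]_n.
Notation mu := (rvm n).
Implicit Types (x : V) (t s r c : R).
Variables (a : V).

Lemma K1_scale t s x : 0 < t -> 0 < s ->
  K1 a (t * s) (Num.sqrt t *: x) = t `^ (- 2^-1 - n%:R / 2) * K1 a s x.
Proof.
move=> t0 s0; rewrite !K1E dotvZ gauss_scale//.
have -> : t `^ (- 2^-1 - n%:R / 2) = (Num.sqrt t)^-1 * t `^ (- (n%:R / 2)).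
  by rewrite powRD ?(gt_eqF t0) ?implybT// powRN powR12_sqrt// ltW.
have e : t * s = Num.sqrt t * Num.sqrt t * s by rewrite -expr2 sqr_sqrtr// ltW.
have q0 : 0 < Num.sqrt t by rewrite sqrtr_gt0.
rewrite e; move: (Num.sqrt t) q0 (t `^ _) (dotv a x) (gauss s x) => q q0 P d G.
by field; rewrite !gt_eqF.
Qed.

Lemma cnvK1_scale t s c (g h : V -> R) x : 0 < t -> 0 < s -> measurable_fun setT g ->
  (forall y, g (Num.sqrt t *: y) = t `^ (- (n%:R / 2) - c) * h y) ->
  (exists B, L1 mu h B) ->
  cnv (K1 a (t * s)) g (Num.sqrt t *: x) = t `^ (- 2^-1 - c - n%:R / 2) * cnv (K1 a s) h x.
Proof.
move=> t0 s0 mg gh [B hB]; have q0 : 0 < Num.sqrt t by rewrite sqrtr_gt0.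
pose F y := K1 a (t * s) (Num.sqrt t *: x - y) * g y.
have mF : measurable_fun setT F.
  by apply: measurable_funM => //; exact: (measurableT_comp (measurable_K1 a (t * s)) (measurable_reflV (Num.sqrt t *: x))).
have := RI_rvm_scale q0 mF => /(congr1 (fun z => Num.sqrt t ^+ n * z)).
rewrite mulrA mulfV ?expf_neq0 ?gt_eqF// mul1r cnvE => <-.
have E y : F (Num.sqrt t *: y) = t `^ (- 2^-1 - n%:R / 2 + (- (n%:R / 2) - c)) * (K1 a s (x - y) * h y).
  rewrite /F -scalerBr K1_scale// gh [in RHS]powRD ?(gt_eqF t0) ?implybT//.
  by rewrite mulrACA.
have I2 := I_scale (t `^ (- 2^-1 - n%:R / 2 + (- (n%:R / 2) - c))) (cnv_intg2 x (measurable_K1 a s) (fun z => K1_sup a z s0) hB).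
rewrite (eq_I mu E) (etrans I2 (congr1 _ (esym (cnvE _ _ _)))) mulrA.
congr (_ * _).
have -> : Num.sqrt t ^+ n = t `^ (n%:R / 2).
  by rewrite -powR12_sqrt ?(ltW t0)// -powR_mulrn ?powR_ge0// -powRrM mulrC.
rewrite -powRD ?(gt_eqF t0) ?implybT//; congr (_ `^ _); ring.
Qed.

(** Under s -> t s and y -> sqrt t y the exponents are 1 from ds, n/2 from dy, -1/2 - n/2 from the
    kernel and -c - n/2 from the source. *)
Lemma duh_selfsim (g h : R -> V -> R) c t r x B : 0 < t -> 0 < r -> jmeas g ->
  (forall s, 0 < s -> s < r -> exists B, L1 mu (h s) B) ->
  (forall s y, 0 < s -> s < r -> g (t * s) (Num.sqrt t *: y) = t `^ (- (n%:R / 2) - c) * h s y) ->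
  L1 leb (tcut r (fun s => cnv (K1 a (r - s)) (h s) x)) B ->
  duh a g (t * r) (Num.sqrt t *: x) = t `^ (2^-1 - c - n%:R / 2) * duh a h r x.
Proof.
move=> t0 r0 mg hL gh hB.
pose F := tcut (t * r) (fun s => cnv (K1 a (t * r - s)) (g s) (Num.sqrt t *: x)).
have mF : measurable_fun setT F by exact: measurable_cutcnv.
have := RI_leb_scale t0 mF => /(congr1 (fun z => t * z)).
rewrite mulrA mulfV ?gt_eqF// mul1r !duhE => <-.
have E s : F (t * s) = t `^ (- 2^-1 - c - n%:R / 2) * tcut r (fun s => cnv (K1 a (r - s)) (h s) x) s.
  rewrite /F /tcut pmulr_rgt0// ltr_pM2l//; case: ifPn => [/andP[s0 sr]|_]; last by rewrite mulr0.
  rewrite -mulrBr; apply: cnvK1_scale => //; first by rewrite subr_gt0.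
  - exact: jmeas_meas.
  - by move=> y; exact: gh.
  - exact: hL.
rewrite (eq_I leb E) (I_scale _ hB) mulrA; congr (_ * _).
rewrite -{1}(powRr1 (ltW t0)) -powRD ?(gt_eqF t0) ?implybT//; congr (_ `^ _); lra.
Qed.

End selfsim.

Section profile_selfsim.
Context {R : realType} {n : nat}.
Notation V := 'rV[R]_n.
Notation mu := (rvm n).
Implicit Types (x y : V) (t s r : R).
Variables (a : V) (p : R).
Hypothesis n0 : (0 < n)%N.
Hypothesis pl : 1 + n%:R^-1 < p.
Hypothesis pu : p < 1 + 3 / (2 * n%:R).

Let sg : R := sigma n p.
Let g0 : R := n%:R / 2 * (p - 1).
Let g0E : g0 = sg + 2^-1. Proof. by rewrite /g0 /sg /sigma subrK. Qed.
Let sg0 : 0 < sg. Proof. exact: sigma_gt0. Qed.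
Let sg4 : sg < 4^-1. Proof. exact: sigma_lt4. Qed.
Let p1 : 1 < p. Proof. exact: p_gt1 n0 pl. Qed.
Let p0 : 0 < p. Proof. exact: lt_trans ltr01 p1. Qed.
Let g00 : 0 <= g0. Proof. by rewrite g0E addr_ge0// ltW. Qed.
Let g01 : g0 < 1. Proof. by rewrite g0E; have := sg4; lra. Qed.

Variable M : R.
Notation A := (prA M).
Notation A1 := (prA1 a p M).

Lemma prA_scale t s y : 0 < t -> 0 < s -> A (t * s) (Num.sqrt t *: y) = t `^ (- (n%:R / 2)) * A s y.
Proof. by move=> t0 s0; rewrite /prA gauss_scale// mulrCA. Qed.

Let e0 : - (n%:R / 2) * p = - (n%:R / 2) - g0. Proof. by rewrite /g0; ring. Qed.

Lemma fnl_prA_scale t s y : 0 < t -> 0 < s ->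
  fnl p (A (t * s) (Num.sqrt t *: y)) = t `^ (- (n%:R / 2) - g0) * fnl p (A s y).
Proof.
move=> t0 s0; rewrite prA_scale// fnlM; congr (_ * _).
by rewrite fnlE ?powR_ge0// -powRrM e0.
Qed.

Let tcutA r x : 0 < r -> L1 leb (tcut r (fun s => cnv (K1 a (r - s)) (fun y => fnl p (A s y)) x))
  (cS a g0 * (`|M| `^ (p - 1) * `|M|) * r `^ (2^-1 - g0) * r `^ (- (n%:R / 2))).
Proof.
move=> r0; apply: scaled_tcut => //.
  by apply: jmeas_fnl; exact: jmeas_prA.
by move=> s s0 _; apply: (scaled_fnl p1 s0); exact: scaled_A.
Qed.

Lemma prA1_scale t r x : 0 < t -> 0 < r ->
  A1 (t * r) (Num.sqrt t *: x) - A (t * r) (Num.sqrt t *: x) = t `^ (- sg - n%:R / 2) * (A1 r x - A r x).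
Proof.
move=> t0 r0; have E s y : A1 s y - A s y = duh a (fun s y => fnl p (A s y)) s y by rewrite /prA1 addrAC subrr add0r.
have e : - sg - n%:R / 2 = 2^-1 - g0 - n%:R / 2 by rewrite g0E; ring.
have main : duh a (fun s y => fnl p (A s y)) (t * r) (Num.sqrt t *: x) =
    t `^ (2^-1 - g0 - n%:R / 2) * duh a (fun s y => fnl p (A s y)) r x.
  apply: (duh_selfsim t0 r0 _ _ _ (tcutA x r0)).
  - by apply: jmeas_fnl; exact: jmeas_prA.
  - by move=> s s0 _; eexists; exact: (scaled_fnl p1 s0 (scaled_A M s0)).1.
  - by move=> s y s0 _; exact: fnl_prA_scale.
rewrite -e in main.
exact: (etrans (E (t * r) _) (etrans main (congr1 (fun z => t `^ (- sg - n%:R / 2) * z) (esym (E r x))))).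
Qed.

Let dfnl_scale t z : derive1 (fnl p) (t `^ (- (n%:R / 2)) * z) = t `^ (- (n%:R / 2) * (p - 1)) * derive1 (fnl p) z.
Proof.
by rewrite !(derive1_fnl _ p1) normrM (ger0_norm (powR_ge0 _ _)) powRM ?powR_ge0// -powRrM mulrCA.
Qed.

Lemma prR_scale t x : 0 < t -> prR a p M t (Num.sqrt t *: x) = t `^ (- (n%:R / 2 + 2 * sg)) * prR a p M 1 x.
Proof.
move=> t0; have [C C0 HC] := scaled_gR a n0 pl pu M.
rewrite -{1}(mulr1 t) (_ : - (n%:R / 2 + 2 * sg) = 2^-1 - (2 * sg + 2^-1) - n%:R / 2); last by ring.
have c2 : 0 <= 2 * sg + 2^-1 by have := sg0; lra.
have c21 : 2 * sg + 2^-1 < 1 by have := sg4; lra.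
have eT : t `^ (- sg - n%:R / 2) * t `^ (- (n%:R / 2) * (p - 1)) = t `^ (- (n%:R / 2) - (2 * sg + 2^-1)).
  rewrite -powRD ?(gt_eqF t0) ?implybT//; congr (_ `^ _).
  by rewrite mulNr -/g0 g0E; ring.
have l := scaled_tcut a x c2 c21 C0 ltr01 (jmeas_gR a n0 pl M) (fun s (sp : 0 < s) _ => HC s sp).
apply: (duh_selfsim (h := fun s y => (A1 s y - A s y) * derive1 (fnl p) (A s y)) t0 ltr01 _ _ _ l).
- exact: jmeas_gR.
- by move=> s s0 _; eexists; exact: (HC s s0).1.
- move=> s y s0 _; have h1 := prA1_scale y t0 s0.
  have h3 := etrans (congr1 (derive1 (fnl p)) (prA_scale y t0 s0)) (dfnl_scale t (A s y)).
  apply: etrans (congr2 (fun u v => u * v) h1 h3) _; apply: etrans (mulrACA _ _ _ _) _.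
  by rewrite eT.
Qed.

Lemma scaled_prR1 : exists2 C, 0 <= C & scaled 1 C (prR a p M 1).
Proof.
have [C C0 HC] := scaled_gR a n0 pl pu M.
have c2 : 0 <= 2 * sg + 2^-1 by have := sg0; lra.
have c21 : 2 * sg + 2^-1 < 1 by have := sg4; lra.
have h := scaled_S a c2 c21 C0 ltr01 (jmeas_gR a n0 pl M) (fun s (sp : 0 < s) _ => HC s sp).
by rewrite powR1 mulr1 in h; eexists; last exact: h; exact: scaled_ge0 h.
Qed.

(** The parabolic rescaling that leaves [prR] invariant, by [prR_scale]. *)
Definition rescaled (w : R -> V -> R) t x := t `^ (n%:R / 2 + 2 * sg) * w t (Num.sqrt t *: x).

Lemma rescaled_dist (w : R -> V -> R) C d t : 0 < t -> scaled t (C * t `^ (- (2 * sg + d))) (fun x => w t x - prR a p M t x) ->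
  scaled 1 (C * t `^ (- d)) (fun x => rescaled w t x - prR a p M 1 x).
Proof.
move=> t0 [h1 h2]; have q0 : 0 < Num.sqrt t by rewrite sqrtr_gt0.
have E x : t `^ (n%:R / 2 + 2 * sg) * (w t (Num.sqrt t *: x) - prR a p M t (Num.sqrt t *: x)) = rescaled w t x - prR a p M 1 x.
  rewrite mulrBr prR_scale// mulrA -powRD ?(gt_eqF t0) ?implybT//.
  by rewrite subrr powRr0 mul1r.
have qn : (Num.sqrt t ^+ n)^-1 = t `^ (- (n%:R / 2)).
  by rewrite -powR12_sqrt ?(ltW t0)// -powR_mulrn ?powR_ge0// -powRrM powRN mulrC.
have pE : t `^ (n%:R / 2 + 2 * sg) * (t `^ (- (n%:R / 2)) * (C * t `^ (- (2 * sg + d)))) = C * t `^ (- d).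
  rewrite (_ : - d = n%:R / 2 + 2 * sg + (- (n%:R / 2) + - (2 * sg + d))); last by ring.
  by rewrite [in RHS]powRD ?(gt_eqF t0) ?implybT// [t `^ (- (n%:R / 2) + _)]powRD ?(gt_eqF t0) ?implybT//; ring.
split.
  apply: eq_L1 E _; have := L1_scale (t `^ (n%:R / 2 + 2 * sg)) (L1_dilate q0 h1).
  by rewrite (ger0_norm (powR_ge0 _ _)) qn pE.
move=> x; rewrite powR1 mulr1 -E normrM (ger0_norm (powR_ge0 _ _)) -pE.
by apply: ler_wpM2l; [exact: powR_ge0|rewrite mulrC; exact: h2].
Qed.

End profile_selfsim.

Section rate.
Context {R : realType}.
Implicit Types (D e eps t : R).

Lemma cvg_powR_rate (l : R -> R) l0 D e : 0 <= D -> 0 < e ->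
  (forall t, 1 <= t -> `|l t - l0| <= D * t `^ (- e)) -> l t @[t --> +oo] --> l0.
Proof.
move=> D0 e0 h; apply/cvgrPdist_lt => eps ep.
pose T := ((D + 1) / eps) `^ e^-1.
have z0 : 0 < (D + 1) / eps by rewrite divr_gt0// ltr_wpDl.
have T0 : 0 < T by exact: powR_gt0.
near=> t.
have t1 : 1 < t by near: t; exact: nbhs_pinfty_gt.
have tT : T < t by near: t; apply: nbhs_pinfty_gt; rewrite num_real.
have t0 : 0 < t by exact: lt_trans ltr01 t1.
rewrite distrC; apply: le_lt_trans (h t (ltW t1)) _.
have te : (D + 1) / eps <= t `^ e.
  have -> : (D + 1) / eps = T `^ e by rewrite /T -powRrM mulVf ?lt0r_neq0// powRr1// ltW.
  by apply: ge0_ler_powR; rewrite ?nnegrE ?(ltW e0) ?(ltW T0) ?(ltW t0) ?(ltW tT).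
rewrite powRN -/(_ / _) ltr_pdivrMr ?powR_gt0//.
move: te; rewrite ler_pdivrMr// mulrC; apply: lt_le_trans.
by rewrite ltrDl.
Unshelve. all: by end_near. Qed.

End rate.

(** * Convergence of L^q norms *)

Section Lq_cvg.
Context {R : realType} {n : nat}.
Notation V := 'rV[R]_n.
Notation mu := (rvm n).
Implicit Types (f g w : V -> R) (c d r K A B C t : R).
Hypothesis n0 : (0 < n)%N.

Lemma Lq_fine (q : \bar R) w A K : (1 <= q)%E -> L1 mu w A -> (forall x, `|w x| <= K) -> Lq q w = (fine (Lq q w))%:E.
Proof.
case: q => [r||]// r1 hw wK; first by rewrite (Lq_EFin _ hw wK).
rewrite fineK// ge0_fin_numE; last exact: esssup_ge0.
by apply: le_lt_trans (esssup_le n0 wK) _; exact: ltry.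
Qed.

(** For finite r, |v|^r and |w|^r are compared by the mean value theorem, and their integrals
    through Hoelder continuity of the r-th root. The rate e^{1/r} is crude but suffices for
    convergence. *)
Lemma Lq_close (q : \bar R) (v w : V -> R) A B K e : (1 <= q)%E -> L1 mu v A -> L1 mu w B ->
  (forall x, `|v x| <= K) -> (forall x, `|w x| <= K) ->
  L1 mu (fun x => v x - w x) e -> (forall x, `|v x - w x| <= e) ->
  `|fine (Lq q v) - fine (Lq q w)| <=
   match q with r%:E => (r * K `^ (r - 1) * e) `^ r^-1 | _ => e end.
Proof.
move=> q1 hv hw vK wK he eK; case: q q1 => [r||]// r1; last first.
  have h1 := esssup_dist eK.
  have eK' x : `|w x - v x| <= e by rewrite distrC.
  have h2 := esssup_dist eK'.
  have E1 := Lq_fine (q := +oo%E) (leey _) hv vK; have E2 := Lq_fine (q := +oo%E) (leey _) hw wK.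
  move: h1 h2; rewrite -[esssup v]/(Lq +oo v) -[esssup w]/(Lq +oo w) E1 E2 -!EFinD !lee_fin => h1 h2.
  rewrite ler_norml; apply/andP; split; lra.
rewrite (Lq_EFin r1 hv vK) (Lq_EFin r1 hw wK) /=; rewrite lee_fin in r1.
have r0 : 0 < r by exact: lt_le_trans r1.
have r01 : 0 <= r^-1 <= 1 by rewrite invr_ge0 (ltW r0) invf_le1.
have Iv : 0 <= RI mu (fun x => `|v x| `^ r) by apply: I_ge0 => x; exact: powR_ge0.
have Iw : 0 <= RI mu (fun x => `|w x| `^ r) by apply: I_ge0 => x; exact: powR_ge0.
apply: le_trans (powR_dist r01 Iv Iw) _.
have hpv := L1_pow r1 hv vK; have hpw := L1_pow r1 hw wK.
have K0 : 0 <= K by apply: le_trans (vK 0).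
have c0 : 0 <= r * K `^ (r - 1) by rewrite mulr_ge0 ?powR_ge0// ltW.
have hd : L1 mu (fun x => `|v x| `^ r - `|w x| `^ r) (r * K `^ (r - 1) * e).
  have := L1_scale (r * K `^ (r - 1)) (L1_abs he); rewrite (ger0_norm c0) => h.
  apply: (L1_le _ _ (L1_sub hpv hpw).1 _ h) => x.
  have a1 : 0 <= `|w x| <= K by rewrite normr_ge0 wK.
  have a2 : 0 <= `|v x| <= K by rewrite normr_ge0 vK.
  apply: le_trans (powR_lip r1 a1 a2) _.
  by apply: ler_wpM2l => //; exact: ler_dist_dist.
have hI := L1_I hd; rewrite (I_sub hpv hpw) in hI.
apply: ge0_ler_powR; rewrite ?nnegrE ?invr_ge0 ?(ltW r0)//.
exact: L1_ge0 hd.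
Qed.

Lemma Lq_cvg (q : \bar R) (OM : R -> V -> R) w0 A K C d : (1 <= q)%E -> L1 mu w0 A -> (forall x, `|w0 x| <= K) ->
  0 <= C -> 0 < d -> (forall t, 1 <= t -> scaled 1 (C * t `^ (- d)) (fun x => OM t x - w0 x)) ->
  (forall t, 1 <= t -> Lq q (OM t) = (fine (Lq q (OM t)))%:E) /\
  fine (Lq q (OM t)) @[t --> +oo] --> fine (Lq q w0).
Proof.
move=> q1 hw wK C0 d0 h.
have K0 : 0 <= K by apply: le_trans (wK 0).
have td t : 1 <= t -> C * t `^ (- d) <= C.
  move=> t1; rewrite ler_piMr// powRN invf_le1 ?powR_gt0 ?(lt_le_trans ltr01 t1)//.
  by rewrite -{1}(powRr0 t) ler_powR// ltW.
have supd t x : 1 <= t -> `|OM t x - w0 x| <= C * t `^ (- d).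
  by move=> t1; have := (h t t1).2 x; rewrite powR1 mulr1.
have omL t : 1 <= t -> L1 mu (OM t) (C + A).
  move=> t1; apply: eq_L1 (L1_add (L1_weak (td t t1) (h t t1).1) hw) => x.
  by rewrite subrK.
have omK t x : 1 <= t -> `|OM t x| <= C + K.
  move=> t1; rewrite -(subrK (w0 x) (OM t x)); apply: le_trans (ler_normD _ _) _.
  by apply: lerD => //; apply: le_trans (supd t x t1) _; exact: td.
have wK' x : `|w0 x| <= C + K by apply: le_trans (wK x) _; rewrite lerDr.
split; first by move=> t t1; exact: (Lq_fine q1 (omL t t1) (fun x => omK t x t1)).
have cl t (t1 : 1 <= t) := Lq_close q1 (omL t t1) hw (fun x => omK t x t1) wK' (h t t1).1 (fun x => supd t x t1).
case: q q1 cl => [r||]// r1 cl; last exact: (cvg_powR_rate C0 d0 cl).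
have r0 : 0 < r by rewrite lee_fin in r1; exact: lt_le_trans r1.
have c0 : 0 <= r * (C + K) `^ (r - 1) * C by rewrite !mulr_ge0 ?powR_ge0// ltW.
apply: (@cvg_powR_rate R _ _ ((r * (C + K) `^ (r - 1) * C) `^ r^-1) (d / r)).
- exact: powR_ge0.
- by rewrite divr_gt0.
- move=> t t1; apply: le_trans (cl t t1) _.
  by rewrite mulrA powRM ?powR_ge0// -powRrM mulNr.
Qed.

Lemma Lq_eq0 (q : \bar R) w A K : (1 <= q)%E -> L1 mu w A -> (forall x, `|w x| <= K) ->
  fine (Lq q w) = 0 -> ae_eq mu setT w (cst 0).
Proof.
move=> q1 hw wK; case: q q1 => [r||]// r1.
  rewrite (Lq_EFin r1 hw wK) /= => /eqP; rewrite lee_fin in r1.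
  have r0 : 0 < r by exact: lt_le_trans r1.
  rewrite powR_eq0 => /andP[/eqP I0 _].
  have hp := L1_pow r1 hw wK.
  have := I_eq0 hp (fun x => powR_ge0 _ _) I0; apply: filterS => x h hx.
  have /eqP := h hx; rewrite powR_eq0 normr_eq0 => /andP[/eqP -> _].
  by [].
move=> E; have E0 : (esssup w = 0)%E.
  by have := Lq_fine (q := +oo%E) (leey _) hw wK; rewrite E.
have B : {ae mu, forall x : V, forall k : nat, `|w x| < k.+1%:R^-1}.
  apply: ae_foralln => k; apply: esssup_lt_ae; first exact: hw.1.
  by rewrite E0 lte_fin invr_gt0.
apply: filterS B => x hx _ /=; apply/eqP; rewrite -normr_le0 leNgt; apply/negP => w0.
have := hx (Num.truncn (`|w x|^-1)); apply/negP; rewrite -leNgt.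
by rewrite invf_ple ?posrE// ltW// truncnS_gt.
Qed.

End Lq_cvg.

(** * Nonvanishing of the profile *)

Section nonvanishing.
Context {R : realType} {n : nat}.
Notation V := 'rV[R]_n.
Notation mu := (rvm n).
Implicit Types (x y : V) (t s r : R).
Variables (a : V) (p M : R).
Hypothesis n0 : (0 < n)%N.
Hypothesis pl : 1 + n%:R^-1 < p.
Hypothesis pu : p < 1 + 3 / (2 * n%:R).
Hypothesis a0 : a != 0.
Hypothesis M0 : M != 0.

Let sg : R := sigma n p.
Let sg0 : 0 < sg. Proof. exact: sigma_gt0. Qed.
Let sg4 : sg < 4^-1. Proof. exact: sigma_lt4. Qed.
Let p1 : 1 < p. Proof. exact: p_gt1 n0 pl. Qed.
Let p0 : 0 < p. Proof. exact: lt_trans ltr01 p1. Qed.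

Let dota := dotv a.

(** The signed factor k is kept apart from the positive one, so that no case on its sign arises; k
    may vanish, as a . y does. *)
Lemma RI_tcut_sign t (F P : R -> R) k B : 0 < t -> L1 leb (tcut t F) B ->
  (forall s, 0 < s -> s < t -> F s = k * P s /\ 0 < P s) -> exists2 Q, 0 < Q & RI leb (tcut t F) = k * Q.
Proof.
move=> t0 hF FP; have [k0|k0] := eqVneq k 0.
  exists 1 => //; rewrite k0 mul0r; have -> : tcut t F = fun=> 0.
    by apply/funext => s; rewrite /tcut; case: ifPn => // /andP[s0 st]; have [-> _] := FP s s0 st; rewrite k0 mul0r.
  exact: I_zero.
have E s : k^-1 * tcut t F s = tcut t P s.
  rewrite /tcut; case: ifPn => [/andP[s0 st]|_]; last by rewrite mulr0.
  by have [-> _] := FP s s0 st; rewrite mulKf.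
have hP := eq_L1 E (L1_scale k^-1 hF).
have P0 s : 0 <= tcut t P s by rewrite /tcut; case: ifPn => // /andP[s0 st]; have [_ /ltW] := FP s s0 st.
exists (RI leb (tcut t P)).
  rewrite lt_def I_ge0// andbT; apply/eqP => I0.
  have [s [s0 st /(_ Logic.I)]] := ae_interval_ex t0 (I_eq0 hP P0 I0).
  by have [_ h] := FP s s0 st; rewrite tcutE// => /eqP; rewrite gt_eqF.
by rewrite -(eq_I leb E) (I_scale k^-1 hF) mulVKf.
Qed.

Let tau_pos t : 0 < t -> 0 < t / p. Proof. by move=> t0; rewrite divr_gt0. Qed.

(** G_t^p is proportional to G_{t/p}; this is the ratio of the normalising factors. *)
Let gpow t : R := (4 * pi * t) `^ (- (n%:R / 2) * p) * ((4 * pi * (t / p)) `^ (- (n%:R / 2)))^-1.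

Let fourpi t : 0 < t -> 0 < 4 * pi * t :> R.
Proof. by move=> t0; rewrite !mulr_gt0// pi_gt0. Qed.

Let gpow_gt0 t : 0 < t -> 0 < gpow t.
Proof. by move=> t0; rewrite mulr_gt0 ?invr_gt0 ?powR_gt0 ?fourpi// tau_pos. Qed.

Lemma gauss_pow t x : 0 < t -> gauss t x `^ p = gpow t * gauss (t / p) x.
Proof.
move=> t0; have cancel (q u v : R) : u != 0 -> q * u^-1 * (u * v) = q * v by move=> h; field.
rewrite !gaussE powRM ?powR_ge0 ?expR_ge0// -powRrM -expRM /gpow cancel.
  by congr (_ * expR _); field; rewrite !gt_eqF.
by rewrite gt_eqF// powR_gt0// fourpi// tau_pos.
Qed.

Let A := @prA R n M.
Let gA s y := fnl p (A s y).
Let A1 := @prA1 R n a p M.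
Let gR s y := (A1 s y - A s y) * derive1 (fnl p) (A s y).

Let gAE s y : 0 < s -> gA s y = fnl p M * gpow s * gauss (s / p) y.
Proof.
move=> s0; rewrite /gA /A /prA fnlM (fnlE p0 (gauss_ge0 _ _)) gauss_pow//.
by rewrite mulrA.
Qed.

(** The source is a multiple of G_{s/p}, so the convolution is a multiple of a . grad G at time s/p
    + r, itself a negative multiple of a . y. *)
Let cnv_gA s r y : 0 < r -> 0 < s -> exists2 P, 0 < P & cnv (K1 a r) (gA s) y = - (fnl p M * dota y) * P.
Proof.
move=> r0 s0; have sp := tau_pos s0; have T0 : 0 < s / p + r by rewrite addr_gt0.
exists (gpow s * (gauss (s / p + r) y / (2 * (s / p + r)))).
  by rewrite mulr_gt0 ?gpow_gt0// divr_gt0 ?gauss_gt0// mulr_gt0.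
have -> : gA s = fun z => (fnl p M * gpow s) * gauss (s / p) z by apply/funext => z; exact: gAE.
rewrite (cnvZ _ y (measurable_K1 a r) (fun z => K1_sup a z r0) (L1_gauss sp)) (cnv_K1_gauss a sp r0) K1E.
by rewrite -/dota; move: (gpow s) (gauss _ y) (dota y) (fnl p M) (2 * _)^-1 => u v w z q; ring.
Qed.

Let tcutA r x : 0 < r -> L1 leb (tcut r (fun s => cnv (K1 a (r - s)) (gA s) x))
  (cS a (n%:R / 2 * (p - 1)) * (`|M| `^ (p - 1) * `|M|) * r `^ (2^-1 - n%:R / 2 * (p - 1)) * r `^ (- (n%:R / 2))).
Proof.
have g0E : n%:R / 2 * (p - 1) = sg + 2^-1 by rewrite /sg /sigma subrK.
move=> r0; apply: scaled_tcut => //.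
- by rewrite g0E addr_ge0// ltW.
- by rewrite g0E; have := sg4; lra.
- by apply: jmeas_fnl; exact: jmeas_prA.
- by move=> s s0 _; apply: (scaled_fnl p1 s0); exact: scaled_A.
Qed.

Let duh_gA s y : 0 < s -> exists2 Q, 0 < Q & duh a gA s y = - (fnl p M * dota y) * Q.
Proof.
move=> s0; rewrite duhE.
have h r : exists P, 0 < r -> r < s -> cnv (K1 a (s - r)) (gA r) y = - (fnl p M * dota y) * P /\ 0 < P.
  have [r0|] := ltP 0 r; last by exists 1 => ?.
  have [rs|] := ltP r s; last by exists 1 => ?.
  have sr : 0 < s - r by rewrite subr_gt0.
  by have [P P0 E] := cnv_gA y sr r0; exists P.
have [P HP] := choice h.
exact: (RI_tcut_sign s0 (tcutA y s0) HP).
Qed.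

Let gRE s y : 0 < s -> exists2 Q, 0 < Q & gR s y = - (fnl p M * dota y) * Q.
Proof.
move=> s0; have [Q Q0 E] := duh_gA y s0.
have G0 : 0 < `|A s y| by rewrite normr_gt0 mulf_neq0// gt_eqF// gauss_gt0.
exists (Q * (p * `|A s y| `^ (p - 1))); first by rewrite !mulr_gt0// powR_gt0.
rewrite /gR (derive1_fnl _ p1) [RHS]mulrA -E; congr (_ * _).
by rewrite /A1 /prA1 addrAC subrr add0r.
Qed.

(** If a . y vanished almost everywhere, so would a . grad G_1, and its convolution a . grad G_2
    would be 0; but at the point a the latter is a nonzero multiple of |a|^2. *)
Let dota_ae : ~ {ae mu, forall y : V, dota y = 0}.
Proof.
move=> h; have E : ae_eq mu setT (K1 a 1) (cst 0).
  by apply: filterS h => y hy _; rewrite K1E -/dota hy oppr0 mul0r mul0r.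
have m0 : measurable_fun setT (cst (0 : R) : V -> R) by exact: measurable_cst.
have c1 := cnv_ae a (measurable_gauss 1) (measurable_K1 a 1) m0 E.
have := cnv_gauss_K1 a ltr01 ltr01 => /(congr1 (fun f : V -> R => f a)) /=.
rewrite c1 cnvE; under eq_I do rewrite mulr0.
rewrite I_zero K1E => /esym/eqP; rewrite mulf_eq0 (gt_eqF (gauss_gt0 _ _)) ?addr_gt0// orbF.
rewrite mulf_eq0 invr_eq0 (gt_eqF (_ : 0 < 2 * (1 + 1))) ?mulr_gt0 ?addr_gt0// orbF oppr_eq0 dotvv => /eqP s0.
move/eqP: a0; apply; apply/rowP => i; rewrite mxE.
have := s0; rewrite /sqnorm => /eqP; rewrite psumr_eq0; last by move=> j _; exact: sqr_ge0.
by move=> /allP/(_ i (mem_index_enum _)) /=; rewrite sqrf_eq0 => /eqP.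
Qed.

Let c2 : 0 <= 2 * sg + 2^-1. Proof. by have := sg0; lra. Qed.
Let c21 : 2 * sg + 2^-1 < 1. Proof. by have := sg4; lra. Qed.

(** At -y the kernel is a positive multiple of a . y, while the source is -f(M) (a . y) times a
    positive function: the product is -f(M) (a . y)^2 times a positive one. The additional unit of
    kernel time comes from e^{Delta}. *)
Let inner s : 0 < s -> s < 1 -> exists2 Z, 0 < Z & cnv (K1 a (1 + (1 - s))) (gR s) 0 = - fnl p M * Z.
Proof.
move=> s0 s1; have r0 : 0 < 1 + (1 - s) by lra.
set r := 1 + (1 - s) in r0 *.
have [C C0 HC] := scaled_gR a n0 pl pu M.
have hg : L1 mu (gR s) _ := (HC s s0).1.
have hF := cnv_intg2 0 (measurable_K1 a r) (fun z => K1_sup a z r0) hg.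
have fM : - fnl p M != 0 by rewrite oppr_eq0 mulf_neq0// powR_eq0 normr_eq0 negb_and M0.
have key y : exists2 Q, 0 < Q & K1 a r (0 - y) * gR s y = - fnl p M * (dota y ^+ 2 * Q).
  have [Q Q0 E] := gRE y s0.
  exists (Q * (gauss r (0 - y) / (2 * r))); first by rewrite mulr_gt0// divr_gt0 ?gauss_gt0// mulr_gt0.
  rewrite E K1E sub0r dotvN opprK -/dota.
  by move: (gauss _ _) (dota y) (fnl p M) (2 * r)^-1 => u v w z; ring.
have key' y : exists Q, 0 < Q /\ K1 a r (0 - y) * gR s y = - fnl p M * (dota y ^+ 2 * Q).
  by have [Q Q0 E] := key y; exists Q.
have [Q HQ] := choice key'.
have E y : (- fnl p M)^-1 * (K1 a r (0 - y) * gR s y) = dota y ^+ 2 * Q y.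
  by have [_ ->] := HQ y; rewrite mulKf.
have hQ := eq_L1 E (L1_scale (- fnl p M)^-1 hF).
have Q0 y : 0 <= dota y ^+ 2 * Q y by have [h _] := HQ y; rewrite mulr_ge0 ?sqr_ge0// ltW.
exists (RI mu (fun y => dota y ^+ 2 * Q y)).
  rewrite lt_def I_ge0// andbT; apply/eqP => I0.
  apply: dota_ae; have := I_eq0 hQ Q0 I0; apply: filterS => y h.
  have [q0 _] := HQ y; have /eqP := h Logic.I.
  by rewrite /= mulf_eq0 (gt_eqF q0) orbF sqrf_eq0 => /eqP.
by rewrite cnvE -(eq_I mu E) (I_scale (- fnl p M)^-1 hF) mulVKf.
Qed.

(** Applying e^{Delta} turns vanishing almost everywhere into vanishing at the origin, where [inner]
    gives every time slice the sign of -f(M). *)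
Lemma prR_nonnull : ~ ae_eq mu setT (prR a p M 1) (cst 0).
Proof.
move=> h; have [C C0 HC] := scaled_gR a n0 pl pu M.
have m0 : measurable_fun setT (cst (0 : R) : V -> R) by exact: measurable_cst.
have [C' _ [hL _]] := scaled_prR1 a n0 pl pu M.
have c1 := cnv_ae 0 (measurable_gauss 1) hL.1 m0 h.
have mg : jmeas gR by exact: jmeas_gR.
have gb s : 0 < s -> s < 1 -> L1 mu (gR s) (C * s `^ (- (2 * sg + 2^-1))) by move=> s0 _; exact: (HC s s0).1.
have cC : 0 <= cK a * C by rewrite mulr_ge0 ?cK_ge0.
have hB : L1 leb (tcut 1 (fun s => cK a * (1 - s) `^ (- 2^-1) * (C * s `^ (- (2 * sg + 2^-1)))))
    (cK a * C * (cB (2 * sg + 2^-1) * 1 `^ (2^-1 - (2 * sg + 2^-1)))).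
  by apply: eq_L1cut (L1_cut_scale (L1_cut_beta c2 c21 ltr01) cC) => s _ _; ring.
have [E LE] := duh_cnv mg gb hB 0 (measurable_gauss 1) (fun z => gauss_sup z ltr01).
have hs s : exists Z, 0 < s -> s < 1 -> cnv (gauss 1) (cnv (K1 a (1 - s)) (gR s)) 0 = - fnl p M * Z /\ 0 < Z.
  have [s0|] := ltP 0 s; last by exists 1 => ?.
  have [s1|] := ltP s 1; last by exists 1 => ?.
  have r0 : 0 < 1 - s by rewrite subr_gt0.
  have [Z Z0 EZ] := inner s0 s1; exists Z => _ _; split=> //.
  by apply: etrans (heat_adheat a 0 ltr01 r0 (gb s s0 s1)) EZ.
have [Z HZ] := choice hs.
have [Q Q0 EQ] := RI_tcut_sign ltr01 LE HZ.
have : cnv (gauss 1) (prR a p M 1) 0 = - fnl p M * Q := etrans E EQ.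
rewrite c1 cnvE; under eq_I do rewrite mulr0.
rewrite I_zero => /esym/eqP; rewrite mulf_eq0 (gt_eqF Q0) orbF oppr_eq0.
by rewrite mulf_eq0 powR_eq0 normr_eq0 (negbTE M0).
Qed.

End nonvanishing.

(** * Conclusion *)

Section asymptotics.
Context {R : realType} {n : nat}.
Notation V := 'rV[R]_n.
Notation mu := (rvm n).
Implicit Types (x y : V) (t s r : R).

Lemma L1_of_Lq1 (g : V -> R) : rn_measurable g -> (Lq 1%E g < +oo)%E -> exists B, L1 mu g B.
Proof.
move=> /(rn_measurableE g).1 mg; rewrite (Lq1E mg) => h.
exists (fine (\int[mu]_x (`|g x|)%:E)); split=> //.
by rewrite fineK// ge0_fin_numE//; exact: integral_ge0.
Qed.

Lemma M0E (u0 : V -> R) B : L1 mu u0 B -> M0 u0 = RI mu u0.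
Proof. by move=> h; rewrite /M0 /iintR iintE//; exact: L1_Itg h. Qed.

Variables (a : V) (p : R) (u0 : V -> R).
Hypothesis n0 : (0 < n)%N.
Hypothesis pl : 1 + n%:R^-1 < p.
Hypothesis pu : p < 1 + 3 / (2 * n%:R).

Let sg : R := sigma n p.
Let sg0 : 0 < sg. Proof. exact: sigma_gt0. Qed.
Let sg4 : sg < 4^-1. Proof. exact: sigma_lt4. Qed.
Let p1 : 1 < p. Proof. exact: p_gt1 n0 pl. Qed.
Let p0 : 0 < p. Proof. exact: lt_trans ltr01 p1. Qed.
Let M := M0 u0.

Lemma A01E t x : A01 p a u0 t x = prA1 a p M t x.
Proof.
rewrite /A01 /prA1; congr (_ + _); apply: duhamelE.
- by apply: jmeas_fnl; exact: jmeas_prA.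
- by move=> s s0 _; eexists; exact: (scaled_fnl p1 s0 (scaled_A M s0)).1.
- by move=> s s0 _; split; [exact: (jmeas_meas s (jmeas_fnl p (jmeas_prA M)))|exact: ae_eq_refl].
Qed.

Lemma RstarE x : Rstar p a u0 x = prR a p M 1 x.
Proof.
rewrite /Rstar; have -> : (fun th y => (A01 p a u0 th y - A0 u0 th y) * derive1 (fnl p) (A0 u0 th y)) =
    (fun s y => (prA1 a p M s y - prA M s y) * derive1 (fnl p) (prA M s y)).
  by apply/funext => s; apply/funext => y; rewrite A01E.
have [C C0 HC] := scaled_gR a n0 pl pu M.
apply: duhamelE; first exact: jmeas_gR.
- by move=> s s0 _; eexists; exact: (HC s s0).1.
- by move=> s s0 _; split; [exact: (jmeas_meas s (jmeas_gR a n0 pl M))|exact: ae_eq_refl].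
Qed.

Let G1 s y := fnl p (prA 1 s y).

Let G1E s y : G1 s y = gauss s y `^ p.
Proof. by rewrite /G1 /prA mul1r fnlE// gauss_ge0. Qed.

(** The source in the second formula for the profile. By [hprE] it is a multiple of the source of
    [prR] for mass 1, whose bounds it inherits. *)
Let hpr s y := gauss s y `^ (p - 1) * duh a G1 s y.

Let hprE s y : hpr s y = p^-1 * ((prA1 a p 1 s y - prA 1 s y) * derive1 (fnl p) (prA 1 s y)).
Proof.
have E : prA1 a p 1 s y - prA 1 s y = duh a G1 s y by rewrite /prA1 addrAC subrr add0r.
have E2 : derive1 (fnl p) (prA 1 s y) = p * gauss s y `^ (p - 1).
  by rewrite (derive1_fnl _ p1) /prA mul1r (ger0_norm (gauss_ge0 _ _)).
by rewrite E E2 [_ * (p * _)]mulrC -mulrA mulKf ?gt_eqF.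
Qed.

Let scaled_hpr : exists2 C, 0 <= C & forall s, 0 < s -> scaled s (C * s `^ (- (2 * sg + 2^-1))) (hpr s).
Proof.
have [C C0 HC] := scaled_gR a n0 pl pu 1.
exists (`|p^-1| * C); first exact: mulr_ge0.
move=> s s0; rewrite -mulrA; apply: eq_sb (scaled_scale p^-1 (HC s s0)) => y.
by rewrite hprE.
Qed.

Let jmeas_hpr : jmeas hpr.
Proof.
have h := measurable_funM (measurable_cst p^-1) (jmeas_gR a n0 pl 1).
by apply: eq_measurable_fun h => -[s y] _; rewrite /= hprE.
Qed.

Let c2 : 0 <= 2 * sg + 2^-1. Proof. by have := sg0; lra. Qed.
Let c21 : 2 * sg + 2^-1 < 1. Proof. by have := sg4; lra. Qed.

(** f is multiplicative, so the mass factors out of the source. *)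
Let duh_G1 s y : 0 < s -> duh a (fun s y => fnl p (prA M s y)) s y = fnl p M * duh a G1 s y.
Proof.
move=> s0; have g0E : n%:R / 2 * (p - 1) = sg + 2^-1 by rewrite /sg /sigma subrK.
have -> : (fun s y => fnl p (prA M s y)) = (fun s y => fnl p M * G1 s y).
  by apply/funext => r; apply/funext => z; rewrite /G1 /prA mul1r fnlM.
have l : L1 leb (tcut s (fun r => cnv (K1 a (s - r)) (G1 r) y))
  (cS a (n%:R / 2 * (p - 1)) * (`|1| `^ (p - 1) * `|1|) * s `^ (2^-1 - n%:R / 2 * (p - 1)) * s `^ (- (n%:R / 2))).
  apply: scaled_tcut => //.
  - by rewrite g0E addr_ge0// ltW.
  - by rewrite g0E; have := sg4; lra.
  - by apply: jmeas_fnl; exact: jmeas_prA.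
  - by move=> r r0 _; apply: (scaled_fnl p1 r0); exact: scaled_A.
by apply: (duh_mull _ _ l) => r r0 _; eexists; exact: (scaled_fnl p1 r0 (scaled_A 1 r0)).1.
Qed.

Lemma Rstar_formula x : Rstar p a u0 x = fnl p (M0 u0) * derive1 (fnl p) (M0 u0) *
  duhamel a (fun th y => gauss th y `^ (p - 1) * duhamel a (fun tau z => gauss tau z `^ p) th y) 1 x.
Proof.
rewrite RstarE -/M.
have [C C0 HC] := scaled_hpr.
have E1 th y : duhamel a (fun tau z => gauss tau z `^ p) th y = duh a G1 th y.
  have -> : (fun tau (z : V) => gauss tau z `^ p) = G1 by apply/funext => s; apply/funext => z; rewrite G1E.
  apply: duhamelE; first by apply: jmeas_fnl; exact: jmeas_prA.
  - by move=> s s0 _; eexists; exact: (scaled_fnl p1 s0 (scaled_A 1 s0)).1.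
  - by move=> s s0 _; split; [exact: (jmeas_meas s (jmeas_fnl p (jmeas_prA 1)))|exact: ae_eq_refl].
have -> : (fun th y => gauss th y `^ (p - 1) * duhamel a (fun tau z => gauss tau z `^ p) th y) = hpr.
  by apply/funext => th; apply/funext => y; rewrite E1.
have -> : duhamel a hpr 1 x = duh a hpr 1 x.
  apply: duhamelE; first exact: jmeas_hpr.
  - by move=> s s0 _; eexists; exact: (HC s s0).1.
  - by move=> s s0 _; split; [exact: (jmeas_meas s jmeas_hpr)|exact: ae_eq_refl].
have l := scaled_tcut a x c2 c21 C0 ltr01 jmeas_hpr (fun s (sp : 0 < s) _ => HC s sp).
have hL s : 0 < s -> s < 1 -> exists b, L1 mu (hpr s) b by move=> s0 _; eexists; exact: (HC s s0).1.
apply: etrans (duh_mull (fnl p M * derive1 (fnl p) M) hL l).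
rewrite /prR !duhE; congr RI; apply: eq_cut => s s0 s1; congr (cnv _ _ x).
apply/funext => y.
have e1 : prA1 a p M s y - prA M s y = fnl p M * duh a G1 s y by rewrite -duh_G1// /prA1 addrAC subrr add0r.
have e2 : derive1 (fnl p) (prA M s y) = derive1 (fnl p) M * gauss s y `^ (p - 1).
  by rewrite !(derive1_fnl _ p1) /prA normrM powRM// (ger0_norm (gauss_ge0 _ _)) mulrA.
by rewrite e1 e2 mulrACA [duh a G1 s y * _]mulrC.
Qed.

Variable u : R -> V -> R.
Hypothesis mu0 : rn_measurable u0.
Hypothesis iu0 : (Lq 1%E u0 < +oo)%E.
Hypothesis xu0 : forall j : 'I_n, (Lq 1%E (fun x : V => (x 0 j * u0 x)%R) < +oo)%E.
Hypothesis usol : global_solution p a u0 u.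

Let D q t := Lq q (fun x => (u t x - A01 p a u0 t x)%R).

(** One rescaled function serves all q. It is built from the regular version U, equal to u almost
    everywhere, and it differs from the profile by a negative power of t in L^1 and pointwise. *)
Lemma rescaled_limit : exists2 om' : R -> V -> R,
  (forall (q : \bar R) t, (1 <= q)%E -> 0 < t ->
    ((t `^ (n%:R / 2 * (1 - inv_exp q) + 2 * sg))%:E * D q t = Lq q (om' t))%E) &
  (forall q : \bar R, (1 <= q)%E -> (forall t, 1 <= t -> Lq q (om' t) = (fine (Lq q (om' t)))%:E) /\
    fine (Lq q (om' t)) @[t --> +oo] --> fine (Lq q (Rstar p a u0))).
Proof.
have [B0 hu0] := L1_of_Lq1 mu0 iu0.
have mx j : rn_measurable (fun x : V => x 0 j * u0 x).
  by apply/rn_measurableE; apply: measurable_funM; [exact: measurable_coord|apply/rn_measurableE].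
have [m hm] := choice (fun j => L1_of_Lq1 (mx j) (xu0 j)).
have [U [N1 [K [reg nU]]]] := regular_solution p1 hu0 usol.
have [C [d [C0 d0 HE]]] := expansion n0 pl pu hu0 hm (M0E hu0) reg.
pose w t x := U t x - prA1 a p M t x.
have [CA CA0 HA] := scaled_prA1B a n0 pl pu M.
have [mU UL UK UE] := reg.
have RE : Rstar p a u0 = prR a p M 1 by apply/funext => x; exact: RstarE.
have [CR CR0 [hR1 hR2]] := scaled_prR1 a n0 pl pu M.
exists (rescaled p w).
  move=> q t q1 t0; pose E t := `|M| + CA * t `^ (- sg).
  have hA1 : scaled t (E t) (prA1 a p M t).
    by apply: eq_sb (scaled_add (scaled_A M t0) (HA t t0)) => x; rewrite -/(prA M t x) addrC subrK.
  have hw := L1_sub (UL t t0) hA1.1.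
  have wb x : `|w t x| <= K + E t * t `^ (- (n%:R / 2)).
    by apply: le_trans (ler_normB _ _) _; apply: lerD; [exact: UK|exact: hA1.2].
  apply: etrans (Lq_scale (2 * sg) q1 t0 hw wb); congr (_ * _)%E.
  apply: Lq_null => //.
  - apply: measurable_funB; first by apply/rn_measurableE; case: usol => h _ _ _; apply: h; exact: ltW.
    by apply: eq_measurable_fun (hA1.1.1) => x _; rewrite A01E.
  - exact: hw.1.
  - apply: rn_null_sub (nU t t0) => x /= h E'; apply: h.
    by rewrite /w E' A01E.
move=> q q1; rewrite RE.
have hR2' x : `|prR a p M 1 x| <= CR by have := hR2 x; rewrite powR1 mulr1.
apply: (Lq_cvg n0 q1 hR1 hR2' C0 d0) => t t1.
have t0 : 0 < t by exact: lt_le_trans t1.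
exact: (rescaled_dist n0 pl pu t0 (HE t t0)).
Qed.

Lemma Lq_Rstar_fine (q : \bar R) : (1 <= q)%E -> Lq q (Rstar p a u0) = (fine (Lq q (Rstar p a u0)))%:E.
Proof.
have RE : Rstar p a u0 = prR a p M 1 by apply/funext => x; exact: RstarE.
have [CR CR0 [hR1 hR2]] := scaled_prR1 a n0 pl pu M.
have hR2' x : `|prR a p M 1 x| <= CR by have := hR2 x; rewrite powR1 mulr1.
by move=> q1; rewrite RE; exact: (Lq_fine n0 q1 hR1 hR2').
Qed.

Lemma Rstar_nonnull : a != 0 -> fnl p M * derive1 (fnl p) M != 0 ->
  (exists x, Rstar p a u0 x != 0) /\ forall q : \bar R, (1 <= q)%E -> fine (Lq q (Rstar p a u0)) != 0.
Proof.
move=> a0; rewrite mulf_eq0 negb_or => /andP[fM _].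
have Mn : M != 0 by apply: contra_neq fM => ->; exact: fnl0.
have RE : Rstar p a u0 = prR a p M 1 by apply/funext => x; exact: RstarE.
have nn := prR_nonnull n0 pl pu a0 Mn.
have [CR CR0 [hR1 hR2]] := scaled_prR1 a n0 pl pu M.
have hR2' x : `|prR a p M 1 x| <= CR by have := hR2 x; rewrite powR1 mulr1.
rewrite RE; split.
  apply: contrapT => h; apply: nn; apply: aeW => x _; apply/eqP.
  by apply: contrapT => /negP hx; apply: h; exists x.
by move=> q q1; apply/eqP => E0; apply: nn; exact: (Lq_eq0 n0 q1 hR1 hR2' E0).
Qed.

Lemma main_limit (q : \bar R) : (1 <= q)%E ->
  (fun t : R => ((t `^ (n%:R / 2 * (1 - inv_exp q) + 2 * sg))%:E * D q t)%E) @ +oo --> Lq q (Rstar p a u0).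
Proof.
move=> q1; have [om' h1 h2] := rescaled_limit; have [h3 h4] := h2 q q1.
rewrite (Lq_Rstar_fine q1); apply/fine_cvgP; split.
  near=> t; have t1 : 1 < t by near: t; exact: nbhs_pinfty_gt.
  by rewrite (h1 q t q1 (lt_trans ltr01 t1)) (h3 t (ltW t1)).
apply: cvg_trans h4; apply: near_eq_cvg; near=> t.
have t1 : 1 < t by near: t; exact: nbhs_pinfty_gt.
by rewrite /= (h1 q t q1 (lt_trans ltr01 t1)).
Unshelve. all: by end_near. Qed.

Lemma main_rate (q : \bar R) : (1 <= q)%E -> fine (Lq q (Rstar p a u0)) != 0 ->
  exists eps : R -> R, eps @ +oo --> 0 /\ \forall t \near (+oo : set_system R),
    ((t `^ (n%:R / 2 * (1 - inv_exp q)))%:E * D q t)%E =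
    ((t `^ (- (2 * sg)) * (1 + eps t))%:E * Lq q (Rstar p a u0))%E.
Proof.
move=> q1 l0; have [om' h1 h2] := rescaled_limit; have [h3 h4] := h2 q q1.
set l := fine (Lq q (Rstar p a u0)) in l0 h4.
(* The relative error of the rescaled norm with respect to its nonzero limit l. *)
exists (fun t => fine (Lq q (om' t)) / l - 1); split.
  have -> : 0 = l / l - 1 :> R by rewrite divff// subrr.
  by apply: cvgB; [apply: cvgMl|exact: cvg_cst].
near=> t; have t1 : 1 < t by near: t; exact: nbhs_pinfty_gt.
have t0 : 0 < t by exact: lt_trans ltr01 t1.
rewrite (Lq_Rstar_fine q1) -/l.
have -> : t `^ (n%:R / 2 * (1 - inv_exp q)) = t `^ (- (2 * sg)) * t `^ (n%:R / 2 * (1 - inv_exp q) + 2 * sg).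
  by rewrite -powRD ?(gt_eqF t0) ?implybT//; congr (_ `^ _); ring.
rewrite EFinM -muleA (h1 q t q1 t0) (h3 t (ltW t1)) -!EFinM; congr EFin.
by rewrite addrC subrK -mulrA divfK.
Unshelve. all: by end_near. Qed.

End asymptotics.

Theorem theorem2p5 (R : realType) (n : nat) (a : 'rV[R]_n) (p : R)
  (u0 : 'rV[R]_n -> R) (u : R -> 'rV[R]_n -> R) :
  (0 < n)%N -> a != 0 ->
  1 + n%:R^-1 < p -> p < 1 + 3 / (2 * n%:R) ->
  (* u0 in L^1_1 cap L^oo *)
  rn_measurable u0 -> (Lq 1%E u0 < +oo)%E ->
  (forall j : 'I_n, (Lq 1%E (fun x : 'rV[R]_n => (x 0 j * u0 x)%R) < +oo)%E) ->
  (Lq +oo%E u0 < +oo)%E ->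
  global_solution p a u0 u ->
  [/\ (* main asymptotics *)
      forall q : \bar R, (1 <= q)%E ->
        (fun t : R => ((t `^ (n%:R / 2 * (1 - inv_exp q) + 2 * sigma n p))%:E
           * Lq q (fun x => (u t x - A01 p a u0 t x)%R))%E)
          @ +oo --> Lq q (Rstar p a u0),
      (* the second formula for R*_{0,2} *)
      (forall x, Rstar p a u0 x =
         fnl p (M0 u0) * derive1 (fnl p) (M0 u0) *
         duhamel a (fun th y => gauss th y `^ (p - 1) *
                      duhamel a (fun tau z => gauss tau z `^ p) th y) 1 x) &
      (* "in particular" *)
      (fnl p (M0 u0) * derive1 (fnl p) (M0 u0) != 0 ->
         (exists x, Rstar p a u0 x != 0) /\
         forall q : \bar R, (1 <= q)%E ->
           exists eps : R -> R, eps @ +oo --> 0 /\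
             \forall t \near (+oo : set_system R),
               ((t `^ (n%:R / 2 * (1 - inv_exp q)))%:E
                  * Lq q (fun x => (u t x - A01 p a u0 t x)%R))%E
               = ((t `^ (- (2 * sigma n p)) * (1 + eps t))%:E
                  * Lq q (Rstar p a u0))%E)].
Proof.
move=> n0 a0 pl pu mu0 iu0 xu0 _ usol; split.
- by move=> q q1; exact: (main_limit n0 pl pu mu0 iu0 xu0 usol q1).
- by move=> x; exact: (Rstar_formula a u0 n0 pl pu x).
- move=> h; have [h1 h2] := Rstar_nonnull n0 pl pu a0 h; split=> // q q1.
  exact: (main_rate n0 pl pu mu0 iu0 xu0 usol q1 (h2 q q1)).
Qed.
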